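(* Let $k\ge 3$. Then the initial value problem $$u_t+\partial_x\Delta u+u^ku_x=0,\quad (x,y)\in\mathbb{R}^2,\ t>0,\qquad u(x,y,0)=u_0(x,y),$$ is ill-posed for data in $H^{s_c(k)}(\mathbb{R}^2)$, $s_c(k)=1-2/k$, in the sense that the map data-solution is not uniformly continuous.
   Context: Here $k$ is an integer, $u$ is a real-valued function, $\Delta=\partial_x^2+\partial_y^2$, $u_x=\partial_xu$, and $H^s(\mathbb{R}^2)$ is the usual $L^2$-based Sobolev space of order $s$. The map data-solution is the map taking an initial datum $u_0$ to the corresponding solution $u$ of the initial value problem. *)

(* Defs.v *)
From HB Require Import structures.
From mathcomp Require Import all_boot all_order all_algebra.
From mathcomp Require Import all_classical all_reals all_analysis.
Import Order.TTheory GRing.Theory Num.Theory numFieldNormedType.Exports.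

Set Implicit Arguments.
Unset Strict Implicit.
Unset Printing Implicit Defensive.

Local Open Scope classical_set_scope.
Local Open Scope ring_scope.

Notation leb2 R :=
  (@lebesgue_measure R \x @lebesgue_measure R)%E (only parsing).

Definition dx (R : realType) (f : R * R -> R) : R * R -> R :=
  'D_((1, 0) : R * R) f.
Definition dy (R : realType) (f : R * R -> R) : R * R -> R :=
  'D_((0, 1) : R * R) f.
Definition laplacian (R : realType) (f : R * R -> R) : R * R -> R :=
  fun p => dx (dx f) p + dy (dy f) p.

Definition iter_derive (R : realType) (vs : seq (R * R)) (f : R * R -> R) :
    R * R -> R :=
  foldr (fun v g => 'D_v g) f vs.

Definition ndifferentiable (R : realType) (n : nat) (f : R * R -> R) : Prop :=
  forall vs : seq (R * R), (size vs < n)%N ->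
  forall p, differentiable (iter_derive vs f) p.

Definition smooth (R : realType) (f : R * R -> R) : Prop :=
  forall n, ndifferentiable n f.

Definition schwartz (R : realType) (f : R * R -> R) : Prop :=
  smooth f /\
  forall (vs : seq (R * R)) (n : nat), exists C : R,
    forall p, (1 + `|p|) ^+ n * `|iter_derive vs f p| <= C.

(** The convention is f^(xi) = (2 pi)^-1 \int f(p) exp(- i p.xi) dp, which is
    unitary on L^2(R^2). All functions that are transformed are real-valued,
    so f^ is handled through its real and imaginary parts. *)

Definition dotp (R : realType) (p q : R * R) : R := p.1 * q.1 + p.2 * q.2.

Definition fourier_re (R : realType) (f : R * R -> R) (xi : R * R) : R :=
  (2 * pi)^-1 * \int[leb2 R]_p (f p * cos (dotp p xi)).
Definition fourier_im (R : realType) (f : R * R -> R) (xi : R * R) : R :=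
  - ((2 * pi)^-1 * \int[leb2 R]_p (f p * sin (dotp p xi))).

(** [is_fourierL2 f g h]: g + i h is the Fourier transform, in the sense of
    tempered distributions, <f^, phi> = <f, phi^>, of the L^2 function f. Real
    test functions suffice by linearity. The integrals above may diverge for
    f in L^2, but they are absolutely convergent for the test functions. *)
Definition is_fourierL2 (R : realType) (f g h : R * R -> R) : Prop :=
  [/\ f \in Lfun (leb2 R) 2%:E, g \in Lfun (leb2 R) 2%:E,
      h \in Lfun (leb2 R) 2%:E &
   forall phi : R * R -> R, schwartz phi ->
     \int[leb2 R]_xi (g xi * phi xi) = \int[leb2 R]_p (f p * fourier_re phi p)
     /\
     \int[leb2 R]_xi (h xi * phi xi) = \int[leb2 R]_p (f p * fourier_im phi p)].

(** ||f||_{H^s} = || (1 + |xi|^2)^(s/2) |f^| ||_{L^2}. The Fourier transform of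
    an L^2 function is unique up to a null set, so the infimum ranges over a
    single value; it is +oo when f is not in L^2. Hence, for s >= 0, f is in
    H^s exactly when its norm is finite. *)

Definition sobolev_norm (R : realType) (s : R) (f : R * R -> R) : \bar R :=
  ereal_inf [set N | exists g h : R * R -> R, is_fourierL2 f g h /\
    N = 'N[leb2 R]_(2%:E)[EFin \o (fun xi : R * R =>
          (1 + (xi.1 ^+ 2 + xi.2 ^+ 2)) `^ (s / 2)
          * Num.sqrt (g xi ^+ 2 + h xi ^+ 2))%R]%E].

Definition memHs (R : realType) (s : R) (f : R * R -> R) : Prop :=
  (sobolev_norm s f < +oo)%E.

Definition continuous_Hs (R : realType) (s T : R) (u : R -> R * R -> R) :
    Prop :=
  (forall t, t \in `[0, T] -> memHs s (u t)) /\
  (forall t0, t0 \in `[0, T] ->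
     sobolev_norm s (u t \- u t0) @[t --> within `[0, T]%classic (nbhs t0)]
       --> 0%E).

Definition sup_dist_Hs (R : realType) (s T : R) (u v : R -> R * R -> R) :
    \bar R :=
  ereal_sup [set sobolev_norm s (u t \- v t) | t in `[0, T]%classic].

Definition solves_gZK (R : realType) (k : nat) (T : R) (u : R -> R * R -> R) :
    Prop :=
  forall t p, 0 < t < T ->
    [/\ ndifferentiable 3 (u t), derivable (fun s => u s p) t 1 &
     'D_1 (fun s => u s p) t + dx (laplacian (u t)) p + u t p ^+ k * dx (u t) p
     = 0].

(** The graph of the map data-solution. It is set up on regular solutions,
    u in C([0,T]; H^s) for every s: in that class a solution is determined by
    its initial datum (L^2 energy estimate for the difference of two
    solutions), so that this relation is the graph of a map. Its domain is a
    subset of every H^s, and any map extending it to rougher data inherits a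
    failure of uniform continuity. *)
Definition data_solution (R : realType) (k : nat) (T : R) :
    set ((R * R -> R) * (R -> R * R -> R)) :=
  [set d | [/\ d.2 0 = d.1, solves_gZK k T d.2 &
               forall s, 0 <= s -> continuous_Hs s T d.2]].

(** S is the graph of a map into C([0,T]; H^s). As usual for data-solution maps,
    uniform continuity means uniform continuity on bounded sets of data; its
    negation implies that the map is not uniformly continuous on its whole
    domain. *)
Definition uniformly_continuous_Hs (R : realType) (s T : R)
    (S : set ((R * R -> R) * (R -> R * R -> R))) : Prop :=
  forall M e : R, 0 < e -> exists2 d : R, 0 < d &
    forall u0 u v0 v, S (u0, u) -> S (v0, v) ->
      (sobolev_norm s u0 <= M%:E)%E -> (sobolev_norm s v0 <= M%:E)%E ->
      (sobolev_norm s (u0 \- v0)%R < d%:E)%E ->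
      (sup_dist_Hs s T u v < e%:E)%E.

Definition s_crit (R : realType) (k : nat) : R := 1 - 2 / k%:R.

(* Main.v *)
(** Solitary waves at two nearby scales. Let Phi be the radial ground state of
    Lap Phi = Phi - Phi^(k+1) and, for l > 0,
      U_l(x, y) = (k+1)^(1/k) l^(2/k) Phi(l x, l y).
    Then U_l(x - l^2 t, y) solves the equation, and its norm in the critical
    space H^(1-2/k) is bounded in l >= 1. Start the waves of scales n and n + 1
    from the same centre. By scaling, the initial data differ in the critical
    norm as Phi does from its dilation by n / (n + 1), hence by o(1). At time T
    the centres are (2n + 1) T apart, which is much larger than the width 1/n of
    the waves, so that the waves have decoupled: tested against a Schwartz
    function living at frequencies of order n, their difference keeps a
    norm bounded below.

    Phi = w((x^2 + y^2) / 4) for a positive decreasing solution w of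
    (s w')' = w - w^(k+1) on [0, +oo[, found by shooting on w(0). Since w'(s) is
    the average of w - w^(k+1) over [0, s], the singular point s = 0 is harmless:
    w is smooth on a neighbourhood of [0, +oo[, and Phi is a Schwartz function. *)

Require Import Defs.
From HB Require Import structures.
From mathcomp Require Import all_boot all_order all_algebra.
From mathcomp Require Import all_classical all_reals all_analysis.
From mathcomp Require Import measurable_realfun.
From mathcomp Require Import ring lra.
Import Order.TTheory GRing.Theory Num.Theory numFieldNormedType.Exports.

Set Implicit Arguments.
Unset Strict Implicit.
Unset Printing Implicit Defensive.

Local Open Scope classical_set_scope.
Local Open Scope ring_scope.

(** * Calculus of one variable *)

(** The Sobolev norm is an infimum over candidate transforms, so it is handled from two sides. From
    above, the transform of a wave is explicit: its centre enters as a modulation and its scale [l]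
    as a dilation of one even function, [amplitude]; once the frequencies are dilated by [l], every
    estimate is uniform up to a power of [l], which the critical exponent cancels. From below,
    duality bounds the pairing with a test function by the norm. The sign of [amplitude] is known
    only near 0, so the test function sits at frequencies [e * n] with a fixed small [e].

    The energy of the radial equation decreases, which separates the solutions that cross 0 from
    those that never do; a starting value between the two kinds gives the ground state. In dimension
    two a solution of given flux falls only logarithmically, so the upper end of the shooting range
    must be exponentially large for the solution to cross. Decay of the ground state follows from
    the nonnegativity of its energy. *)

Section RealDerivatives.
Context {R : realType}.
Implicit Types (f g : R -> R) (x a b c : R).

Lemma is_derive_continuous f x a : is_derive x 1 f a -> {for x, continuous f}.
Proof. by move=> h; apply: differentiable_continuous; apply/derivable1_diffP; case: h. Qed.

Lemma continuous_at_mul f g x : {for x, continuous f} -> {for x, continuous g} ->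
  continuous_at x (fun y => f y * g y).
Proof. exact: continuousM. Qed.

Lemma continuous_at_cst c x : continuous_at x (fun _ : R => c).
Proof. exact: cst_continuous. Qed.

Lemma continuous_at_comp f g x : {for g x, continuous f} -> {for x, continuous g} ->
  continuous_at x (fun y => f (g y)).
Proof. by move=> cf cg; apply: continuous_comp. Qed.

Lemma derive_eq f x a b : is_derive x 1 f a -> a = b -> is_derive x 1 f b.
Proof. by move=> h <-. Qed.

Lemma derive_cst c x : is_derive x 1 (fun _ => c) 0.
Proof. exact: is_derive_cst. Qed.

Lemma derive_id x : is_derive x 1 (fun s => s) 1.
Proof. exact: is_derive_id. Qed.

Lemma derive_add f g x a b : is_derive x 1 f a -> is_derive x 1 g b ->
  is_derive x 1 (fun s => f s + g s) (a + b).
Proof. by move=> h1 h2; apply: is_deriveD. Qed.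

Lemma derive_sub f g x a b : is_derive x 1 f a -> is_derive x 1 g b ->
  is_derive x 1 (fun s => f s - g s) (a - b).
Proof. by move=> h1 h2; apply: is_deriveB. Qed.

Lemma derive_mul f g x a b : is_derive x 1 f a -> is_derive x 1 g b ->
  is_derive x 1 (fun s => f s * g s) (a * g x + f x * b).
Proof.
move=> h1 h2; apply: (derive_eq (@is_deriveM _ _ f g x 1 a b h1 h2)).
by rewrite addrC; congr (_ + _); rewrite /GRing.scale /= mulrC.
Qed.

Lemma derive_scale c f x a : is_derive x 1 f a ->
  is_derive x 1 (fun s => c * f s) (c * a).
Proof.
move=> h; apply: (derive_eq (derive_mul (derive_cst c x) h)).
by rewrite mul0r add0r.
Qed.

Lemma derive_comp f g x a b : is_derive (g x) 1 f a -> is_derive x 1 g b ->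
  is_derive x 1 (fun s => f (g s)) (a * b).
Proof. by move=> h1 h2; apply: is_derive1_comp. Qed.

Lemma derive_ext f g x a : (forall y, f y = g y) -> is_derive x 1 f a -> is_derive x 1 g a.
Proof. by move=> /funext ->. Qed.

Lemma derive_exp f n x a : is_derive x 1 f a ->
  is_derive x 1 (fun s => f s ^+ n) (n%:R * f x ^+ n.-1 * a).
Proof.
move=> h; elim: n => [|n IH]; first by rewrite !mul0r; apply: derive_cst.
apply: (@derive_ext (fun s => f s * f s ^+ n)) => [y|]; first by rewrite exprS.
apply: (derive_eq (derive_mul h IH)); case: n IH => [|n] IH /=.
  by rewrite !expr0 !mul0r; lra.
by rewrite (exprS _ n) -(natr1 n.+1); ring.
Qed.

Lemma derive_near f g x a : (\forall y \near x, f y = g y) ->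
  is_derive x 1 f a -> is_derive x 1 g a.
Proof. move=> fg; exact: near_eq_is_derive. Qed.

Lemma derive_near_itv f g u v x a : u < x < v -> (forall y, u < y < v -> f y = g y) ->
  is_derive x 1 f a -> is_derive x 1 g a.
Proof.
move=> xuv fg; apply: derive_near.
have xI : x \in `]u, v[ by rewrite in_itv.
by have := near_in_itvoo xI; apply: filterS => y; rewrite in_itv => /fg.
Qed.

Lemma mean_value f df a b : a < b ->
  (forall x, a <= x <= b -> is_derive x 1 f (df x)) ->
  exists2 c, a < c < b & f b - f a = df c * (b - a).
Proof.
move=> ab h; have [||c] := @MVT R f df a b ab.
- by move=> x; rewrite in_itv /= => /andP[ax xb]; apply: h; rewrite !ltW.
- apply: continuous_in_subspaceT => x; rewrite inE /= in_itv /= => /h.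
  exact: is_derive_continuous.
by rewrite in_itv /= => cab e; exists c.
Qed.

Lemma nondecreasing_derive f df a b : a <= b ->
  (forall x, a <= x <= b -> is_derive x 1 f (df x)) ->
  (forall x, a < x < b -> 0 <= df x) -> f a <= f b.
Proof.
rewrite le_eqVlt => /orP[/eqP -> //|ab] h p.
have [c cab e] := mean_value ab h.
by rewrite -subr_ge0 e mulr_ge0 ?p// subr_ge0 ltW.
Qed.

Lemma nonincreasing_derive f df a b : a <= b ->
  (forall x, a <= x <= b -> is_derive x 1 f (df x)) ->
  (forall x, a < x < b -> df x <= 0) -> f b <= f a.
Proof.
rewrite le_eqVlt => /orP[/eqP -> //|ab] h p.
have [c cab e] := mean_value ab h.
by rewrite -subr_le0 e mulr_le0_ge0 ?p// subr_ge0 ltW.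
Qed.

Lemma derive0_constant f a b : a <= b ->
  (forall x, a <= x <= b -> is_derive x 1 f 0) -> f b = f a.
Proof.
move=> ab h; apply/eqP; rewrite eq_le.
by rewrite (nonincreasing_derive ab h)// (nondecreasing_derive ab h).
Qed.

Lemma continuous_lipschitz f M : (forall x y, `|f x - f y| <= M * `|x - y|) -> continuous f.
Proof.
move=> h x; apply/cvgrPdist_lt => e e0.
have M0 : 0 < `|M| + 1 by rewrite ltr_wpDl.
near=> y; apply: le_lt_trans (h _ _) _.
apply: (@le_lt_trans _ _ ((`|M| + 1) * `|x - y|)).
  by rewrite ler_wpM2r// (le_trans (ler_norm _))// lerDl.
rewrite -ltr_pdivlMl//; near: y; apply: (@cvgr_dist_lt _ _ _ _ _ id x cvg_id).
by rewrite mulr_gt0 // invr_gt0.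
Unshelve. all: by end_near. Qed.

Lemma continuous_bounded f a b : a <= b -> (forall x, a <= x <= b -> {for x, continuous f}) ->
  exists2 M, 0 <= M & forall x, a <= x <= b -> `|f x| <= M.
Proof.
move=> ab cf.
have cw : {within `[a, b], continuous (fun x => `|f x|)}.
  apply: continuous_in_subspaceT => x; rewrite inE /= in_itv /= => /cf h.
  by apply: continuous_comp => //; apply: norm_continuous.
have [c _ hc] := EVT_max ab cw.
exists `|f c| => // x xab; apply: hc; by rewrite in_itv.
Qed.

End RealDerivatives.

(** * Averages over [0, s] and their regularity in s *)

Section Average.
Context {R : realType}.
Implicit Types (h g : R -> R) (s x : R).
Notation mu := (@lebesgue_measure R).

(** The mean of [h] over [0, s] when j = 0, written over the fixed interval [0, 1] so that s = 0 is
    not singular. Each derivative in [s] brings out one more factor [t], whence [j]. *)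
Definition average (j : nat) (h : R -> R) (s : R) : R :=
  \int[mu]_(t in `[0, 1]) (t ^+ j * h (s * t)).

Lemma integrable01 h : (forall t, 0 <= t <= 1 -> {for t, continuous h}) ->
  mu.-integrable `[0, 1] (EFin \o h).
Proof.
move=> ch; apply: continuous_compact_integrable; first exact: segment_compact.
by apply: continuous_in_subspaceT => x; rewrite inE /= in_itv /= => /ch.
Qed.

Lemma continuous_average_integrand j h s :
  (forall t, 0 <= t <= 1 -> {for s * t, continuous h}) ->
  forall t, 0 <= t <= 1 -> {for t, continuous (fun t : R => t ^+ j * h (s * t))}.
Proof.
move=> ch t t01; apply: (@continuousM R R).
  by apply: exprn_continuous.
apply: (@continuous_comp _ _ _ ( *%R s) h); last exact: ch.
exact: mulrl_continuous.
Qed.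

Lemma integrable_average j h s :
  (forall t, 0 <= t <= 1 -> {for s * t, continuous h}) ->
  mu.-integrable `[0, 1] (EFin \o (fun t => t ^+ j * h (s * t))).
Proof. by move=> ch; apply/integrable01/continuous_average_integrand. Qed.

Lemma averageB j h g s :
  (forall t, 0 <= t <= 1 -> {for s * t, continuous h}) ->
  (forall t, 0 <= t <= 1 -> {for s * t, continuous g}) ->
  average j (fun x => h x - g x) s = average j h s - average j g s.
Proof.
move=> ch cg; rewrite /average -RintegralB//; try exact: integrable_average.
by apply: eq_Rintegral => t _; rewrite mulrBr.
Qed.

Lemma average_le h g s :
  (forall t, 0 <= t <= 1 -> {for s * t, continuous h}) ->
  (forall t, 0 <= t <= 1 -> {for s * t, continuous g}) ->
  (forall t, 0 <= t <= 1 -> h (s * t) <= g (s * t)) ->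
  average 0 h s <= average 0 g s.
Proof.
move=> ch cg hg; apply: le_Rintegral => //; try exact: integrable_average.
by move=> t /=; rewrite in_itv /= => /hg; rewrite !expr0 !mul1r.
Qed.

Lemma average_cst c s : average 0 (fun _ => c) s = c.
Proof.
rewrite /average; under eq_Rintegral do rewrite expr0 mul1r.
rewrite Rintegral_cst//= lebesgue_measure_itv /= lte01 /=.
by rewrite subr0 mulr1.
Qed.

Lemma average_norm_le h g s :
  (forall t, 0 <= t <= 1 -> {for s * t, continuous h}) ->
  (forall t, 0 <= t <= 1 -> {for s * t, continuous g}) ->
  (forall t, 0 <= t <= 1 -> `|h (s * t)| <= g (s * t)) ->
  `|average 0 h s| <= average 0 g s.
Proof.
move=> ch cg hg; apply: le_trans (le_normr_Rintegral _ _) _ => //.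
  exact: integrable_average.
apply: le_Rintegral => //; try exact: integrable_average.
  apply: (@integrable01 (fun t => `|t ^+ 0 * h (s * t)|)) => t t01.
  apply: (@continuous_comp _ _ _ (fun t : R => t ^+ 0 * h (s * t)) Num.norm); last exact: norm_continuous.
  exact: continuous_average_integrand.
by move=> t /=; rewrite in_itv /= => /hg; rewrite !expr0 !mul1r.
Qed.

(** Integrals from -n are primitives on ]-n, n[ only. Shifted to vanish at 0, they agree wherever
    two of them are defined, so [n] may depend on the point. *)
Lemma continuous_primitive h : continuous h -> exists G, forall x, is_derive x 1 G (h x).
Proof.
move=> ch; have [F hF] : exists F : nat -> R -> R, forall n (x : R), - n%:R < x < n%:R ->
    is_derive x 1 (F n) (h x).
  exists (fun n x => \int[mu]_(t in `[- n%:R, x]) h t) => n x /andP[nx xn].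
  have [||d e] := @continuous_FTC1_closed _ h (- n%:R) x n%:R xn _ nx; last first.
    by apply: (DeriveDef d); rewrite -derive1E.
  - exact: ch.
  - apply: continuous_compact_integrable; first exact: segment_compact.
    exact: continuous_subspaceT.
pose N (x : R) := (Num.truncn `|x|).+1.
have Nx x : - (N x)%:R < x < (N x)%:R.
  by rewrite -ltr_norml; apply: truncnS_gt.
have FF n m x : (n <= m)%N -> - n%:R < x < n%:R -> F n x - F n 0 = F m x - F m 0.
  move=> nm xn; apply/eqP; rewrite -subr_eq0; apply/eqP.
  have nm' : (n%:R <= m%:R :> R) by rewrite ler_nat.
  pose D y := (F n y - F n 0) - (F m y - F m 0).
  have dD (y : R) : - n%:R < y < n%:R -> is_derive y 1 D 0.
    move=> yn; apply: (derive_eq (derive_sub (derive_sub (hF n y yn) (derive_cst _ _))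
      (derive_sub (hF m y _) (derive_cst _ _)))); last by rewrite subrr.
    by case/andP: yn => *; apply/andP; split; lra.
  have D0 : D 0 = 0 by rewrite /D; lra.
  rewrite -/(D x) -D0; case: (lerP 0 x) => x0.
    apply: derive0_constant => // y yx; apply: dD.
    by case/andP: xn yx => ? ? /andP[? ?]; apply/andP; split; lra.
  apply/esym/derive0_constant => [|y yx]; first exact: ltW.
  apply: dD.
  by case/andP: xn yx => ? ? /andP[? ?]; apply/andP; split; lra.
exists (fun x => F (N x) x - F (N x) 0) => x.
have xm : - (N x)%:R < x < (N x)%:R by [].
apply: (derive_near_itv xm) (derive_eq (derive_sub (hF (N x) x xm) (derive_cst (F (N x) 0) x)) (subr0 _)).
move=> y yx; apply/esym.
case: (leqP (N x) (N y)) => nn; first by rewrite -(FF _ _ y nn).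
by rewrite (FF _ _ y (ltnW nn)).
Qed.

(** The function t |-> G(s t) has derivative s h(s t), and its increment over [0, 1] is the
    right-hand side, whatever the sign of [s]. *)
Lemma average_primitive h G s : continuous h -> (forall x, is_derive x 1 G (h x)) ->
  s * average 0 h s = G s - G 0.
Proof.
move=> ch dG.
have ci : forall t, 0 <= t <= 1 -> {for t, continuous (fun t => s * h (s * t))}.
  move=> t _; apply: (@continuousM R R); first exact: cst_continuous.
  apply: (@continuous_comp _ _ _ ( *%R s) h); [exact: mulrl_continuous|exact: ch].
have dd (t : R) : is_derive t 1 (fun t : R => G (s * t)) (s * h (s * t)).
  apply: (derive_eq (derive_comp (dG (s * t)) (derive_scale s (derive_id t)))).
  by rewrite mulr1 mulrC.
rewrite /average -RintegralZl//; last by apply: integrable_average => t _; exact: ch.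
rewrite /Rintegral.
under eq_integral do rewrite expr0 mul1r.
rewrite (@continuous_FTC2 _ _ (fun t => G (s * t))) //.
- by rewrite mulr1 mulr0.
- by apply: continuous_in_subspaceT => x; rewrite inE /= in_itv /= => /ci.
- have cG x : {for x, continuous (fun t => G (s * t))} by apply: is_derive_continuous (dd x).
  split.
  + by move=> x _; case: (dd x).
  + exact: cvg_at_right_filter (cG 0).
  + exact: cvg_at_left_filter (cG 1).
- by move=> x _; rewrite derive1E; case: (dd x).
Qed.

Lemma derive_average h s : continuous h -> is_derive s 1 (fun x => x * average 0 h x) (h s).
Proof.
move=> ch; have [G dG] := continuous_primitive ch.
apply: (@derive_ext _ (fun x => G x - G 0)) => [x|]; first by rewrite (average_primitive _ ch dG).
by apply: (derive_eq (derive_sub (dG s) (derive_cst _ _))); rewrite subr0.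
Qed.

(** An interval around 0 is stable under multiplication by t in [0, 1], so an average at [x]
    involves only values inside it. *)
Lemma scale_in_itv (u v x t : R) : u <= 0 <= v -> u < x < v -> 0 <= t <= 1 -> u <= x * t <= v.
Proof.
move=> /andP[u0 v0] /andP[ux xv] /andP[t0 t1]; apply/andP; split.
- case: (lerP 0 x) => x0; first by rewrite (le_trans u0)// mulr_ge0.
  by apply: (le_trans (ltW ux)); nra.
- case: (lerP 0 x) => x0; last by rewrite (le_trans _ v0)// mulr_le0_ge0// ltW.
  by apply: le_trans (ltW xv); nra.
Qed.

Section average_regularity.
(** Regularity is asked on ]u0, +oo[ with u0 < 0, an open set containing [0, +oo[, so that
    derivatives at 0 are two-sided. *)
Variables (u0 : R) (u0_lt0 : u0 < 0).

Lemma neighbourhood_itv s : u0 < s -> exists u v, [/\ u0 < u, u <= 0 <= v & u < s < v].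
Proof.
move=> us; exists ((u0 + Num.min s 0) / 2), (Num.max s 0 + 1).
have m1 : Num.min s 0 <= s by rewrite ge_min lexx.
have m2 : Num.min s 0 <= 0 by rewrite ge_min lexx orbT.
have m3 : u0 < Num.min s 0 by rewrite lt_min us.
have m4 : s <= Num.max s 0 by rewrite le_max lexx.
have m5 : 0 <= Num.max s 0 by rewrite le_max lexx orbT.
by split; [lra|apply/andP; split; lra|apply/andP; split; lra].
Qed.

Lemma continuous_average j h : (forall x, u0 < x -> {for x, continuous h}) ->
  forall s, u0 < s -> {for s, continuous (average j h)}.
Proof.
move=> ch s /neighbourhood_itv[u [v [u0u uv suv]]].
have xt (x t : R) : u < x < v -> 0 <= t <= 1 -> u0 < x * t.
  by move=> xuv t01; have /andP[] := scale_in_itv uv xuv t01; lra.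
have [M M0 hM] : exists2 M, 0 <= M & forall x, u <= x <= v -> `|h x| <= M.
  apply: continuous_bounded; first by case/andP: uv => *; lra.
  by move=> x /andP[ux _]; apply: ch; lra.
have H := @continuity_under_integral R _ _ mu (fun s t => t ^+ j * h (s * t)) `[0, 1]
  (measurable_itv _) u v.
apply: (H _ _ (fun=> M)) => //.
- move=> x /=; rewrite in_itv /= => xuv.
  by apply: integrable_average => t t01; apply: ch; apply: xt.
- apply: aeW => t /=; rewrite in_itv /= => t01 x; rewrite inE /= in_itv /= => xuv.
  have c (c r : R) : {for x * r, continuous h} -> {for x, continuous (fun y : R => c * h (y * r))}.
    move=> cxt; apply: (@continuousM R R); first exact: cst_continuous.
    by apply: (@continuous_comp _ _ _ (fun y : R => y * r) h) => //; exact: mulrr_continuous.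
  by apply: c; apply: ch; apply: xt.
- by apply: (@integrable01 (fun=> M)) => t _; apply: cst_continuous.
- move=> x /=; rewrite in_itv /= => xuv; apply: aeW => t /=; rewrite in_itv /= => t01.
  rewrite normrM -[leRHS]mul1r ler_pM// ?hM//; last exact: scale_in_itv.
  by rewrite normrX exprn_ile1// ger0_norm; case/andP: t01.
- by rewrite inE /= in_itv.
Qed.

(** Differentiation under the integral sign, dominated by a bound of [dh] on a compact interval that
    contains 0 and [s]. *)
Lemma is_derive_average j h dh : (forall x, u0 < x -> is_derive x 1 h (dh x)) ->
  (forall x, u0 < x -> {for x, continuous dh}) ->
  forall s, u0 < s -> is_derive s 1 (average j h) (average j.+1 dh s).
Proof.
move=> hd cd s /neighbourhood_itv[u [v [u0u uv suv]]].
have ch x : u0 < x -> {for x, continuous h} by move=> /hd; apply: is_derive_continuous.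
have xt (x t : R) : u < x < v -> 0 <= t <= 1 -> u0 < x * t.
  by move=> xuv t01; have /andP[] := scale_in_itv uv xuv t01; lra.
have [M M0 hM] : exists2 M, 0 <= M & forall x, u <= x <= v -> `|dh x| <= M.
  apply: continuous_bounded; first by case/andP: uv => *; lra.
  by move=> x /andP[ux _]; apply: cd; lra.
pose f (s t : R) := t ^+ j * h (s * t).
have df (x t : R) : u < x < v -> 0 <= t <= 1 ->
    is_derive x 1 (f ^~ t) (t ^+ j.+1 * dh (x * t)).
  move=> xuv t01; have d1 : is_derive x 1 (fun x => x * t) t.
    by apply: (derive_eq (derive_mul (derive_id x) (derive_cst t x))); rewrite mulr0 addr0 mul1r.
  apply: (derive_eq (derive_scale (t ^+ j) (@derive_comp _ h (fun x => x * t) x _ _ (hd _ (xt _ _ xuv t01)) d1))).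
  by rewrite exprSr; ring.
have i1 x : `]u, v[%classic x -> mu.-integrable `[0, 1] (EFin \o f x).
  rewrite /= in_itv /= => xuv.
  by apply: integrable_average => t t01; apply: ch; apply: xt.
have i2 (x t : R) : `]u, v[%classic x -> `[0, 1]%classic t -> derivable (f ^~ t) x 1.
  by rewrite /= !in_itv /= => xuv t01; case: (df x t xuv t01).
have pE (x t : R) : u < x < v -> 0 <= t <= 1 -> partial1of2 f x t = t ^+ j.+1 * dh (x * t).
  by move=> xuv t01; rewrite /partial1of2 derive1E; case: (df x t xuv t01).
have i3 : mu.-integrable `[0, 1] (EFin \o (fun=> M)).
  by apply: (@integrable01 (fun=> M)) => t _; apply: cst_continuous.
have i4 (x t : R) : `]u, v[%classic x -> `[0, 1]%classic t -> `|partial1of2 f x t| <= M.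
  rewrite /= !in_itv /= => xuv t01; rewrite pE//.
  rewrite normrM -[leRHS]mul1r ler_pM// ?hM//; last exact: scale_in_itv.
  by rewrite normrX exprn_ile1// ger0_norm; case/andP: t01.
have suv' : `]u, v[%classic s by rewrite /= in_itv.
have D := @derivable_under_integral R _ _ mu f `[0, 1] (measurable_itv _) s u v suv' i1 i2 (fun=> M) (fun=> M0) i3 i4.
have E := @differentiation_under_integral R _ _ mu f `[0, 1] (measurable_itv _) s u v suv' i1 i2 (fun=> M) (fun=> M0) i3 i4.
apply: (DeriveDef D); rewrite -derive1E E.
by apply: eq_Rintegral => t; rewrite inE /= in_itv /= => t01; exact: pE.
Qed.

End average_regularity.

End Average.

(** * The radial initial value problem *)

Section Picard.
Context {R : realType}.
Variables (F : R -> R) (L M : R).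
Hypotheses (L_gt0 : 0 < L) (F_lip : forall x y, `|F x - F y| <= L * `|x - y|)
  (F_le : forall x, `|F x| <= M).

Implicit Types (a b s x y : R) (g u v : R -> R).

(** Integrating (s v')' = g twice from 0 gives this function: the solution that vanishes at 0 and is
    regular there. *)
Definition double_average g s := s * average 0 (average 0 g) s.

Lemma continuous_average0 g : continuous g -> continuous (average 0 g).
Proof.
move=> cg s; have s0 : - (`|s| + 1) < 0 by rewrite oppr_lt0 ltr_wpDl.
apply: (continuous_average s0 (j := 0%N)) => [x _|]; first exact: cg.
by rewrite ltrNl (le_lt_trans (ler_norm _))// normrN ltrDl.
Qed.

Lemma derive_double_average g s : continuous g ->
  is_derive s 1 (double_average g) (average 0 g s).
Proof. by move=> cg; apply/derive_average/continuous_average0. Qed.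

Let K := 2 * L.
Let expK_gt0 s : 0 < expR (K * `|s|). Proof. exact: expR_gt0. Qed.
Let K_gt0 : 0 < K. Proof. by rewrite mulr_gt0. Qed.

Lemma continuous_exp_abs (c : R) : continuous (fun s : R => c * expR (K * `|s|)).
Proof.
move=> s; apply: continuous_at_mul; first exact: continuous_at_cst.
apply: continuous_at_comp; first exact: continuous_expR.
apply: continuous_at_mul; first exact: continuous_at_cst.
exact: norm_continuous.
Qed.

(** An exponentially weighted sup norm: averaging keeps the bound C exp(K|s|), since |s t| <= |s|,
    and the outer integration gains 1/K. The weight lets a single contraction work on the whole
    line. *)
Lemma double_average_le g C : continuous g -> 0 <= C ->
  (forall s, `|g s| <= C * expR (K * `|s|)) ->
  forall s, `|double_average g s| <= C / K * expR (K * `|s|).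
Proof.
move=> cg C0 hg s.
have h1 x : `|average 0 g x| <= C * expR (K * `|x|).
  rewrite -[leRHS](average_cst _ x); apply: average_norm_le.
  - by move=> t _; exact: cg.
  - by move=> t _; exact: cst_continuous.
  - move=> t /andP[t0 t1]; apply: le_trans (hg _) _.
    rewrite ler_wpM2l// ler_expR ler_wpM2l ?(ltW K_gt0)//.
    by rewrite normrM ler_piMr// ger0_norm.
have h2 : `|double_average g s| <= `|s| * average 0 (fun x => C * expR (K * x)) `|s|.
  rewrite /double_average normrM ler_wpM2l//.
  have -> : average 0 (fun x => C * expR (K * x)) `|s| =
    average 0 (fun x => C * expR (K * `|x|)) s.
    apply: eq_Rintegral => t; rewrite inE /= in_itv /= => /andP[t0 t1].
    by rewrite normrM (ger0_norm t0).
  apply: average_norm_le => [t _|t _|t _]; last exact: h1.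
  - exact: continuous_average0.
  - exact: continuous_exp_abs.
have cE : continuous (fun x : R => C * expR (K * x)).
  move=> x; apply: continuous_at_mul; first exact: continuous_at_cst.
  by apply: continuous_at_comp; [exact: continuous_expR|exact: mulrl_continuous].
have dE (x : R) : is_derive x 1 (fun x => C / K * expR (K * x)) (C * expR (K * x)).
  have dK : is_derive x 1 ( *%R K) K by apply: (derive_eq (derive_scale K (derive_id x))); rewrite mulr1.
  apply: (derive_eq (derive_scale (C / K) (@derive_comp _ expR ( *%R K) x _ _ (is_derive_expR (K * x)) dK))).
  by field; rewrite gt_eqF.
apply: le_trans h2 _; rewrite (average_primitive _ cE dE) mulr0 expR0 mulr1.
by rewrite gerBl divr_ge0// ltW.
Qed.

Fixpoint picard_iter (n : nat) (a s : R) : R :=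
  match n with
  | 0 => a
  | n'.+1 => a + double_average (fun x => F (picard_iter n' a x)) s
  end.

Lemma F_continuous : continuous F.
Proof. exact: continuous_lipschitz F_lip. Qed.

(** The derivative of an iterate is an average of values of [F], at most [M] in size. The induction
    also supplies the continuity that the next iterate needs. *)
Lemma picard_iter_lip n a x y : `|picard_iter n a x - picard_iter n a y| <= M * `|x - y|.
Proof.
elim: n x y => [|n IH] x y /=.
  by rewrite subrr normr0 mulr_ge0// (le_trans _ (F_le 0)).
have cu : continuous (fun x => F (picard_iter n a x)).
  move=> z; apply: (@continuous_comp _ _ _ (picard_iter n a) F); last exact: F_continuous.
  exact: continuous_lipschitz IH _.
wlog xy : x y / x < y.
  move=> H; have [xy|yx|->] := ltgtP x y; first exact: H.
    by rewrite distrC (distrC x); apply: H.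
  by rewrite subrr normr0 mulr_ge0// (le_trans _ (F_le 0)).
have [c _ e] := mean_value xy (fun z _ => derive_double_average z cu).
rewrite opprD addrACA subrr add0r distrC e normrM distrC ler_wpM2r//.
rewrite -[leRHS](average_cst _ c); apply: average_norm_le => [t _|t _|t _]; last exact: F_le.
- exact: cu.
- exact: cst_continuous.
Qed.

Lemma picard_iter_continuous n a : continuous (picard_iter n a).
Proof. exact: continuous_lipschitz (@picard_iter_lip n a). Qed.

Lemma double_averageB (g h : R -> R) s : continuous g -> continuous h ->
  double_average (fun x => g x - h x) s = double_average g s - double_average h s.
Proof.
move=> cg ch; rewrite /double_average -mulrBr -averageB; last 2 first.
- by move=> t _; apply: continuous_average0.
- by move=> t _; apply: continuous_average0.
rewrite (_ : average 0 (fun x => g x - h x) = (fun x => average 0 g x - average 0 h x))//.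
by apply/funext => x; apply: averageB => t _; [apply: cg|apply: ch].
Qed.

(* The choice K = 2 L makes the contraction factor 1/2. *)
Lemma double_average_contract u v C : continuous u -> continuous v -> 0 <= C ->
  (forall s, `|u s - v s| <= C * expR (K * `|s|)) ->
  forall s, `|double_average (F \o u) s - double_average (F \o v) s| <= C / 2 * expR (K * `|s|).
Proof.
move=> cu cv C0 huv s.
have cF (w : R -> R) : continuous w -> continuous (F \o w).
  by move=> cw x; apply: continuous_comp; [exact: cw|exact: F_continuous].
rewrite -double_averageB; [|exact: cF|exact: cF].
have -> : C / 2 = (L * C) / K by rewrite /K; field; rewrite gt_eqF.
apply: double_average_le => [x||x].
- by apply: (@continuousB _ R^o); [exact: cF|exact: cF].
- by rewrite mulr_ge0// ltW.
- apply: le_trans (F_lip _ _) _.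
  by rewrite -mulrA ler_wpM2l// ltW.
Qed.

(** The constant 2 is stable under the recursion: the new bound is |a - b| plus half the old one,
    and |a - b| <= |a - b| exp(K|s|). *)
Lemma picard_iter_dep n a b s :
  `|picard_iter n a s - picard_iter n b s| <= 2 * `|a - b| * expR (K * `|s|).
Proof.
have e1 x : 1 <= expR (K * `|x|) by rewrite -expR0 ler_expR mulr_ge0// ltW.
elim: n s => [|n IH] s /=.
  by have := e1 s; have := normr_ge0 (a - b); nra.
rewrite opprD addrACA (le_trans (ler_normD _ _))//.
have := double_average_contract (@picard_iter_continuous n a) (@picard_iter_continuous n b) _ IH s.
rewrite mulr_ge0// => /(_ isT) hX; apply: le_trans (lerD (lexx _) hX) _.
by have := e1 s; have := normr_ge0 (a - b); nra.
Qed.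

Let C0 := M / L.
Let C0_ge0 : 0 <= C0. Proof. by rewrite divr_ge0// ?(ltW L_gt0)// (le_trans _ (F_le 0)). Qed.

Lemma picard_iter_step n a s :
  `|picard_iter n.+1 a s - picard_iter n a s| <= C0 / 2 ^+ n * expR (K * `|s|).
Proof.
elim: n s => [|n IH] s.
  rewrite /= addrAC subrr add0r expr0 divr1.
  have -> : C0 = (2 * M) / K by rewrite /C0 /K; field; rewrite gt_eqF.
  have M0 : 0 <= M by apply: (le_trans _ (F_le 0)).
  apply: double_average_le => [||x]; first exact: cst_continuous.
    by rewrite mulr_ge0.
  apply: le_trans (F_le _) _.
  have e1 : 1 <= expR (K * `|x|) by rewrite -expR0 ler_expR mulr_ge0// ltW.
  by nra.
have -> : picard_iter n.+2 a s - picard_iter n.+1 a s =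
   double_average (F \o picard_iter n.+1 a) s - double_average (F \o picard_iter n a) s.
  by rewrite /= opprD addrACA subrr add0r.
have -> : C0 / 2 ^+ n.+1 = C0 / 2 ^+ n / 2 by rewrite exprSr; field; rewrite expf_neq0.
apply: double_average_contract; [exact: picard_iter_continuous|exact: picard_iter_continuous| |exact: IH].
by rewrite divr_ge0// exprn_ge0.
Qed.

Lemma picard_iter_cauchy (n m : nat) a s : (n <= m)%N ->
  `|picard_iter m a s - picard_iter n a s| <= 2 * C0 / 2 ^+ n * expR (K * `|s|).
Proof.
move=> nm; have [d ->] : exists d, m = (d + n)%N by exists (m - n)%N; rewrite subnK.
elim: d n {nm} => [|d IH] n.
  by rewrite subrr normr0 mulr_ge0// ?(ltW (expK_gt0 s))// divr_ge0// ?exprn_ge0// mulr_ge0.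
rewrite addSnnS; have := IH n.+1; have := picard_iter_step n a s.
have -> : 2 * C0 / 2 ^+ n.+1 = C0 / 2 ^+ n by rewrite exprSr; field; rewrite expf_neq0.
move=> h1 h2; rewrite (le_trans (ler_distD (picard_iter n.+1 a s) _ _))//.
by apply: le_trans (lerD h2 h1) _; lra.
Qed.

Definition picard a s : R := lim ((fun n => picard_iter n a s) @ \oo).

Lemma half_pow_cvg (c : R) : (fun n => c / 2 ^+ n) @ \oo --> (0 : R).
Proof.
rewrite -(mulr0 c); apply: cvgM; first exact: cvg_cst.
rewrite (_ : (fun n => _) = (fun n => (2^-1) ^+ n)); last by apply/funext => n; rewrite exprVn.
apply: cvg_expr; rewrite ger0_norm; lra.
Qed.

Lemma picard_cvg a s : (fun n => picard_iter n a s) @ \oo --> picard a s.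
Proof.
suff : cvg ((fun n => picard_iter n a s) @ \oo) by [].
apply/cauchy_cvgP/cauchy_exP => e e0.
have := half_pow_cvg (2 * C0 * expR (K * `|s|)).
move=> /cvgrPdist_lt /(_ e e0)[N _ hN].
exists (picard_iter N a s); exists N => // n /= Nn.
rewrite /ball /= distrC; apply: le_lt_trans (picard_iter_cauchy a s Nn) _.
have := hN N (leqnn N); rewrite sub0r normrN => /(le_lt_trans (ler_norm _)).
by rewrite mulrAC.
Qed.

Lemma picard_dist_le (f : nat -> R) a x c d : (f n @[n --> \oo] --> d) ->
  (\forall n \near \oo, `|picard_iter n a x - f n| <= c) -> `|picard a x - d| <= c.
Proof.
move=> fd h; have H := cvg_norm (cvgB (picard_cvg (a := a) (s := x)) fd).
by apply: (@cvgr_to_le _ _ _ R _ _ _ (H _ _)).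
Qed.

Lemma picard_err n a s :
  `|picard a s - picard_iter n a s| <= 2 * C0 / 2 ^+ n * expR (K * `|s|).
Proof.
apply: picard_dist_le; first exact: cvg_cst.
by exists n => // m /= nm; exact: picard_iter_cauchy.
Qed.

Lemma picard_lip a x y : `|picard a x - picard a y| <= M * `|x - y|.
Proof.
apply: picard_dist_le; first exact: (picard_cvg (a := a) (s := y)).
by apply: nearW => n; exact: picard_iter_lip.
Qed.

(** What shooting requires: on a bounded interval the solution depends continuously on its starting
    value. *)
Lemma picard_dep a b s : `|picard a s - picard b s| <= 2 * `|a - b| * expR (K * `|s|).
Proof.
apply: picard_dist_le; first exact: (picard_cvg (a := b) (s := s)).
by apply: nearW => n; exact: picard_iter_dep.
Qed.

Lemma le_of_half_pow (x c : R) : (forall n, x <= c / 2 ^+ n) -> x <= 0.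
Proof.
move=> h; apply: (@ler_cvg_to _ \oo _ R (fun=> x) (fun n => c / 2 ^+ n)).
- exact: cvg_cst.
- exact: half_pow_cvg.
- exact: nearW.
Qed.

Lemma picard_continuous a : continuous (picard a).
Proof. exact: continuous_lipschitz (@picard_lip a). Qed.

(** Both sides lie within O(2^-n) of the iterate of rank n + 1, the right one by contraction. *)
Lemma picard_fixpoint a s : picard a s = a + double_average (F \o picard a) s.
Proof.
apply/eqP; rewrite -subr_eq0 -normr_le0.
apply: (@le_of_half_pow _ (2 * C0 * expR (K * `|s|))) => n.
have h1 := picard_err n.+1 a s.
have h2 : `|double_average (F \o picard a) s - double_average (F \o picard_iter n a) s|
    <= 2 * C0 / 2 ^+ n / 2 * expR (K * `|s|).
  apply: double_average_contract; [exact: picard_continuous|exact: picard_iter_continuous| |].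
    by rewrite divr_ge0// ?exprn_ge0// mulr_ge0.
  exact: picard_err.
have -> : picard a s - (a + double_average (F \o picard a) s) =
   (picard a s - picard_iter n.+1 a s) - (double_average (F \o picard a) s - double_average (F \o picard_iter n a) s).
  rewrite [picard_iter n.+1 a s]/=.
  rewrite -[double_average (fun x => F (picard_iter n a x)) s]/(double_average (F \o picard_iter n a) s).
  move: (double_average _ s) (double_average _ s) => D1 D2; ring.
apply: le_trans (ler_normB _ _) _; apply: le_trans (lerD h1 h2) _.
rewrite exprSr le_eqVlt; apply/orP; left; apply/eqP; field; rewrite expf_neq0//.
Qed.

Lemma picard0 a : picard a 0 = a.
Proof. by rewrite picard_fixpoint /double_average mul0r addr0. Qed.

Lemma picard_derive a s : is_derive s 1 (picard a) (average 0 (F \o picard a) s).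
Proof.
apply: (@derive_ext _ (fun s => a + double_average (F \o picard a) s)).
  by move=> y; rewrite [RHS]picard_fixpoint.
apply: (derive_eq (derive_add (derive_cst a s) (derive_double_average s _))); last by rewrite add0r.
by move=> x; apply: continuous_comp; [exact: picard_continuous|exact: F_continuous].
Qed.

End Picard.

(** The zero is the supremum of the points up to which [f] stays negative; continuity excludes
    either strict sign there. *)
Lemma first_zero (R : realType) (f : R -> R) a b : a <= b -> continuous f -> f a < 0 -> 0 <= f b ->
  exists z, [/\ a < z <= b, f z = 0 & forall x, a <= x < z -> f x < 0].
Proof.
move=> ab cf fa fb.
pose S := [set x | a <= x <= b /\ forall y, a <= y <= x -> f y < 0].
have Sa : S a by split; [rewrite lexx|move=> y; rewrite -eq_le => /eqP <-].
have hS : has_sup S by split; [exists a|exists b => x [/andP[]]].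
set z := sup S.
have az : a <= z by apply: ub_le_sup => //; case: hS.
have zb : z <= b by apply: ge_sup; [exists a|move=> x [/andP[]]].
have below x : a <= x < z -> f x < 0.
  move=> /andP[ax xz].
  have e0 : 0 < z - x by rewrite subr_gt0.
  have [y [_ Sy] hy] := sup_adherent e0 hS.
  by apply: Sy; rewrite ax /=; apply: ltW; move: hy; rewrite -/z; lra.
have fz0 : 0 <= f z.
  rewrite leNgt; apply/negP => fz.
  have zb' : z < b by rewrite lt_neqAle zb andbT; apply: contraTneq fz => ->; rewrite -leNgt.
  have : \forall y \near z, f y < 0 by exact: (cvgr_lt (f z) (cf z)).
  move=> /nbhs_ballP[e /= e0 he].
  pose y := Num.min b (z + e / 2).
  have zy : z < y by rewrite lt_min zb' /=; lra.
  have : S y.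
    split; first by rewrite ge_min lexx andbT; lra.
    move=> t /andP[at' ty]; case: (ltrP t z) => tz; first by apply: below; rewrite at'.
    apply: he; rewrite /ball /= ler0_norm; last lra.
    have : y <= z + e / 2 by rewrite ge_min lexx orbT.
    lra.
  by move=> /(ub_le_sup (proj2 hS)); rewrite -/z; lra.
have fz1 : f z <= 0.
  rewrite leNgt; apply/negP => fz.
  have az' : a < z by rewrite lt_neqAle az andbT; apply: contraTneq fz => <-; rewrite -leNgt ltW.
  have : \forall y \near z, 0 < f y by exact: (cvgr_gt (f z) (cf z)).
  move=> /nbhs_ballP[e /= e0 he].
  pose y := Num.max a (z - e / 2).
  have yz : y < z by rewrite gt_max az' /=; lra.
  have : f y < 0 by apply: below; rewrite yz andbT le_max lexx.
  apply/negP; rewrite -leNgt; apply/ltW/he; rewrite /ball /= ger0_norm; last lra.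
  have : z - e / 2 <= y by rewrite le_max lexx orbT.
  lra.
have fz : f z = 0 by apply/eqP; rewrite eq_le fz0 fz1.
exists z; split => //; rewrite zb andbT lt_neqAle az andbT.
by apply: contraTneq fa => ->; rewrite fz ltxx.
Qed.

(** * Shooting for the ground state *)

Section Shooting.
Context {R : realType}.
Variables (p : nat) (h : R).
Hypotheses (p_ge2 : (2 <= p)%N) (h_gt2 : 2 < h) (h_large : 8 * 4 ^+ p < ln (h / 2)).
Implicit Types (a b s x y : R).

(** Shooting takes place in [1, 2 h]. The further factor 2 leaves room to stay below [B] slightly to
    the left of 0 as well. *)
Let B := 4 * h.
(* The clamp makes the nonlinearity globally Lipschitz; the ground state takes
   its values in ]0, B[. *)
Definition clamp (x : R) := Num.max 0 (Num.min B x).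
Definition nonlin x := clamp x - clamp x ^+ p.
Notation F := nonlin.
Let L := 1 + p%:R * B ^+ p.-1.
Let M := B ^+ p.

Let B_ge8 : 8 <= B. Proof. by have := h_gt2; rewrite /B; lra. Qed.
Let M_ge0 : 0 <= M. Proof. by rewrite exprn_ge0//; have := B_ge8; lra. Qed.

Lemma clamp_itv x : 0 <= clamp x <= B.
Proof. by rewrite /clamp le_max lexx /= ge_max ge_min lexx /= andbT; have := B_ge8; lra. Qed.

Lemma clamp_id x : 0 <= x <= B -> clamp x = x.
Proof.
move=> /andP[x0 xB]; rewrite /clamp.
have -> : Num.min B x = x by apply/min_idPr.
exact/max_idPr.
Qed.

Lemma clamp_lip x y : `|clamp x - clamp y| <= `|x - y|.
Proof.
have lip (f : R -> R) u v : (forall x y, x <= y -> 0 <= f y - f x <= y - x) -> `|f u - f v| <= `|u - v|.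
  move=> hf; wlog uv : u v / u <= v.
    move=> H; case/orP: (le_total u v) => uv; first exact: H.
    by rewrite -normrN opprB -[leRHS]normrN opprB; exact: H.
  by have /andP[f0 f1] := hf _ _ uv; rewrite distrC (distrC u) !ger0_norm// subr_ge0.
apply: le_trans (lip (Num.max 0) _ _ _) (lip (Num.min B) _ _ _) => {}x {}y xy.
  by rewrite !maxEle; case: (lerP 0 x); case: (lerP 0 y); lra.
by rewrite !minEle; case: (lerP B x); case: (lerP B y); lra.
Qed.

Lemma nonlin_in x : 0 <= x <= B -> F x = x - x ^+ p.
Proof. by move=> xB; rewrite /nonlin clamp_id. Qed.

Lemma nonlin_neg x : x <= 0 -> F x = 0.
Proof.
move=> x0; have -> : F x = F 0.
  rewrite /nonlin; have -> : clamp x = clamp 0; last by [].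
  rewrite [RHS]clamp_id; last by have := B_ge8; lra.
  by rewrite /clamp; apply/max_idPl; rewrite ge_min x0 orbT.
rewrite nonlin_in; last by have := B_ge8; lra.
by rewrite expr0n gtn_eqF ?subrr// (leq_trans _ p_ge2).
Qed.

Lemma nonlin_le1 x : F x <= 1.
Proof.
rewrite /nonlin; have /andP[c0 cB] := clamp_itv x.
have [c1|/ltW c1] := lerP (clamp x) 1.
  by rewrite lerBlDr (le_trans c1)// lerDl exprn_ge0.
have : clamp x <= clamp x ^+ p by rewrite ler_eXnr// (leq_trans _ p_ge2).
by lra.
Qed.

Lemma nonlin_norm x : `|F x| <= M.
Proof.
have B8 := B_ge8; rewrite /nonlin; have /andP[c0 cB] := clamp_itv x.
have h1 : clamp x ^+ p <= M by rewrite lerXn2r// nnegrE; lra.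
have h2 : 0 <= clamp x ^+ p by rewrite exprn_ge0.
have h3 : B <= M by rewrite /M ler_eXnr// ?(leq_trans _ p_ge2)//; lra.
by rewrite ler_norml; lra.
Qed.

Lemma nonlin_lip x y : `|F x - F y| <= L * `|x - y|.
Proof.
have B8 := B_ge8; rewrite /nonlin; set c := clamp x; set d := clamp y.
have /andP[c0 cB] : 0 <= c <= B by exact: clamp_itv.
have /andP[d0 dB] : 0 <= d <= B by exact: clamp_itv.
have cd : `|c - d| <= `|x - y| by exact: clamp_lip.
have pw : `|c ^+ p - d ^+ p| <= p%:R * B ^+ p.-1 * `|c - d|.
  rewrite subrXX normrM mulrC ler_wpM2r//.
  apply: le_trans (ler_norm_sum _ _ _) _.
  apply: (@le_trans _ _ (\sum_(i < p) B ^+ p.-1)); last by rewrite sumr_const card_ord mulr_natl lexx.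
  apply: ler_sum => i _; rewrite normrM !normrX !ger0_norm//.
  rewrite [X in _ <= _ ^+ X](_ : p.-1 = (p.-1 - i + i)%N); last by rewrite subnK// -ltnS prednK// (leq_trans _ p_ge2).
  by rewrite exprD ler_pM ?exprn_ge0// ?lerXn2r ?nnegrE//; lra.
have -> : c - c ^+ p - (d - d ^+ p) = (c - d) - (c ^+ p - d ^+ p) by ring.
apply: le_trans (ler_normB _ _) _; rewrite /L mulrDl mul1r lerD//.
by apply: le_trans pw _; rewrite ler_wpM2l// mulr_ge0// exprn_ge0; lra.
Qed.

Lemma nonlin_nonpos x : 1 <= x -> F x <= 0.
Proof.
move=> x1; have B8 := B_ge8; rewrite /nonlin; have c1 : 1 <= clamp x by rewrite /clamp le_max; apply/orP; right; rewrite le_min x1 andbT; lra.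
by rewrite subr_le0 ler_eXnr// (leq_trans _ p_ge2).
Qed.

Lemma nonlin_nonneg x : x <= 1 -> 0 <= F x.
Proof.
move=> x1; have [x0|/ltW x0] := lerP x 0; first by rewrite nonlin_neg.
rewrite nonlin_in ?subr_ge0; last by have := B_ge8; lra.
by rewrite ler_iXnr// (leq_trans _ p_ge2).
Qed.

Lemma nonlin_neg_strict x : 1 < x <= B -> F x < 0.
Proof.
move=> /andP[x1 xB]; rewrite nonlin_in ?subr_lt0; last by lra.
by rewrite ltr_eXnr.
Qed.

Let L_gt0 : 0 < L.
Proof. by rewrite ltr_wpDr// mulr_ge0// exprn_ge0//; have := B_ge8; lra. Qed.

Definition sol a s := picard F a s.
Definition sol' a s := average 0 (F \o sol a) s.
(** The flux s w' has derivative F(w), so the sign of [nonlin] governs its monotonicity; for s > 0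
    its own sign is that of w'. *)
Definition flux a s := s * sol' a s.

Let F_continuous : continuous F. Proof. exact: F_continuous nonlin_lip. Qed.
Let sol_continuous a : continuous (sol a).
Proof. exact: (picard_continuous L_gt0 nonlin_lip nonlin_norm). Qed.
Let Fsol_continuous a : continuous (F \o sol a).
Proof. by move=> x; apply: continuous_comp; [exact: sol_continuous|exact: F_continuous]. Qed.

Lemma sol0 a : sol a 0 = a.
Proof. exact: (picard0 L_gt0 nonlin_lip nonlin_norm). Qed.

Lemma derive_sol a s : is_derive s 1 (sol a) (sol' a s).
Proof. exact: (picard_derive L_gt0 nonlin_lip nonlin_norm). Qed.

Lemma derive_flux a s : is_derive s 1 (flux a) (F (sol a s)).
Proof. exact: derive_average. Qed.

Lemma sol_lip a x y : `|sol a x - sol a y| <= M * `|x - y|.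
Proof. exact: (picard_lip L_gt0 nonlin_lip nonlin_norm). Qed.

Lemma sol_dep a b s : `|sol a s - sol b s| <= 2 * `|a - b| * expR (2 * L * `|s|).
Proof. exact: (picard_dep L_gt0 nonlin_lip nonlin_norm). Qed.

Lemma sol'_continuous a : continuous (sol' a).
Proof. exact: continuous_average0. Qed.

Lemma flux_continuous a : continuous (flux a).
Proof. by move=> s; apply: is_derive_continuous (derive_flux a s). Qed.

Lemma sol'_dep a b s : `|sol' a s - sol' b s| <= L * (2 * `|a - b| * expR (2 * L * `|s|)).
Proof.
rewrite /sol' -averageB; try by move=> t _; exact: Fsol_continuous.
rewrite -[leRHS](average_cst _ s); apply: average_norm_le => t t01.
- by apply: (@continuousB _ R^o); exact: Fsol_continuous.
- exact: cst_continuous.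
- apply: le_trans (nonlin_lip _ _) _; rewrite ler_wpM2l ?(ltW L_gt0)//.
  apply: le_trans (sol_dep _ _ _) _; rewrite ler_wpM2l ?mulr_ge0//.
  rewrite ler_expR ler_wpM2l ?mulr_ge0 ?(ltW L_gt0)//.
  by case/andP: t01 => t0 t1; rewrite normrM ler_piMr// ger0_norm.
Qed.

(** The equilibrium: [nonlin] vanishes at 1, so every Picard iterate is constant. *)
Lemma sol1 s : sol 1 s = 1.
Proof.
rewrite /sol /picard; have -> : (fun n => picard_iter F n 1 s) = (fun=> 1); last exact: lim_cst.
apply/funext => n; elim: n s => [//|n IH] s /=.
have -> : (fun x => F (picard_iter F n 1 x)) = (fun=> 0).
  by apply/funext => x; rewrite IH nonlin_in ?expr1n ?subrr//; have := B_ge8; lra.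
rewrite /double_average (_ : average 0 (fun=> 0) = fun=> 0); last by apply/funext => x; rewrite average_cst.
by rewrite average_cst mulr0 addr0.
Qed.

(** The primitive of [nonlin] that vanishes at 0, on both sides of 0. *)
Definition pot y := y * average 0 F y.

Lemma derive_pot y : is_derive y 1 pot (F y).
Proof. exact: derive_average. Qed.

Lemma pot0 : pot 0 = 0. Proof. by rewrite /pot mul0r. Qed.

Lemma pot_in y : 0 <= y <= B -> pot y = y ^+ 2 / 2 - y ^+ p.+1 / p.+1%:R.
Proof.
move=> /andP[y0 yB].
pose D x := pot x - (2^-1 * x ^+ 2 - p.+1%:R^-1 * x ^+ p.+1).
suff : D y = D 0.
  by rewrite /D pot0 !expr0n /= !mulr0 subrr subrr => /subr0_eq ->; rewrite mulrC [X in _ - X]mulrC.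
apply: derive0_constant => // x /andP[x0 xy].
have d2 : is_derive x 1 (fun x => 2^-1 * x ^+ 2 - p.+1%:R^-1 * x ^+ p.+1) (x - x ^+ p).
  apply: (derive_eq (derive_sub (derive_scale _ (derive_exp 2 (derive_id x))) (derive_scale _ (derive_exp p.+1 (derive_id x))))).
  by rewrite /= expr1 !mulr1 !mulrA !mulVf ?mul1r// pnatr_eq0.
apply: (derive_eq (derive_sub (derive_pot x) d2)).
by rewrite nonlin_in ?subrr//; lra.
Qed.

(** 1/6 = 1/2 - 1/3, as p + 1 >= 3 and y^(p+1) <= y^2. *)
Lemma pot_ge y : 0 <= y <= 1 -> y ^+ 2 / 6 <= pot y.
Proof.
move=> /andP[y0 y1]; rewrite pot_in; last by have := B_ge8; lra.
have q : y ^+ p.+1 <= y ^+ 2 by rewrite ler_wiXn2l// (leq_trans p_ge2).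
have r : p.+1%:R^-1 <= 3^-1 :> R.
  by rewrite lef_pV2 ?posrE// ler_nat ltnS.
have : y ^+ p.+1 / p.+1%:R <= y ^+ 2 / 3 by rewrite ler_pM// exprn_ge0.
by move: (y ^+ p.+1 / _) => u; lra.
Qed.

Lemma sol'E a s : sol' a s = average 0 (F \o sol a) s. Proof. by []. Qed.

Lemma nonlinE x : F x = clamp x - clamp x ^+ p. Proof. by []. Qed.

Lemma fluxE a s : flux a s = s * sol' a s. Proof. by []. Qed.

Definition energy a s := flux a s * sol' a s / 2 - pot (sol a s).

Lemma energyE a s : energy a s = flux a s * sol' a s / 2 - pot (sol a s).
Proof. by []. Qed.

Opaque sol sol' flux pot energy nonlin.

(** The derivative of s w'^2 / 2 - pot(w) is - w'^2 / 2: the factor [s] in the equation acts as a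
    friction. *)
Lemma energy_nonincreasing a x y : 0 < x -> x <= y -> energy a y <= energy a x.
Proof.
move=> x0 xy.
apply: (@nonincreasing_derive _ (energy a) (fun s => - (sol' a s ^+ 2 / 2))) => //; last first.
  by move=> s _; rewrite oppr_le0 divr_ge0// sqr_ge0.
move=> s /andP[xs _]; have s0 : 0 < s by lra.
have sn0 : s != 0 by rewrite gt_eqF.
have dV : is_derive s 1 (fun s => s^-1) (- s ^- 2).
  apply: (derive_eq (@is_deriveV _ id s 1 1 sn0 (derive_id s))).
  by rewrite /GRing.scale /= mulr1.
(* s w'^2 is written as flux^2 / s, because differentiability is at hand for [flux] rather than for
   [sol']. *)
have d1 : is_derive s 1 (fun s => (flux a s ^+ 2 * s^-1) * 2^-1 - pot (sol a s)) (- (sol' a s ^+ 2 / 2)).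
  apply: (derive_eq (derive_sub (derive_mul (derive_mul (derive_exp 2 (derive_flux a s)) dV) (derive_cst _ _))
     (@derive_comp _ pot (sol a) s _ _ (derive_pot _) (derive_sol a s)))).
  by rewrite /= expr1 fluxE; field.
apply: (@derive_near_itv _ _ _ 0 (s + 1) s _ _ _ d1); first by lra.
move=> z /andP[z0 _]; rewrite energyE fluxE; congr (_ - _); field.
by rewrite gt_eqF.
Qed.

(** A flux below [b] means w' <= b / s, whence the logarithm. *)
Lemma sol_le a b x y : 0 < x -> x <= y -> (forall s, x < s < y -> flux a s <= b) ->
  sol a y - sol a x <= b * (ln y - ln x).
Proof.
move=> x0 xy hb.
suff : sol a y - b * ln y <= sol a x - b * ln x by lra.
apply: (@nonincreasing_derive _ (fun s => sol a s - b * ln s) (fun s => sol' a s - b * s^-1)) => // [s /andP[xs sy]|s /andP[xs sy]].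
  apply: derive_sub; first exact: derive_sol.
  by apply: derive_scale; apply: is_derive1_ln; lra.
have s0 : 0 < s by lra.
have : flux a s <= b by apply: hb; rewrite xs.
by rewrite subr_le0 ler_pdivlMr// mulrC.
Qed.

(* The two open alternatives of the shooting argument: sol a becomes negative, or
   its energy becomes negative, which forbids it ever to reach 0. The ground
   state starts from a value satisfying neither. *)
Definition crossing a := exists2 s, 0 < s & sol a s < 0.
Definition trapped a := exists s, [/\ 0 < s, energy a s < 0 & forall x, 0 <= x <= s -> 0 < sol a x].

Lemma sol_dep_small a s (e : R) : 0 < e -> 0 <= s -> exists2 d : R, 0 < d &
  forall b, `|b - a| < d -> forall x, 0 <= x <= s -> `|sol b x - sol a x| < e.
Proof.
move=> e0 s0; set E := expR (2 * L * s); have E0 : 0 < E by exact: expR_gt0.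
exists (e / (4 * E)) => [|b hb x /andP[x0 xs]]; first by rewrite divr_gt0// mulr_gt0.
apply: le_lt_trans (sol_dep _ _ _) _.
have : expR (2 * L * `|x|) <= E.
  by rewrite ler_expR ler_wpM2l ?mulr_ge0 ?(ltW L_gt0)// ger0_norm.
have : `|b - a| * E < e / 4.
  by rewrite -ltr_pdivlMr//; move: hb; rewrite invfM mulrA.
have := normr_ge0 (b - a); have := expR_gt0 (2 * L * `|x|).
by move: (expR _) (`|b - a|) => X Y; nra.
Qed.

Lemma crossing_open a : crossing a -> exists2 d : R, 0 < d & forall b, `|b - a| < d -> crossing b.
Proof.
move=> [s s0 h1]; have [||d d0 hd] := @sol_dep_small a s (- sol a s); [lra|lra|].
exists d => // b /hd /(_ s); rewrite lexx ltW// => /(_ isT); rewrite ltr_norml => /andP[_ h2].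
by exists s => //; lra.
Qed.

Lemma energy_dep a s (e : R) : 0 < e -> 0 < s -> exists2 d : R, 0 < d &
  forall b, `|b - a| < d -> `|energy b s - energy a s| < e.
Proof.
move=> e0 s0.
have cs : continuous (fun b => sol b s).
  apply: (@continuous_lipschitz _ _ (2 * expR (2 * L * `|s|))) => b c.
  by apply: le_trans (sol_dep _ _ _) _; rewrite mulrAC.
have cs' : continuous (fun b => sol' b s).
  apply: (@continuous_lipschitz _ _ (L * (2 * expR (2 * L * `|s|)))) => b c.
  by apply: le_trans (sol'_dep _ _ _) _; rewrite -!mulrA (mulrC (expR _)).
have cE : {for a, continuous (fun b => energy b s)}.
  rewrite (_ : (fun b => energy b s) = fun b => s * sol' b s * sol' b s / 2 - pot (sol b s)); last first.
    by apply/funext => b; rewrite energyE fluxE.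
  apply: (@continuousB _ R^o).
    apply: continuous_at_mul; last exact: continuous_at_cst.
    apply: continuous_at_mul; last exact: cs'.
    by apply: continuous_at_mul; [exact: continuous_at_cst|exact: cs'].
  apply: (@continuous_at_comp _ pot); last exact: cs.
  exact: is_derive_continuous (derive_pot _).
move/cvgrPdist_lt: cE => /(_ e e0) /nbhs_ballP[d /= d0 hd].
by exists d => // b hb; rewrite distrC; apply: hd; rewrite /ball /= distrC.
Qed.

(** The minimum of [sol a] on the compact [0, s] is positive, so positivity survives a small change
    of [a]; the energy at [s] is continuous in [a]. *)
Lemma trapped_open a : trapped a -> exists2 d : R, 0 < d & forall b, `|b - a| < d -> trapped b.
Proof.
move=> [s [s0 Es pos]].
have cw : {within `[0, s], continuous (sol a)} by apply: continuous_subspaceT.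
have [c cs hc] := EVT_min (ltW s0) cw.
have c0 : 0 < sol a c by apply: pos; move: cs; rewrite in_itv.
have [d1 d10 h1] := @sol_dep_small a s (sol a c) c0 (ltW s0).
have Es' : 0 < - energy a s by lra.
have [d2 d20 h2] := @energy_dep a s _ Es' s0.
exists (Num.min d1 d2) => [|b]; first by rewrite lt_min d10.
rewrite lt_min => /andP[/h1 b1 /h2]; rewrite ltr_norml => /andP[_ b2].
exists s; split => //.
  by move: b2 Es; move: (energy b s) (energy a s) => u v; lra.
move=> x xs; have := b1 x xs; rewrite ltr_norml => /andP[b3 _].
have : sol a c <= sol a x by apply: hc; rewrite in_itv.
by move: b3; move: (sol b x) (sol a x) (sol a c) => u v w; lra.
Qed.

(** A crossing would occur after [s] and pass through a zero, where the energy reduces to half of s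
    w'^2 and is nonnegative; yet it was already negative at [s] and cannot increase. *)
Lemma trapped_not_crossing a : trapped a -> crossing a -> False.
Proof.
move=> [s [s0 Es pos]] [x x0 sx].
have sx' : s <= x.
  by rewrite leNgt; apply/negP => xs; have := pos x; rewrite !ltW// => /(_ isT); lra.
have [z [/andP[sz _] ez _]] : exists z, [/\ s < z <= x, - sol a z = 0 & forall y, s <= y < z -> - sol a y < 0].
  apply: first_zero => //; [by move=> y; apply: continuousN; exact: sol_continuous| |lra].
  by have := pos s; rewrite lexx ltW// => /(_ isT); lra.
have := @energy_nonincreasing a s z s0 (ltW sz).
rewrite (energyE a z) -[sol a z]opprK ez oppr0 pot0 subr0.
have : 0 <= flux a z * sol' a z.
  by rewrite fluxE -mulrA mulr_ge0// ?sqr_ge0 -?expr2 ?sqr_ge0//; lra.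
by move: Es; lra.
Qed.

Lemma trapped1 : trapped 1.
Proof.
exists 1; split => // [|x _]; last by rewrite sol1.
have e0 : sol' 1 1 = 0.
  rewrite sol'E (_ : F \o sol 1 = fun=> 0) ?average_cst//.
  by apply/funext => x /=; rewrite sol1 nonlin_in ?expr1n ?subrr//; have := B_ge8; lra.
rewrite energyE e0 mulr0 mul0r sub0r oppr_lt0 sol1.
by apply: lt_le_trans (pot_ge _); rewrite ?lexx ?ler01//; lra.
Qed.

(** For values z >= h > 2 the linear term is absorbed: z <= z^p / 2. *)
Lemma nonlin_le_of_ge y : h <= y -> F y <= - (h ^+ p / 2).
Proof.
have h2 := h_gt2; move=> hy; rewrite nonlinE; set z := clamp y.
have hz : h <= z.
  by rewrite /z /clamp le_max; apply/orP; right; rewrite le_min hy andbT /B; lra.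
have pE : p = p.-1.+1 by rewrite prednK// (leq_trans _ p_ge2).
rewrite pE !exprS; set u := h ^+ p.-1; set v := z ^+ p.-1.
have uv : u <= v by rewrite lerXn2r// nnegrE; lra.
have u2 : 2 <= u.
  have : h <= u by rewrite /u ler_eXnr//; [rewrite -ltnS -pE|lra].
  lra.
by nra.
Qed.

(** The solution remains above [h] up to [s1], which drives the flux down to -c. As F <= 1, the flux
    is still below -c/2 up to [s2], and over [s1, s2] the solution loses (c/2) ln(s2/s1), more than
    its initial height 2 h. *)
Lemma crossing_2h : crossing (2 * h).
Proof.
have h2 := h_gt2; pose a := 2 * h.
have M0 : 0 < M by rewrite exprn_gt0//; have := B_ge8; lra.
(* The slope is at most [M] in size, so falling from 2 h to [h] takes at least this long. *)
pose s1 := h / M; have s10 : 0 < s1 by rewrite divr_gt0//; lra.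
have q0 : 0 < (4 : R) ^+ p by rewrite exprn_gt0.
have hp0 : 0 < h ^+ p by rewrite exprn_gt0//; lra.
have ME : M = 4 ^+ p * h ^+ p by rewrite /M /B exprMn.
have lb s : 0 <= s <= s1 -> h <= sol a s.
  move=> /andP[s0 ss1]; have := sol_lip a s 0; rewrite sol0 subr0 (ger0_norm s0) ler_norml => /andP[+ _].
  have : M * s <= h by rewrite mulrC -ler_pdivlMr.
  by rewrite /a; lra.
have neg s : 0 <= s <= s1 -> sol' a s <= - (h ^+ p / 2).
  move=> /andP[s0 ss1]; rewrite sol'E -[leRHS](average_cst _ s); apply: average_le => [t _|t _|t /andP[t0 t1]].
  - exact: Fsol_continuous.
  - exact: cst_continuous.
  - by apply: nonlin_le_of_ge; apply: lb; nra.
(* c = s1 h^p / 2 bounds the flux accumulated at [s1]; the powers h^p cancel because M = 4^p h^p. *)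
pose c := h / (2 * 4 ^+ p); have c0 : 0 < c by rewrite divr_gt0 ?mulr_gt0//; lra.
have f1 : flux a s1 <= - c.
  have -> : - c = s1 * - (h ^+ p / 2).
    by rewrite /s1 /c ME; field; rewrite !gt_eqF.
  by rewrite fluxE ler_pM2l//; apply: neg; lra.
pose s2 := s1 + c / 2.
have f2 s : s1 < s < s2 -> flux a s <= - (c / 2).
  move=> /andP[ss1 ss2].
  have : flux a s - s <= flux a s1 - s1.
    apply: (@nonincreasing_derive _ (fun x => flux a x - x) (fun x => F (sol a x) - 1)); [lra| |].
      by move=> x _; apply: derive_sub (derive_flux a x) (derive_id x).
    by move=> x _; rewrite subr_le0 nonlin_le1.
  by move: ss2; rewrite /s2; lra.
have s12 : s1 < s2 by rewrite /s2; lra.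
have sol_s1 : sol a s1 <= a.
  have [x /andP[x0 x1] e] := mean_value s10 (fun x _ => derive_sol a x).
  have hx := neg x; rewrite (ltW x0) (ltW x1) in hx; have {}hx := hx isT.
  by move: e; rewrite sol0; nra.
have := sol_le s10 (ltW s12) f2.
rewrite -ln_div ?posrE//; last by rewrite /s2; lra.
have r1 : h / 2 <= s2 / s1.
  have -> : s2 / s1 = 1 + h ^+ p / 4 by rewrite /s2 /c /s1 ME; field; rewrite !gt_eqF//; lra.
  have : h ^+ 2 <= h ^+ p by rewrite ler_weXn2l//; lra.
  by nra.
have r2 : ln (h / 2) <= ln (s2 / s1).
  by rewrite ler_ln// posrE ?divr_gt0//; [lra|lra|rewrite /s2; lra].
have r3 : 8 * 4 ^+ p < ln (s2 / s1) by apply: lt_le_trans r2; exact: h_large.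
(* The constant 8 * 4^p of [h_large] is the ratio of 2 h to c / 2. *)
have r4 : 2 * h < c / 2 * ln (s2 / s1).
  have -> : 2 * h = c / 2 * (8 * 4 ^+ p) by rewrite /c; field; rewrite gt_eqF.
  by rewrite ltr_pM2l//; lra.
move=> r5; exists s2; first by rewrite /s2; lra.
rewrite -/a; rewrite mulNr in r5; move: r5 r4 sol_s1; rewrite /a.
by move: (c / 2 * _) (sol _ s2) (sol _ s1) => U V W; lra.
Qed.

(** Take the supremum of the trapped values in [1, 2 h]. If it crossed, so would trapped values
    close to it; if it were trapped, so would slightly larger values, for which the crossing at 2 h
    leaves room. *)
Lemma exists_neither : exists a, [/\ 1 < a < 2 * h, ~ crossing a & ~ trapped a].
Proof.
pose S := [set a | 1 <= a <= 2 * h /\ trapped a].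
have h2 := h_gt2.
have S1 : S 1 by split; [lra|exact: trapped1].
have hS : has_sup S by split; [exists 1|exists (2 * h) => x [/andP[]]].
set a := sup S.
have a1 : 1 <= a by apply: ub_le_sup => //; case: hS.
have a2 : a <= 2 * h by apply: ge_sup; [exists 1|move=> x [/andP[]]].
have nc : ~ crossing a.
  move=> /crossing_open[d d0 hd].
  have [y [y1 ty] ay] := sup_adherent d0 hS.
  apply: (trapped_not_crossing ty); apply: hd.
  have : y <= a by apply: ub_le_sup => //; case: hS.
  by rewrite -/a in ay => ya; rewrite ler0_norm; lra.
have a2' : a < 2 * h.
  by rewrite lt_neqAle a2 andbT; apply/eqP => e; apply: nc; rewrite e; exact: crossing_2h.
have nt : ~ trapped a.
  move=> /trapped_open[d d0 hd].
  pose y := Num.min (2 * h) (a + d / 2).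
  have ya : a < y by rewrite lt_min a2' /=; lra.
  have y2 : y <= 2 * h by rewrite ge_min lexx.
  have yd : y <= a + d / 2 by rewrite ge_min lexx orbT.
  have : S y by split; [lra|apply: hd; rewrite ger0_norm; lra].
  by move=> /(ub_le_sup (proj2 hS)); rewrite -/a; lra.
exists a; split => //; rewrite a2' andbT lt_neqAle a1 andbT.
by apply/eqP => e; apply: nt; rewrite -e; exact: trapped1.
Qed.

(** * Positivity, monotonicity and decay of the ground state *)

Section ground_state.
Variable a : R.
Hypotheses (a_itv : 1 < a < 2 * h) (not_crossing : ~ crossing a) (not_trapped : ~ trapped a).
Let W := sol a.

Lemma ground_ge0 s : 0 <= s -> 0 <= W s.
Proof.
rewrite le_eqVlt => /orP[/eqP <-|s0].
  by have /andP[] := a_itv; rewrite /W sol0; lra.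
by rewrite leNgt; apply/negP => Ws; apply: not_crossing; exists s.
Qed.

(** A zero would be a minimum, so w and the flux would vanish there together; Gronwall's inequality,
    used backwards from that point, excludes it. *)
Lemma ground_gt0 s : 0 <= s -> 0 < W s.
Proof.
move=> s0; have a0 : 0 < a by have /andP[] := a_itv; lra.
move: s0; rewrite le_eqVlt => /orP[/eqP <-|s0]; first by rewrite /W sol0.
rewrite lt_neqAle eq_sym ground_ge0 ?ltW// andbT; apply/eqP => Ws.
have ds : sol' a s = 0.
  have h2 : is_derive s 1 W 0.
    apply: (@derive1_at_min _ _ 0 (s + 1)); [lra| |by rewrite in_itv /=; lra|].
    - by move=> x _; case: (derive_sol a x).
    - by move=> x; rewrite in_itv /= Ws => /andP[x0 _]; apply: ground_ge0; exact: ltW.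
  by have := derive_sol a s; rewrite -/W => h1; rewrite -(@derive_val _ _ _ _ _ _ _ h1) (@derive_val _ _ _ _ _ _ _ h2).
(* Close to 0 the solution is positive because its slope is bounded, and staying at distance [d]
   from 0 ensures |w'| <= |flux| / d. *)
pose d := Num.min (a / (2 * (M + 1))) (s / 2).
have M1 : 0 < M + 1 by have := M_ge0; lra.
have d0 : 0 < d by rewrite lt_min !divr_gt0 ?mulr_gt0.
have ds2 : d < s by rewrite gt_min; apply/orP; right; lra.
have Wd : 0 < W d.
  have := sol_lip a d 0; rewrite sol0 subr0 (ger0_norm (ltW d0)) ler_norml => /andP[+ _].
  have : d * (2 * (M + 1)) <= a by rewrite -ler_pdivlMr ?mulr_gt0// ge_min lexx.
  by rewrite /W; have := M_ge0; nra.
(* |N'| <= K N for N = w^2 + flux^2, so N exp(K x) is nondecreasing on [d, s]. *)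
pose K := d^-1 + L.
pose N x := W x ^+ 2 + flux a x ^+ 2.
have dN x : is_derive x 1 N (2 * W x * sol' a x + 2 * flux a x * F (W x)).
  by apply: (derive_eq (derive_add (derive_exp 2 (derive_sol a x)) (derive_exp 2 (derive_flux a x)))); rewrite /= !expr1.
have dE x : is_derive x 1 (fun x => expR (K * x)) (K * expR (K * x)).
  have dK : is_derive x 1 ( *%R K) K by apply: (derive_eq (derive_scale K (derive_id x))); rewrite mulr1.
  by apply: (derive_eq (@derive_comp _ expR ( *%R K) x _ _ (is_derive_expR (K * x)) dK)); rewrite mulrC.
have : N d * expR (K * d) <= N s * expR (K * s).
  apply: (@nondecreasing_derive _ (fun x => N x * expR (K * x)) (fun x =>
    (2 * W x * sol' a x + 2 * flux a x * F (W x)) * expR (K * x) + N x * (K * expR (K * x))) d s (ltW ds2)).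
    by move=> x _; apply: derive_mul (dN x) (dE x).
  move=> x /andP[dx xs]; rewrite [X in _ + X]mulrA -mulrDl mulr_ge0 ?(ltW (expR_gt0 _))//.
  have FW : `|F (W x)| <= L * `|W x|.
    by have := nonlin_lip (W x) 0; rewrite (nonlin_neg (lexx 0)) !subr0.
  have sW : `|sol' a x| <= d^-1 * `|flux a x|.
    have x0 : 0 < x by apply: lt_trans dx.
    rewrite fluxE normrM (gtr0_norm x0) mulrA ler_peMl// mulrC ler_pdivlMr// mul1r.
    exact: ltW.
  rewrite /N /K; set w := W x in FW *; set v := flux a x in sW *.
  set f := F w in FW *; set w1 := sol' a x in sW *.
  have i0 : 0 < d^-1 by rewrite invr_gt0.
  have l0 := L_gt0.
  have e1 : - (w * w1) <= d^-1 * (`|w| * `|v|).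
    apply: le_trans (ler_norm _) _; rewrite normrN normrM mulrCA ler_wpM2l//.
  have e2 : - (v * f) <= L * (`|w| * `|v|).
    apply: le_trans (ler_norm _) _; rewrite normrN normrM mulrC mulrA ler_wpM2r//.
  have e3 : 2 * (`|w| * `|v|) <= w ^+ 2 + v ^+ 2.
    rewrite -(real_normK (num_real w)) -(real_normK (num_real v)).
    by have := sqr_ge0 (`|w| - `|v|); lra.
  have e4 : (d^-1 + L) * (2 * (`|w| * `|v|)) <= (d^-1 + L) * (w ^+ 2 + v ^+ 2).
    by rewrite ler_wpM2l//; lra.
  by lra.
rewrite {2}/N Ws fluxE ds mulr0 expr0n addr0 mul0r leNgt mulr_gt0 ?expR_gt0//.
by rewrite /N ltr_wpDr ?sqr_ge0// exprn_gt0.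
Qed.

Lemma ground_energy s : 0 < s -> 0 <= energy a s.
Proof.
move=> s0; rewrite leNgt; apply/negP => Es; apply: not_trapped; exists s; split => // x /andP[x0 _].
exact: ground_gt0.
Qed.

(** At a first zero z of the flux, nonnegative energy forces pot(w(z)) <= 0, hence w(z) > 1. As w
    has decreased up to z, F(w) <= 0 all the way, and the flux could not have risen back to 0. *)
Lemma ground_flux s : 0 < s -> flux a s < 0.
Proof.
have /andP[a1 a2] := a_itv; have h2 := h_gt2.
move=> s0; rewrite ltNge; apply/negP => vs.
(* On [0, e] the solution is still above 1, so the flux starts out negative. *)
pose e := Num.min ((a - 1) / (2 * (M + 1))) s.
have M1 : 0 < M + 1 by have := M_ge0; lra.
have e0 : 0 < e by rewrite lt_min s0 divr_gt0 ?mulr_gt0//; lra.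
have es : e <= s by rewrite ge_min lexx orbT.
have We x : 0 <= x <= e -> 1 < W x <= B.
  move=> /andP[x0 xe].
  have := sol_lip a x 0; rewrite sol0 subr0 (ger0_norm x0) ler_norml -/W => /andP[l1 l2].
  have : e * (2 * (M + 1)) <= a - 1 by rewrite -ler_pdivlMr ?mulr_gt0// ge_min lexx.
  by have := M_ge0; rewrite /B; nra.
have ve x : 0 < x <= e -> flux a x < 0.
  move=> /andP[x0 xe].
  have [c /andP[c0 cx]] := mean_value x0 (fun y _ => derive_flux a y).
  rewrite (fluxE a 0) mul0r !subr0 => ->; rewrite pmulr_llt0//.
  by apply: nonlin_neg_strict; apply: We; lra.
have [z [/andP[ez zs] vz below]] : exists z, [/\ e < z <= s, flux a z = 0 & forall y, e <= y < z -> flux a y < 0].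
  apply: first_zero => //; [exact: flux_continuous|by apply: ve; lra].
have below' y : 0 < y < z -> flux a y < 0.
  move=> /andP[y0 yz]; case: (lerP y e) => ye; first by apply: ve; rewrite y0.
  by apply: below; rewrite yz andbT ltW.
have z0 : 0 < z by lra.
have decr x : 0 <= x <= z -> W z <= W x <= a.
  move=> /andP[x0 xz].
  have dneg y : 0 < y < z -> sol' a y <= 0.
    by move=> yz; have := below' y yz; rewrite fluxE pmulr_rlt0; [exact: ltW|case/andP: yz].
  apply/andP; split.
    apply: (@nonincreasing_derive _ W (sol' a)) => // [y _|y /andP[y0 yz]]; first exact: derive_sol.
    by apply: dneg; lra.
  rewrite -[leRHS](sol0 a).
  apply: (@nonincreasing_derive _ W (sol' a)) => // [y _|y /andP[y0 yz]]; first exact: derive_sol.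
  by apply: dneg; lra.
have Wz1 : 1 < W z.
  rewrite ltNge; apply/negP => Wz.
  have := ground_energy z0; rewrite energyE vz !mul0r sub0r -/W.
  have := ground_gt0 (ltW z0) => Wz0.
  have : W z ^+ 2 / 6 <= pot (W z) by apply: pot_ge; lra.
  have : 0 < W z ^+ 2 by rewrite exprn_gt0.
  lra.
have : flux a z <= flux a e.
  apply: (@nonincreasing_derive _ (flux a) (fun x => F (W x))); first exact: ltW.
    by move=> x _; exact: derive_flux.
  move=> x /andP[ex xz]; apply: nonlin_nonpos.
  have := decr x; rewrite (ltW xz) andbT => /(_ _)/andP; case; lra.
by have := ve e; rewrite e0 lexx vz => /(_ isT); lra.
Qed.

Lemma ground_sol' s : 0 < s -> sol' a s < 0.
Proof. by move=> s0; have := ground_flux s0; rewrite fluxE pmulr_rlt0. Qed.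

Lemma ground_decr x y : 0 <= x -> x <= y -> W y <= W x.
Proof.
move=> x0 xy; apply: (@nonincreasing_derive _ W (sol' a)) => // [z _|z /andP[xz _]]; first exact: derive_sol.
by apply/ltW/ground_sol'; lra.
Qed.

(** Otherwise F(w) <= 0 for s >= 1, the flux stays below -c, and w falls logarithmically without
    bound. *)
Lemma ground_lt1 : exists2 s : R, 1 <= s & W s < 1.
Proof.
apply: contrapT => H.
have W1 s : 1 <= s -> 1 <= W s.
  by move=> s1; rewrite leNgt; apply/negP => ?; apply: H; exists s.
set c := - flux a 1; have c0 : 0 < c by have := ground_flux ltr01; rewrite /c; lra.
have vc s : 1 < s -> flux a s <= - c.
  move=> s1; rewrite /c opprK.
  apply: (@nonincreasing_derive _ (flux a) (fun x => F (W x))); first exact: ltW.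
    by move=> x _; exact: derive_flux.
  by move=> x /andP[x1 _]; apply/nonlin_nonpos/W1/ltW.
(* Here c ln s = W 1 + c, more than the height available. *)
pose s := expR (W 1 / c + 1).
have s1 : 1 <= s.
  rewrite -expR0 ler_expR; have : 0 < W 1 / c by rewrite divr_gt0//; exact: ground_gt0.
  by lra.
have := @sol_le a (- c) 1 s ltr01 s1 (fun x hx => vc x (proj1 (andP hx))).
rewrite ln1 subr0 expRK -/W mulNr mulrDr mulr1 mulrC divfK ?gt_eqF//.
by have := W1 s s1; lra.
Qed.

(** Nonnegative energy bounds |w'| from below by w / sqrt(3 s): a decay of type exp(-C sqrt s),
    exponential in the radius. *)
Lemma ground_sol'_le s : 0 < s -> W s <= 1 -> W s ^+ 2 / 3 <= s * sol' a s ^+ 2.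
Proof.
move=> s0 Ws; have := ground_energy s0; rewrite energyE fluxE -/W.
have W0 := ground_gt0 (ltW s0).
have : W s ^+ 2 / 6 <= pot (W s) by apply: pot_ge; rewrite (ltW W0).
by move: (W s) (sol' a s) (pot (W s)) => u v w; lra.
Qed.

(** By [ground_sol'_le], (1 + s) |w'| dominates N w once w <= 1 and s >= 3 N^2, so (1 + s)^N w
    eventually decreases. *)
Lemma ground_rapid N : exists C, forall s, 0 <= s -> (1 + s) ^+ N * W s <= C.
Proof.
have [s1 s11 Ws1] := ground_lt1.
pose t := s1 + 6 * N%:R ^+ 2.
have N2 : 0 <= N%:R ^+ 2 :> R by exact: sqr_ge0.
have t1 : 1 <= t by rewrite /t; lra.
pose f s := (1 + s) ^+ N * W s.
have df x : is_derive x 1 f (N%:R * (1 + x) ^+ N.-1 * W x + (1 + x) ^+ N * sol' a x).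
  apply: (derive_eq (derive_mul (derive_exp N (derive_add (derive_cst 1 x) (derive_id x))) (derive_sol a x))).
  by rewrite add0r mulr1.
have decr s : t <= s -> f s <= f t.
  move=> ts; apply: (nonincreasing_derive ts (fun x _ => df x)) => x /andP[tx xs].
  have x0 : 0 < x by lra.
  have Wx1 : W x <= 1.
    by apply: le_trans (ltW Ws1); apply: ground_decr; rewrite /t in tx; lra.
  have W0 : 0 < W x by apply/ground_gt0/ltW.
  have v0 : sol' a x < 0 by exact: ground_sol'.
  have g := ground_sol'_le x0 Wx1.
  have xN : 6 * N%:R ^+ 2 <= x by rewrite /t in tx; lra.
  have x1 : 0 < 1 + x by lra.
  have n0 : 0 <= N%:R :> R by [].
  rewrite -(pmulr_rle0 _ x1).
  have -> : (1 + x) * (N%:R * (1 + x) ^+ N.-1 * W x + (1 + x) ^+ N * sol' a x) =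
      (1 + x) ^+ N * (N%:R * W x + (1 + x) * sol' a x).
    by case: (N) => [|n]; rewrite /= ?exprS; ring.
  rewrite pmulr_rle0 ?exprn_gt0// -lerBrDr sub0r -mulrN.
  rewrite -ler_sqr ?nnegrE ?mulr_ge0//; [|lra|lra|lra].
  rewrite !exprMn sqrrN; move: g W0 xN N2 x0.
  move: (W x) (sol' a x) (N%:R ^+ 2) => w v n2 g w0 xN n20 x0.
  have q : n2 * w ^+ 2 <= x * (x * v ^+ 2).
    apply: (@le_trans _ _ (x * (w ^+ 2 / 3))); last by rewrite ler_pM2l.
    by have := sqr_ge0 w; nra.
  by have := sqr_ge0 v; nra.
have [M' _ hM] : exists2 M, 0 <= M & forall x, 0 <= x <= t -> `|f x| <= M.
  apply: continuous_bounded; first by lra.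
  by move=> x _; exact: is_derive_continuous (df x).
exists M' => s s0; case: (lerP s t) => st.
  by apply: le_trans (ler_norm _) (hM s _); rewrite s0.
apply: le_trans (decr s (ltW st)) _; apply: le_trans (ler_norm _) (hM t _).
by rewrite lexx andbT; lra.
Qed.

(** Once w < 1 the flux increases, so |w'(2 s)| is at most |w'| at a mean value point of [s, 2 s],
    hence at most w(s) / s. *)
Lemma ground_sol'_rapid N : exists C, forall s, 0 <= s -> (1 + s) ^+ N * `|sol' a s| <= C.
Proof.
have [s1 s11 Ws1] := ground_lt1.
have [C hC] := ground_rapid N.
have vN s : s1 <= s -> `|sol' a (2 * s)| <= W s.
  move=> ss; have s0 : 0 < s by lra.
  have s2 : s < 2 * s by lra.
  have [c /andP[sc cs] e] := mean_value s2 (fun x _ => derive_sol a x).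
  have c0 : 0 < c by lra.
  have : flux a c <= flux a (2 * s).
    apply: (@nondecreasing_derive _ (flux a) (fun x => F (W x))); first exact: ltW.
      by move=> x _; exact: derive_flux.
    move=> x /andP[cx xs]; apply: nonlin_nonneg; apply: le_trans (ltW Ws1).
    by apply: ground_decr; lra.
  rewrite !fluxE => fl.
  have v1 : sol' a c < 0 by exact: ground_sol'.
  have v2 : sol' a (2 * s) < 0 by apply: ground_sol'; lra.
  have W2 : 0 < W (2 * s) by apply: ground_gt0; lra.
  have v12 : sol' a c <= sol' a (2 * s) by nra.
  rewrite ltr0_norm//; move: e; rewrite -/W; nra.
have [M' M'0 hM] : exists2 M : R, 0 <= M & forall x, 0 <= x <= 2 * s1 -> `|(1 + x) ^+ N * sol' a x| <= M.
  apply: continuous_bounded; first by lra.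
  move=> x _; apply: continuous_at_mul; last exact: sol'_continuous.
  exact: is_derive_continuous (derive_exp N (derive_add (derive_cst 1 x) (derive_id x))).
exists (M' + 2 ^+ N * C) => s s0.
have C0 : 0 <= C by apply: le_trans (hC 0 (lexx 0)); rewrite mulr_ge0 ?exprn_ge0 ?ltW ?ground_gt0//; lra.
case: (lerP s (2 * s1)) => ss.
  have := hM s; rewrite s0 ss normrM => /(_ isT).
  have e0 : 0 <= (1 + s) ^+ N by rewrite exprn_ge0//; lra.
  rewrite (ger0_norm e0) => /le_trans; apply.
  by rewrite lerDl mulr_ge0// exprn_ge0.
have e2 : 2 * (s / 2) = s by field.
have hv : `|sol' a s| <= W (s / 2) by rewrite -{1}e2; apply: vN; lra.
apply: (@le_trans _ _ (2 ^+ N * C)); last by rewrite lerDr.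
apply: (@le_trans _ _ ((2 * (1 + s / 2)) ^+ N * W (s / 2))).
  rewrite ler_pM ?exprn_ge0//; [lra| ].
  by rewrite lerXn2r ?nnegrE; lra.
by rewrite exprMn -mulrA ler_wpM2l ?exprn_ge0//; apply: hC; lra.
Qed.

(** Moving left of 0 by less than 1 / (M + 1) changes w by less than 1, and 1 < a < B - 1, so the
    clamp is inactive there. *)
Lemma ground_near0 : exists2 d : R, 0 < d & forall s, - d < s -> 0 <= W s <= B.
Proof.
have /andP[a1 a2] := a_itv; have h2 := h_gt2.
have M1 : 0 < M + 1 by have := M_ge0; lra.
exists (1 / (M + 1)) => [|s ds]; first by rewrite divr_gt0.
case: (lerP 0 s) => s0.
  rewrite ground_ge0//=; apply: le_trans (ground_decr (lexx 0) s0) _.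
  by rewrite /W sol0 /B; lra.
have := sol_lip a s 0; rewrite sol0 subr0 (ltr0_norm s0) ler_norml -/W => /andP[l1 l2].
have : - s * (M + 1) <= 1 by rewrite -ler_pdivlMr//; lra.
by have := M_ge0; rewrite /B; nra.
Qed.

End ground_state.
End Shooting.

Theorem ground_profile (R : realType) (p : nat) : (2 <= p)%N ->
  exists (W W1 : R -> R) (u0 : R), [/\ u0 < 0,
    forall s : R, is_derive s 1 W (W1 s),
    forall s, u0 < s -> W1 s = average 0 (fun x => W x - W x ^+ p) s,
    forall s, 0 <= s -> 0 < W s &
    forall N, exists C, forall s, 0 <= s ->
      (1 + s) ^+ N * `|W s| <= C /\ (1 + s) ^+ N * `|W1 s| <= C].
Proof.
(* Any [h] with ln(h / 2) > 8 * 4^p will do; the added 1 makes the inequality strict. *)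
move=> p2; pose h : R := 2 * expR (8 * 4 ^+ p + 1).
have h0 : 2 < h.
  have q0 : 0 <= (4 : R) ^+ p by exact: exprn_ge0.
  have : expR 0 < expR (8 * 4 ^+ p + 1) :> R by rewrite ltr_expR; lra.
  by rewrite expR0 /h; lra.
have hl : 8 * 4 ^+ p < ln (h / 2) by rewrite /h mulrAC divff// mul1r expRK ltrDl ltr01.
have [a [a12 nc nt]] := exists_neither p2 h0 hl.
have [d d0 hd] := ground_near0 p2 h0 a12 nc nt.
exists (sol p h a), (sol' p h a), (- d); split; first by rewrite oppr_lt0.
- by move=> s; exact: derive_sol.
- move=> s ds; rewrite sol'E; apply: eq_Rintegral => t; rewrite inE /= in_itv /= => t01.
  congr (_ * _); apply: nonlin_in; apply: hd.
  have [t0 t1] : 0 <= t /\ t <= 1 by apply/andP.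
  case: (lerP 0 s) => s0; first by have := mulr_ge0 s0 t0; lra.
  by nra.
- by move=> s s0; exact: ground_gt0.
- move=> N; have [C1 h1] := ground_rapid p2 h0 a12 nc nt N.
  have [C2 h2] := ground_sol'_rapid p2 h0 a12 nc nt N.
  exists (Num.max C1 C2) => s s0; rewrite !le_max h2// orbT; split => //.
  by rewrite ger0_norm ?h1//; apply: ltW; exact: ground_gt0.
Qed.

(** * Regularity and decay of the ground state *)

Section Regularity.
Context {R : realType}.
Variable u0 : R.
Hypothesis u0_lt0 : u0 < 0.
Implicit Types (f g : R -> R) (P : (R -> R) -> Prop).

(** [P] will be continuity and then rapid decay: both propagate through the nonlinearity by the same
    algebra. *)
Fixpoint iter_diff P (n : nat) f : Prop :=
  P f /\ match n with
         | 0 => True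
         | n'.+1 => (forall s, u0 < s -> derivable f s 1) /\ iter_diff P n' (derive1 f)
         end.

Lemma derive1_eq f (s d : R) : is_derive s 1 f d -> (derive1 f) s = d.
Proof. by move=> h; rewrite derive1E (@derive_val _ _ _ _ _ _ _ h). Qed.

Lemma derivable_is_derive f (s : R) : derivable f s 1 -> is_derive s 1 f ((derive1 f) s).
Proof. by move=> h; rewrite derive1E; apply: DeriveDef. Qed.

Lemma derive_right_ext f g s d : (forall x, u0 < x -> f x = g x) -> u0 < s ->
  is_derive s 1 f d -> is_derive s 1 g d.
Proof.
move=> fg us; apply: (@derive_near_itv _ _ _ u0 (s + 1)); first by rewrite us ltrDl ltr01.
by move=> y /andP[uy _]; exact: fg.
Qed.

(** The first clause makes [P] blind to what happens left of [u0], where iterated derivatives are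
    not under control. *)
Definition ring_closed P := [/\ forall f g, (forall s, u0 < s -> f s = g s) -> P f -> P g,
  forall f g, P f -> P g -> P (fun x => f x - g x),
  forall f g, P f -> P g -> P (fun x => f x + g x) &
  forall f g, P f -> P g -> P (fun x => f x * g x)].

Section ring_closed.
Variables (P : (R -> R) -> Prop) (gP : ring_closed P).

Lemma iter_diff0 n f : iter_diff P n f -> P f.
Proof. by case: n => [|n] []. Qed.

Lemma iter_diffS n f : iter_diff P n.+1 f -> iter_diff P n f.
Proof.
elim: n f => [|n IH] f [Pf [df hf]]; first by split.
by split => //; split => //; exact: IH.
Qed.

Lemma iter_diff_ext n f g : (forall s, u0 < s -> f s = g s) -> iter_diff P n f -> iter_diff P n g.
Proof.
have [Pe _ _ _] := gP.
elim: n f g => [|n IH] f g fg; first by move=> [/(Pe _ _ fg)].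
move=> [Pf [df hf]]; split; first exact: Pe Pf.
have dg s : u0 < s -> is_derive s 1 g ((derive1 f) s).
  by move=> us; apply: (derive_right_ext fg us); apply: derivable_is_derive; exact: df.
split; first by move=> s /dg [].
by apply: IH hf => s /dg/derive1_eq.
Qed.

Lemma iter_diffB n f g : iter_diff P n f -> iter_diff P n g -> iter_diff P n (fun x => f x - g x).
Proof.
have [_ PB _ _] := gP.
elim: n f g => [|n IH] f g; first by move=> [Pf _] [Pg _]; split=> //; exact: PB.
move=> [Pf [df hf]] [Pg [dg hg]]; split; first exact: PB.
have d s : u0 < s -> is_derive s 1 (fun x => f x - g x) ((derive1 f) s - (derive1 g) s).
  by move=> us; apply: derive_sub; apply: derivable_is_derive; [exact: df|exact: dg].
split; first by move=> s /d [].
by apply: (@iter_diff_ext _ (fun x => (derive1 f) x - (derive1 g) x)); [move=> s /d/derive1_eq|exact: IH].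
Qed.

Lemma iter_diffD n f g : iter_diff P n f -> iter_diff P n g -> iter_diff P n (fun x => f x + g x).
Proof.
have [_ _ PD _] := gP.
elim: n f g => [|n IH] f g; first by move=> [Pf _] [Pg _]; split=> //; exact: PD.
move=> [Pf [df hf]] [Pg [dg hg]]; split; first exact: PD.
have d s : u0 < s -> is_derive s 1 (fun x => f x + g x) ((derive1 f) s + (derive1 g) s).
  by move=> us; apply: derive_add; apply: derivable_is_derive; [exact: df|exact: dg].
split; first by move=> s /d [].
by apply: (@iter_diff_ext _ (fun x => (derive1 f) x + (derive1 g) x)); [move=> s /d/derive1_eq|exact: IH].
Qed.

Lemma iter_diffM n f g : iter_diff P n f -> iter_diff P n g -> iter_diff P n (fun x => f x * g x).
Proof.
have [_ _ _ PM] := gP.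
elim: n f g => [|n IH] f g; first by move=> [Pf _] [Pg _]; split=> //; exact: PM.
move=> hf hg; have [Pf [df hf']] := hf; have [Pg [dg hg']] := hg; split; first exact: PM.
have d s : u0 < s -> is_derive s 1 (fun x => f x * g x) ((derive1 f) s * g s + f s * (derive1 g) s).
  by move=> us; apply: derive_mul; apply: derivable_is_derive; [exact: df|exact: dg].
split; first by move=> s /d [].
apply: (@iter_diff_ext _ (fun x => (derive1 f) x * g x + f x * (derive1 g) x)); first by move=> s /d/derive1_eq.
by apply: iter_diffD; apply: IH => //; exact: iter_diffS.
Qed.

Lemma iter_diff_exp n f k : iter_diff P n f -> iter_diff P n (fun x => f x ^+ k.+1).
Proof.
move=> hf; elim: k => [|k IH].
  by apply: iter_diff_ext hf => s _; rewrite expr1.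
apply: (@iter_diff_ext _ (fun x => f x * f x ^+ k.+1)); first by move=> s _; rewrite [RHS]exprS.
exact: iter_diffM.
Qed.

Lemma iter_diff_derivable n f : iter_diff P n.+1 f -> forall s, u0 < s -> derivable (derive1n n f) s 1.
Proof.
elim: n f => [|n IH] f [Pf [df hf]] s us; first exact: df.
by rewrite derive1Sn; exact: IH.
Qed.

Lemma iter_diff_last n f : iter_diff P n f -> P (derive1n n f).
Proof.
elim: n f => [|n IH] f; first by case.
by move=> [Pf [df hf]]; rewrite derive1Sn; exact: IH.
Qed.

Lemma iter_diff_intro n f : iter_diff P n f -> (forall s, u0 < s -> derivable (derive1n n f) s 1) ->
  P (derive1n n.+1 f) -> iter_diff P n.+1 f.
Proof.
elim: n f => [|n IH] f; first by move=> [Pf _] df Pf'; do 2!split => //.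
move=> [Pf [df hf]] d Pd; split; first exact: Pf.
split; first exact: df.
apply: IH; first exact: hf.
- by move=> s us; rewrite -derive1Sn; exact: d.
- by rewrite -derive1Sn; exact: Pd.
Qed.

End ring_closed.

Definition continuous_right f := forall s, u0 < s -> {for s, continuous f}.

Lemma ring_closed_continuous : ring_closed continuous_right.
Proof.
split.
- move=> f g fg cf s us; have : (f @ s --> f s) := cf s us.
  rewrite /prop_for /continuous_at (fg s us); apply: cvg_trans; apply: near_eq_cvg.
  have sI : s \in `]u0, (s + 1)[ by rewrite in_itv /= us ltrDl ltr01.
  by have := near_in_itvoo sI; apply: filterS => y; rewrite in_itv => /andP[/fg].
- by move=> f g cf cg s us; apply: continuousB; [exact: cf|exact: cg].
- by move=> f g cf cg s us; apply: continuousD; [exact: cf|exact: cg].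
- by move=> f g cf cg s us; apply: continuous_at_mul; [exact: cf|exact: cg].
Qed.

(** The derivative of [average j f] is the average of f' with index j + 1, so the induction needs a
    general [j]. *)
Lemma iter_diff_average n j f : iter_diff continuous_right n f ->
  iter_diff continuous_right n (average j f).
Proof.
elim: n j f => [|n IH] j f.
  by move=> [cf _]; split => // s; exact: continuous_average.
move=> [cf [df hf]].
have d s : u0 < s -> is_derive s 1 (average j f) (average j.+1 (derive1 f) s).
  move=> us; apply: (@is_derive_average R u0 u0_lt0 j f (derive1 f) _ _ s us) => x ux.
    by apply: derivable_is_derive; exact: df.
  exact: (iter_diff0 hf).
split; first by move=> s /d; exact: is_derive_continuous.
split; first by move=> s /d [].
by apply: (@iter_diff_ext _ ring_closed_continuous n (average j.+1 (derive1 f))); [move=> s /d/derive1_eq|exact: IH].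
Qed.

Definition rapid f := forall N, exists C, forall s, 0 <= s -> (1 + s) ^+ N * `|f s| <= C.

Lemma ring_closed_rapid : ring_closed rapid.
Proof.
have add f g h : (forall s, `|h s| <= `|f s| + `|g s|) -> rapid f -> rapid g -> rapid h.
  move=> hfg rf rg N; have [C1 h1] := rf N; have [C2 h2] := rg N.
  exists (C1 + C2) => s s0; apply: le_trans (lerD (h1 s s0) (h2 s s0)).
  by rewrite -mulrDr ler_wpM2l ?exprn_ge0//; lra.
split.
- move=> f g fg rf N; have [C hC] := rf N; exists C => s s0.
  by rewrite -fg ?hC//; have := u0_lt0; lra.
- by move=> f g; apply: add => s; exact: ler_normB.
- by move=> f g; apply: add => s; exact: ler_normD.
- move=> f g rf rg N; have [C1 h1] := rf N; have [C2 h2] := rg 0%N.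
  exists (C1 * C2) => s s0; rewrite normrM mulrA ler_pM ?h1 ?mulr_ge0 ?exprn_ge0//; first lra.
  by have := h2 s s0; rewrite expr0 mul1r.
Qed.

Variables (p : nat) (W W1 : R -> R).
Hypotheses (p_gt0 : (0 < p)%N) (dW : forall s : R, is_derive s 1 W (W1 s))
  (W1E : forall s, u0 < s -> W1 s = average 0 (fun x => W x - W x ^+ p) s)
  (rW : rapid W) (rW1 : rapid W1).
Let G x := W x - W x ^+ p.

Let W_derive1 s : (derive1 W) s = W1 s. Proof. exact: derive1_eq. Qed.

Lemma iter_diff_nonlin P n : ring_closed P -> iter_diff P n W -> iter_diff P n G.
Proof.
move=> gP hW; apply: iter_diffB => //.
by rewrite /G -(prednK p_gt0); apply: iter_diff_exp.
Qed.

(** Bootstrap: w' is the average of w - w^p, hence as smooth as w itself. *)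
Lemma profile_smooth n : iter_diff continuous_right n W.
Proof.
elim: n => [|n IH]; first by split => // s _; exact: is_derive_continuous (dW s).
split; first by move=> s _; exact: is_derive_continuous (dW s).
split; first by move=> s _; case: (dW s).
apply: (@iter_diff_ext _ ring_closed_continuous n (average 0 G)).
  by move=> s us; rewrite W_derive1 W1E.
by apply: iter_diff_average; apply: iter_diff_nonlin => //; exact: ring_closed_continuous.
Qed.

Lemma profile_derive n s : u0 < s -> is_derive s 1 (derive1n n W) ((derive1n n.+1 W) s).
Proof.
move=> us; apply: derivable_is_derive.
exact: iter_diff_derivable (profile_smooth n.+1) _ us.
Qed.

(** The integrated equation for s w', differentiated n + 1 times with the Leibniz rule. *)
Lemma profile_equation n s : u0 < s ->
  s * (derive1n n.+2 W) s + n.+1%:R * (derive1n n.+1 W) s = (derive1n n G) s.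
Proof.
elim: n s => [|n IH] s us.
  have cG : continuous G.
    move=> x; apply: is_derive_continuous (derive_sub (dW x) (derive_exp p (dW x))).
  have h1 := derive_average s cG.
  have h2 : is_derive s 1 (fun x => x * average 0 G x) (1 * (derive1n 1 W) s + s * (derive1n 2 W) s).
    apply: (@derive_right_ext (fun x => x * (derive1n 1 W) x)) => //.
      by move=> x ux; rewrite /= W_derive1 W1E.
    exact: derive_mul (derive_id s) (profile_derive 1 us).
  by rewrite /= -[RHS](derive1_eq h1) (derive1_eq h2) mul1r addrC.
have h1 : is_derive s 1 (derive1n n G) (1 * (derive1n n.+2 W) s + s * (derive1n n.+3 W) s + n.+1%:R * (derive1n n.+2 W) s).
  apply: (@derive_right_ext (fun x => x * (derive1n n.+2 W) x + n.+1%:R * (derive1n n.+1 W) x)) => //.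
  apply: derive_add; first exact: derive_mul (derive_id s) (profile_derive n.+2 us).
  exact: derive_scale (profile_derive n.+1 us).
rewrite -[(derive1n n.+1 G) s]/(derive1 (derive1n n G) s) (derive1_eq h1) -(natr1 n.+1).
move: (derive1n n.+2 W s) (derive1n n.+3 W s) => x y; ring.
Qed.

(** For s >= 1 the equation expresses the derivative of order n + 2 through lower ones, with a
    coefficient s >= 1 in front; on [0, 1] continuity suffices. *)
Lemma profile_rapid n : iter_diff rapid n.+1 W.
Proof.
elim: n => [|n IH].
  split=> //; split; first by move=> s _; case: (dW s).
  by split => //; move=> N; have [C hC] := rW1 N; exists C => s; rewrite W_derive1; exact: hC.
apply: iter_diff_intro; first exact: IH.
  by move=> s us; case: (profile_derive n.+1 us).
have rG : rapid (derive1n n G).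
  apply: iter_diff_last; apply: iter_diff_nonlin; first exact: ring_closed_rapid.
  exact: iter_diffS.
have rn : rapid (derive1n n.+1 W) by exact: iter_diff_last IH.
move=> N; have [C1 h1] := rG N; have [C2 h2] := rn N.
have [M M0 hM] : exists2 M : R, 0 <= M & forall x, 0 <= x <= 1 -> `|(1 + x) ^+ N * (derive1n n.+2 W) x| <= M.
  apply: continuous_bounded => // x /andP[x0 _]; apply: continuous_at_mul.
    exact: is_derive_continuous (derive_exp N (derive_add (derive_cst 1 x) (derive_id x))).
  apply: is_derive_continuous (profile_derive n.+2 _).
  by have := u0_lt0; lra.
have C10 : 0 <= C1 by apply: le_trans (h1 0 (lexx 0)); rewrite mulr_ge0 ?exprn_ge0//; lra.
have C20 : 0 <= C2 by apply: le_trans (h2 0 (lexx 0)); rewrite mulr_ge0 ?exprn_ge0//; lra.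
exists (M + (C1 + n.+1%:R * C2)) => s s0.
have e0 : 0 <= (1 + s) ^+ N by rewrite exprn_ge0//; lra.
case: (lerP s 1) => s1.
  have := hM s; rewrite s0 s1 normrM (ger0_norm e0) => /(_ isT)/le_trans; apply.
  by rewrite lerDl addr_ge0 ?mulr_ge0.
apply: (@le_trans _ _ (C1 + n.+1%:R * C2)); last by rewrite lerDr.
apply: (@le_trans _ _ ((1 + s) ^+ N * (`|(derive1n n G) s| + n.+1%:R * `|(derive1n n.+1 W) s|))).
  rewrite ler_wpM2l//.
  have us : u0 < s by have := u0_lt0; lra.
  have -> : n.+1%:R * `|(derive1n n.+1 W) s| = `|n.+1%:R * (derive1n n.+1 W) s| by rewrite normrM ger0_norm.
  apply: le_trans (ler_normB _ _); rewrite -(profile_equation n us) addrK normrM.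
  by rewrite ler_peMl// ger0_norm// ltW.
rewrite mulrDr mulrCA lerD ?h1//.
by rewrite ler_wpM2l// h2.
Qed.

End Regularity.

Theorem ground_profile_smooth (R : realType) (p : nat) : (2 <= p)%N ->
  exists (w : nat -> R -> R) (u0 : R), [/\ u0 < 0,
    forall n (s : R), u0 < s -> is_derive s 1 (w n) (w n.+1 s),
    forall s, u0 < s -> s * w 2%N s + w 1%N s = w 0%N s - w 0%N s ^+ p,
    forall s, 0 <= s -> 0 < w 0%N s &
    forall n, rapid (w n)].
Proof.
move=> p2; have [W [W1 [u0 [u0_lt0 dW W1E W_gt0 dec]]]] := ground_profile R p2.
have p0 : (0 < p)%N by exact: leq_trans p2.
have rW : rapid W by move=> N; have [C hC] := dec N; exists C => s /hC[].
have rW1 : rapid W1 by move=> N; have [C hC] := dec N; exists C => s /hC[].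
exists (fun n => derive1n n W), u0; split; [exact: u0_lt0| | |exact: W_gt0|].
- by move=> n s us; exact: (profile_derive u0_lt0 p0 dW W1E).
- by move=> s us; rewrite -(mul1r (derive1n 1 W s)); exact: (profile_equation u0_lt0 p0 dW W1E 0 us).
- case=> [//|n]; exact: (iter_diff_last (profile_rapid u0_lt0 p0 dW W1E rW rW1 n)).
Qed.

(** * Integration on the plane *)

Section DominatedFubini.
Context d (T : measurableType d) (R : realType) (m : {sigma_finite_measure set T -> \bar R}).
Variables (w : T -> R) (w_ge0 : forall x, 0 <= w x) (iw : m.-integrable setT (EFin \o w)).
Implicit Types (h : T * T -> R) (C : R).

Let mw : measurable_fun setT w.
Proof. by case/integrableP: iw => /measurable_EFinP. Qed.

Lemma integrable_dominated_by (f : T -> R) C : measurable_fun setT f ->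
  (forall x, `|f x| <= C * w x) -> m.-integrable setT (EFin \o f).
Proof.
move=> mf fC; have h : m.-integrable setT (EFin \o (fun p => C * w p)).
  by have := integrableZl measurableT C iw.
apply: le_integrable h => //; first exact/measurable_EFinP.
by move=> p _ /=; rewrite lee_fin (le_trans (fC p))// ler_norm.
Qed.

(** Tonelli on the majorant. The measure is general because it will be the plane measure itself, for
    double integrals over pairs of points. *)
Lemma integrable_dominated_prod h C : measurable_fun setT h -> 0 <= C ->
  (forall x y, `|h (x, y)| <= C * (w x * w y)) -> (m \x m)%E.-integrable setT (EFin \o h).
Proof.
move=> mh C0 hC; apply/integrable12ltyP; first exact/measurable_EFinP.
have fin : (\int[m]_x (w x)%:E \is a fin_num)%E by apply: integrable_fin_num.
apply: (@le_lt_trans _ _ (\int[m]_p \int[m]_q ((C * (w p * w q))%:E))%E).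
  apply: ge0_le_integral => //=.
  - by move=> p _; apply: integral_ge0.
  - apply: (@measurable_fun_fubini_tonelli_F _ _ _ _ _ m (fun z => `|(h z)%:E|)%E) => //.
    by apply: measurableT_comp => //; exact/measurable_EFinP.
  - apply: (@measurable_fun_fubini_tonelli_F _ _ _ _ _ m (fun z => (C * (w z.1 * w z.2))%:E)).
      apply/measurable_EFinP; apply: measurable_funM => //; apply: measurable_funM.
        by apply: measurableT_comp => //; exact: measurable_fst.
      by apply: measurableT_comp => //; exact: measurable_snd.
    by move=> z; rewrite lee_fin mulr_ge0// mulr_ge0.
  - move=> p _; apply: ge0_le_integral => //=.
    + by apply/measurable_EFinP; apply: measurableT_comp => //; exact: measurableT_comp.
    + by apply/measurable_EFinP; apply: measurable_funM => //; apply: measurable_funM.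
    + by move=> q _; rewrite lee_fin.
have -> : (\int[m]_p \int[m]_q ((C * (w p * w q))%:E) =
    \int[m]_p (C%:E * (w p)%:E * \int[m]_q (w q)%:E))%E.
  apply: eq_integral => p _; under eq_integral do rewrite mulrA EFinM.
  rewrite ge0_integralZl//.
  - exact/measurable_EFinP.
  - by move=> q _; rewrite lee_fin.
  - by rewrite lee_fin mulr_ge0.
rewrite ge0_integralZr//; last 3 first.
- by apply: emeasurable_funM => //; exact/measurable_EFinP.
- by move=> q _; rewrite mule_ge0// lee_fin.
- by apply: integral_ge0 => q _; rewrite lee_fin.
rewrite ge0_integralZl//; last 2 first.
- exact/measurable_EFinP.
- by move=> q _; rewrite lee_fin.
by rewrite ltey_eq !fin_numM.
Qed.

Lemma fubini_dominated h C : measurable_fun setT h -> 0 <= C ->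
  (forall x y, `|h (x, y)| <= C * (w x * w y)) ->
  \int[m]_x (\int[m]_y h (x, y)) = \int[m]_y (\int[m]_x h (x, y)).
Proof.
move=> mh C0 hC; have ih := integrable_dominated_prod mh C0 hC.
have e1 p : ((\int[m]_q h (p, q))%:E = \int[m]_q (h (p, q))%:E)%E.
  rewrite fineK//; apply: integrable_fin_num => //.
  apply: (@integrable_dominated_by (fun q => h (p, q)) (C * w p)).
    exact: measurableT_comp.
  by move=> q; rewrite -mulrA.
have e2 q : ((\int[m]_p h (p, q))%:E = \int[m]_p (h (p, q))%:E)%E.
  rewrite fineK//; apply: integrable_fin_num => //.
  apply: (@integrable_dominated_by (fun p => h (p, q)) (C * w q)).
    exact: measurableT_comp.
  by move=> p; rewrite -mulrA (mulrC (w q)).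
rewrite [LHS]/Rintegral [RHS]/Rintegral; congr fine.
under eq_integral do rewrite e1.
under [RHS]eq_integral do rewrite e2.
exact: (Fubini ih).
Qed.

End DominatedFubini.

Lemma sigma_finite_plane (R : realType) : sigma_finite setT (leb2 R).
Proof.
exists (fun n => `[- n%:R, n%:R] `*` `[- n%:R, n%:R]).
  rewrite predeqE => -[x y]; split => // _.
  exists (Num.truncn (Num.max `|x| `|y|)).+1 => //=; rewrite !in_itv /= -!ler_norml.
  have h := truncnS_gt (Num.max `|x| `|y|).
  by split; rewrite (le_trans _ (ltW h))// le_max lexx ?orbT.
move=> n; split; first by apply: measurableX; exact: measurable_itv.
rewrite product_measure1E; [|exact: measurable_itv|exact: measurable_itv].
have h : (@lebesgue_measure R `[(- n%:R)%R, n%:R%R]%classic \is a fin_num)%E.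
  by rewrite lebesgue_measure_itv /= -EFinD; case: ifP.
by rewrite ltey_eq fin_numM.
Qed.
(* The product measure leb2 carries no canonical sigma-finite structure. *)
Definition plane_measure (R : realType) : SigmaFiniteMeasure.type (measurableTypeR R * measurableTypeR R)%type R :=
  HB.pack_for (SigmaFiniteMeasure.type (measurableTypeR R * measurableTypeR R)%type R) (leb2 R)
  (@Measure_isSigmaFinite.Build _ _ R (leb2 R) (sigma_finite_plane R)).
Notation plane_measurable R :=
  (measurable_fun [set: measurableTypeR R * measurableTypeR R]) (only parsing).

Section Plane.
Context {R : realType}.
Notation mu := (@lebesgue_measure R).
Notation mu2 := (leb2 R).
Implicit Types (f g : R * R -> R) (p q xi : R * R).

(** Measurability refers to the product of two Borel structures, so an open set is written as a
    countable union of rational boxes. *)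
Lemma open_measurable_plane (A : set (R * R)) : open A ->
  (@measurable _ (measurableTypeR R * measurableTypeR R)%type A).
Proof.
move=> oA.
pose Q (i : rat * rat * (rat * rat)) : set (R * R) :=
  `]ratr i.1.1, ratr i.1.2[%classic `*` `]ratr i.2.1, ratr i.2.2[%classic.
have -> : A = \bigcup_i (if `[< Q i `<=` A >] then Q i else set0).
  apply/seteqP; split => [[x y] Axy|p [i _]]; last first.
    by case: ifPn => // /asboolP QA /QA.
  have /nbhs_ballP[e /= e0 he] : nbhs (x, y) A by exact: open_nbhs_nbhs.
  have [a /[!in_itv] /= ha] := @rat_in_itvoo R (x - e) x (ltac:(lra)).
  have [b /[!in_itv] /= hb] := @rat_in_itvoo R x (x + e) (ltac:(lra)).
  have [c /[!in_itv] /= hc] := @rat_in_itvoo R (y - e) y (ltac:(lra)).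
  have [d /[!in_itv] /= hd] := @rat_in_itvoo R y (y + e) (ltac:(lra)).
  exists ((a, b), (c, d)) => //=; rewrite ifT.
    by rewrite /Q /= !in_itv /=; split; lra.
  apply/asboolP => -[u v]; rewrite /Q /= !in_itv /= => -[uab vcd]; apply: he.
  by split; rewrite /= /ball /= ltr_norml; lra.
apply: countable_bigcupT_measurable => // i; case: ifPn => // _.
by apply: measurableX; exact: measurable_itv.
Qed.

Lemma continuous_measurable_plane f : continuous f ->
  plane_measurable R f.
Proof.
move=> /continuousP cf; apply: (measurability _ (RGenOpens.measurableE R)).
move=> _ [_ [a [b ->] <-]]; rewrite setTI; apply: open_measurable_plane.
exact/cf/interval_open.
Qed.

(** The integrable majorant of all estimates; its product form makes the integral pi^2 by
    Tonelli. *)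
Definition weight p : R := (1 + p.1 ^+ 2)^-1 * (1 + p.2 ^+ 2)^-1.

Lemma integral_oneDsqr : (\int[mu]_x ((1 + x ^+ 2)^-1)%:E = pi%:E)%E.
Proof.
have := @ge0_symfun_integralT R (fun x => (oneDsqr x)^-1).
move=> -> => [|x||x]; last 3 first.
- by rewrite invr_ge0.
- exact: continuous_oneDsqrV.
- by rewrite /= /oneDsqr sqrrN.
rewrite -set_itvcy integral0y_oneDsqr -EFinM; congr EFin; lra.
Qed.

Lemma continuous_fst : continuous (fun p : R * R => p.1).
Proof. by move=> p; exact: cvg_fst. Qed.

Lemma continuous_snd : continuous (fun p : R * R => p.2).
Proof. by move=> p; exact: cvg_snd. Qed.

Lemma continuous_weight : continuous weight.
Proof.
move=> p; apply: (@continuousM _ (R * R)%type).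
  apply: (@continuous_comp _ _ _ (fun p : R * R => p.1) (fun x : R => (1 + x ^+ 2)^-1)).
    exact: continuous_fst.
  exact: continuous_oneDsqrV.
apply: (@continuous_comp _ _ _ (fun p : R * R => p.2) (fun x : R => (1 + x ^+ 2)^-1)).
  exact: continuous_snd.
exact: continuous_oneDsqrV.
Qed.

Lemma weight_gt0 p : 0 < weight p.
Proof. by rewrite mulr_gt0 // invr_gt0 ltr_pwDl// sqr_ge0. Qed.

Lemma measurable_weight : plane_measurable R weight.
Proof. apply: continuous_measurable_plane. apply: continuous_weight. Qed.

Lemma integral_weight : (\int[mu2]_p (weight p)%:E = (pi ^+ 2)%:E)%E.
Proof.
rewrite fubini_tonelli1; last 2 first.
- by apply/measurable_EFinP; exact: measurable_weight.
- by move=> p; rewrite lee_fin ltW// weight_gt0.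
have mo : measurable_fun [set: measurableTypeR R] (fun x : R => ((1 + x ^+ 2)^-1)%:E).
  by apply/measurable_EFinP; apply: continuous_measurable_fun; exact: continuous_oneDsqrV.
have pos (x : R) : (0 <= ((1 + x ^+ 2)^-1)%:E)%E by rewrite lee_fin invr_ge0 addr_ge0// sqr_ge0.
have e (x : R) : fubini_F mu (fun z => (weight z)%:E) x = (((1 + x ^+ 2)^-1)%:E * pi%:E)%E.
  rewrite /fubini_F; under eq_integral do rewrite /weight /= EFinM.
  by rewrite ge0_integralZl ?integral_oneDsqr// => y _; exact: pos.
rewrite (@eq_integral _ _ _ mu setT (fun x : R => (((1 + x ^+ 2)^-1)%:E * pi%:E)%E)); last by move=> x _; exact: e.
rewrite ge0_integralZr//; try by rewrite lee_fin pi_ge0.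
by rewrite integral_oneDsqr -EFinM expr2.
Qed.

Lemma integrable_weight : mu2.-integrable setT (EFin \o weight).
Proof.
apply/integrableP; split; first by apply/measurable_EFinP; exact: measurable_weight.
under eq_integral do rewrite /= ger0_norm ?(ltW (weight_gt0 _))//.
by rewrite integral_weight ltry.
Qed.

Lemma integrable_dominated f C : plane_measurable R f ->
  (forall p, `|f p| <= C * weight p) -> mu2.-integrable setT (EFin \o f).
Proof.
move=> mf fC; have h : mu2.-integrable setT (EFin \o (fun p => C * weight p)).
  by have := integrableZl measurableT C integrable_weight.
apply: le_integrable h => //; first exact/measurable_EFinP.
by move=> p _ /=; rewrite lee_fin (le_trans (fC p))// ler_norm.
Qed.

Lemma integral_plane_le f C : plane_measurable R f ->
  (forall p, `|f p| <= C * weight p) -> `|\int[mu2]_p f p| <= C * pi ^+ 2.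
Proof.
move=> mf fC; have if_ := integrable_dominated mf fC.
apply: le_trans (le_normr_Rintegral _ if_) _; first exact: measurableT.
have -> : C * pi ^+ 2 = \int[mu2]_p (C * weight p).
  rewrite RintegralZl//; last exact: integrable_weight.
  by rewrite /Rintegral integral_weight.
apply: le_Rintegral => //.
- have := integrable_abse if_; by [].
- by have := integrableZl measurableT C integrable_weight.
Qed.

Lemma integral_plane_ge0 f : (forall p, 0 <= f p) -> 0 <= \int[mu2]_p f p.
Proof. by move=> f0; apply: Rintegral_ge0 => p _. Qed.

Lemma fubini_plane (h : (R * R) * (R * R) -> R) C :
  measurable_fun [set: (measurableTypeR R * measurableTypeR R) * (measurableTypeR R * measurableTypeR R)] h ->
  (forall p q, `|h (p, q)| <= C * (weight p * weight q)) ->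
  \int[mu2]_p (\int[mu2]_q h (p, q)) = \int[mu2]_q (\int[mu2]_p h (p, q)).
Proof.
move=> mh hC; have C0 : 0 <= C.
  have := le_trans (normr_ge0 _) (hC (0, 0) (0, 0)).
  by rewrite pmulr_lge0// mulr_gt0// weight_gt0.
exact: (@fubini_dominated _ _ R (plane_measure R) weight (fun p => ltW (weight_gt0 p))
  integrable_weight h C mh C0 hC).
Qed.

End Plane.

(** * Affine changes of variables in the plane *)

Section ScaledPushforward.
Context d1 d2 (X : measurableType d1) (Y : measurableType d2) (R : realType).
Variables (phi : X -> Y) (mphi : measurable_fun setT phi) (m : {measure set X -> \bar R}).
Variables (k : {nonneg R}).

Definition scaled_pushforward : {measure set Y -> \bar R}.
Proof. by refine (mscale k (pushforward m phi)). Defined.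

Lemma scaled_pushforwardE A : scaled_pushforward A = (k%:num%:E * m (phi @^-1` A))%E.
Proof. by []. Qed.

Lemma ge0_integral_scaled_pushforward (f : Y -> \bar R) : measurable_fun setT f ->
  (forall y, (0 <= f y)%E) ->
  (\int[scaled_pushforward]_y f y = k%:num%:E * \int[m]_x f (phi x))%E.
Proof.
move=> mf f0; rewrite /scaled_pushforward ge0_integral_mscale//; congr (_ * _)%E.
by rewrite ge0_integral_pushforward.
Qed.

End ScaledPushforward.

Section ChangeOfVariables.
Context {R : realType}.
Notation mu := (@lebesgue_measure R).
Notation mu2 := (leb2 R).
Variables (l a b : R).
Hypothesis l_neq0 : l != 0.

Let T1 (c : R) (x : R) : R := l * x + c.

Lemma measurable_affine1 c : measurable_fun [set: measurableTypeR R] (T1 c : measurableTypeR R -> measurableTypeR R).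
Proof.
apply: continuous_measurable_fun => x; apply: (@continuousD _ R^o); last exact: cst_continuous.
exact: mulrl_continuous.
Qed.

(** Half-open intervals determine the measure; for l < 0 their preimages are half-open on the other
    side. *)
Lemma lebesgue_measure_affine c (A : set R) : measurable A ->
  (`|l|%:E * mu (T1 c @^-1` A) = mu A)%E.
Proof.
move=> mA.
have l0 : 0 < `|l| by rewrite normr_gt0.
pose m := scaled_pushforward (measurable_affine1 c) mu (NngNum (ltW l0)).
suff : forall X, measurable X -> mu X = m X by move=> /(_ _ mA) ->.
apply: lebesgue_measure_unique => _ [[u v] _ <-] /=.
rewrite /m scaled_pushforwardE /=.
have eqI (x y : R) (b1 b2 : bool) : lebesgue_measure [set` Interval (BSide b1 x) (BSide b2 y)] =
    (if (x < y)%R then (y - x)%:E else 0)%E.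
  by rewrite lebesgue_measure_itv /= lte_fin; case: ifP => // _; rewrite EFinB.
case: (ltrgt0P l) => [lp|ln|/eqP]; last by rewrite (negbTE l_neq0).
- have -> : T1 c @^-1` `]u, v]%classic = `]((u - c) / l), ((v - c) / l)]%classic.
    apply/seteqP; split => x /=; rewrite !in_itv /= /T1 ltr_pdivrMr// ler_pdivlMr// => /andP[]; lra.
  rewrite !eqI ltr_pM2r ?invr_gt0// ltrD2r; case: ifP => _; last by rewrite mule0.
  by rewrite -EFinM; congr EFin; field; rewrite gt_eqF.
- have -> : T1 c @^-1` `]u, v]%classic = `[((v - c) / l), ((u - c) / l)[%classic.
    apply/seteqP; split => x /=; rewrite !in_itv /= /T1 ler_ndivrMr// ltr_ndivlMr// => /andP[]; lra.
  rewrite !eqI ltr_nM2r ?invr_lt0// ltrD2r; case: ifP => _; last by rewrite mule0.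
  by rewrite -EFinM; congr EFin; field; rewrite lt_eqF.
Qed.

Definition affine_map (p : R * R) : R * R := (l * p.1 + a, l * p.2 + b).

Lemma measurable_affine_map : plane_measurable R
  (affine_map : measurableTypeR R * measurableTypeR R -> measurableTypeR R * measurableTypeR R).
Proof.
apply: measurable_fun_pair.
  by apply: (measurableT_comp (measurable_affine1 a)); exact: measurable_fst.
by apply: (measurableT_comp (measurable_affine1 b)); exact: measurable_snd.
Qed.

(** The rescaled push-forward agrees with the plane measure on rectangles, by the one-dimensional
    case on each side. *)
Lemma ge0_integral_affine (f : R * R -> \bar R) :
  plane_measurable R f -> (forall p, (0 <= f p)%E) ->
  (\int[mu2]_p f p = (l ^+ 2)%:E * \int[mu2]_p f (affine_map p))%E.
Proof.
move=> mf f0.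
pose m := scaled_pushforward measurable_affine_map mu2 (NngNum (sqr_ge0 l)).
transitivity (\int[m]_p f p)%E; last exact: ge0_integral_scaled_pushforward.
apply: eq_measure_integral => A mA _; apply: product_measure_unique => // X Y mX mY.
  rewrite /m scaled_pushforwardE.
  have -> : affine_map @^-1` (X `*` Y) = (T1 a @^-1` X) `*` (T1 b @^-1` Y) by [].
  transitivity ((l ^+ 2)%:E * (mu (T1 a @^-1` X) * mu (T1 b @^-1` Y)))%E.
    congr (_ * _)%E; apply: product_measure1E.
    - by rewrite -[X in measurable X]setTI; apply: measurable_affine1.
    - by rewrite -[X in measurable X]setTI; apply: measurable_affine1.
  transitivity ((`|l|%:E * mu (T1 a @^-1` X)) * (`|l|%:E * mu (T1 b @^-1` Y)))%E.
    by rewrite -(real_normK (num_real l)) expr2 EFinM muleACA.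
  by congr (_ * _)%E; exact: lebesgue_measure_affine.
Qed.

Lemma integrable_affine (f : R * R -> R) : mu2.-integrable setT (EFin \o f) ->
  mu2.-integrable setT (EFin \o (f \o affine_map)).
Proof.
move=> /integrableP[mf fi]; apply/integrableP; split.
  by apply: (measurableT_comp mf); exact: measurable_affine_map.
rewrite (@ge0_integral_affine (fun p => `|(EFin \o f) p|%E)) in fi => //.
  move: fi; case: (\int[_]_p _)%E => [r _|//|//]; first exact: ltry.
  by rewrite mulry gtr0_sg ?mul1e// exprn_even_gt0.
exact: measurableT_comp.
Qed.

Lemma integral_affine (f : R * R -> R) : mu2.-integrable setT (EFin \o f) ->
  \int[mu2]_p f p = l ^+ 2 * \int[mu2]_p f (affine_map p).
Proof.
move=> if_; have ig := integrable_affine if_.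
have /integrableP[/measurable_EFinP mf _] := if_.
have pos (g : R * R -> R) : mu2.-integrable setT (EFin \o g) -> (forall p, 0 <= g p) ->
    \int[mu2]_p g p = l ^+ 2 * \int[mu2]_p g (affine_map p).
  move=> gi g0; have gT := integrable_affine gi; have /integrableP[mg _] := gi.
  rewrite /Rintegral (@ge0_integral_affine (EFin \o g))//.
  by rewrite fineM//; exact: integrable_fin_num gT.
have ip : mu2.-integrable setT (EFin \o (fun p => Num.max (f p) 0)).
  apply: le_integrable if_ => //; first by apply/measurable_EFinP; apply: measurable_maxr.
  by move=> p _; rewrite /= lee_fin maxEle; case: ifP => // _; rewrite normr0.
have ineg : mu2.-integrable setT (EFin \o (fun p => Num.max (- f p) 0)).
  apply: le_integrable if_ => //.
    by apply/measurable_EFinP; apply: measurable_maxr => //; exact: measurableT_comp.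
  by move=> p _; rewrite /= lee_fin maxEle; case: ifP => // _; rewrite ?normr0// normrN.
have fE x : x = Num.max x 0 - Num.max (- x) 0 :> R.
  by rewrite !maxEle oppr_le0; case: (lerP x 0); case: (lerP 0 x); lra.
have e1 : \int[mu2]_p f p = \int[mu2]_p Num.max (f p) 0 - \int[mu2]_p Num.max (- f p) 0.
  by rewrite -RintegralB//; apply: eq_Rintegral => p _; exact: fE.
have e2 : \int[mu2]_p f (affine_map p) = \int[mu2]_p Num.max (f (affine_map p)) 0 -
    \int[mu2]_p Num.max (- f (affine_map p)) 0.
  rewrite -RintegralB//; first by apply: eq_Rintegral => p _; exact: fE.
  - exact: (integrable_affine ip).
  - exact: (integrable_affine ineg).
have m0 (x : R) : 0 <= Num.max x 0 by rewrite le_max lexx orbT.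
by rewrite e1 e2 mulrBr (pos (fun p => Num.max (f p) 0))// (pos (fun p => Num.max (- f p) 0)).
Qed.

End ChangeOfVariables.

(** * Fourier transform and Sobolev norms *)

Section Fourier.
Context {R : realType}.
Notation mu2 := (leb2 R).
Implicit Types (f g phi : R * R -> R) (p q v xi : R * R) (s l : R).

Lemma continuous_plane_mul f g p : {for p, continuous f} -> {for p, continuous g} ->
  continuous_at p (fun q => f q * g q).
Proof. exact: continuousM. Qed.

Lemma continuous_plane_add f g p : {for p, continuous f} -> {for p, continuous g} ->
  continuous_at p (fun q => f q + g q).
Proof. exact: continuousD. Qed.

(** The square of the Japanese bracket: the Sobolev weight is its power s / 2. *)
Definition japanese p : R := 1 + p.1 ^+ 2 + p.2 ^+ 2.

Lemma japanese_ge1 p : 1 <= japanese p.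
Proof. by rewrite /japanese -addrA lerDl addr_ge0// sqr_ge0. Qed.

Lemma japanese_gt0 p : 0 < japanese p.
Proof. exact: lt_le_trans (japanese_ge1 p). Qed.

Lemma weight_ge_japanese p : japanese p ^- 2 <= weight p.
Proof.
rewrite /weight -invfM lef_pV2 ?posrE ?exprn_gt0 ?japanese_gt0//; last first.
  by rewrite mulr_gt0// ltr_pwDl// sqr_ge0.
rewrite /japanese; have := sqr_ge0 p.1; have := sqr_ge0 p.2.
by move: (p.1 ^+ 2) (p.2 ^+ 2) => x y; nra.
Qed.

Lemma weight_le1 p : weight p <= 1.
Proof.
rewrite /weight -invfM invf_le1 ?mulr_gt0 ?ltr_pwDl ?sqr_ge0//.
by rewrite -[leLHS]mulr1 ler_pM// lerDl sqr_ge0.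
Qed.

(** Bounded shifts change the weight by a bounded factor, which yields majorants uniform in the
    shift. *)
Lemma weight_shift (x : R) p :
  weight (p.1 + x, p.2) <= (2 + x ^+ 2 *+ 2) * weight p /\
  weight (p.1, p.2 + x) <= (2 + x ^+ 2 *+ 2) * weight p.
Proof.
have aux (a : R) : (1 + (a + x) ^+ 2)^-1 <= (2 + x ^+ 2 *+ 2) * (1 + a ^+ 2)^-1.
  rewrite ler_pdivlMr ?ltr_pwDl ?sqr_ge0// mulrC ler_pdivrMr ?ltr_pwDl ?sqr_ge0//.
  have := sqr_ge0 (a + 2 * x); have := sqr_ge0 (a + x); have := sqr_ge0 x; have := sqr_ge0 a.
  have := sqr_ge0 (x * (a + x)).
  rewrite -mulr_natl; nra.
have w0 (a : R) : 0 <= (1 + a ^+ 2)^-1 by rewrite invr_ge0 addr_ge0// sqr_ge0.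
split; rewrite /weight /=; first by rewrite mulrA ler_wpM2r.
by rewrite mulrCA ler_wpM2l.
Qed.

Lemma derive_line f p v (x : R) d : is_derive (p + x *: v) v f d ->
  is_derive x 1 (fun y : R => f (p + y *: v)) d.
Proof.
move=> [df fd].
have E : (fun h : R => h^-1 *: (f (p + (h *: (1 : R^o) + x) *: v) - f (p + x *: v))) =
  (fun h => h^-1 *: (f (h *: v + (p + x *: v)) - f (p + x *: v))).
  apply/funext => h; congr (_ *: (f _ - _)).
  by rewrite scalerDl addrCA /GRing.scale /= mulr1.
split; first by rewrite /derivable E.
by rewrite /derive E.
Qed.

(** By translation invariance the integral of f(p + x v) does not depend on [x]; differentiate under
    the integral at x = 0. *)
Lemma integral_derive_eq0 f df (v : R * R) C C' :
  v = (1, 0) \/ v = (0, 1) ->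
  (forall p, is_derive p v f (df p)) ->
  plane_measurable R f ->
  (forall p, `|f p| <= C * weight p) -> (forall p, `|df p| <= C' * weight p) ->
  \int[mu2]_p df p = 0.
Proof.
move=> hv hd mf fC dfC.
have C0 : 0 <= C.
  by have := le_trans (normr_ge0 _) (fC 0); rewrite pmulr_lge0// weight_gt0.
have C'0 : 0 <= C'.
  by have := le_trans (normr_ge0 _) (dfC 0); rewrite pmulr_lge0// weight_gt0.
have shiftE p x : p + x *: v = affine_map 1 (x * v.1) (x * v.2) p.
  by rewrite /affine_map !mul1r /GRing.scale /= /scale_pair; case: p.
have wl p x : -1 < x < 1 -> weight (p + x *: v) <= 4 * weight p.
  move=> x1; have x2 : x ^+ 2 <= 1 by nra.
  have [w1 w2] := weight_shift x p.
  have w0 := weight_gt0 p.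
  have w4 : (2 + x ^+ 2 *+ 2) * weight p <= 4 * weight p.
    by rewrite ler_wpM2r ?(ltW w0)// -mulr_natl; lra.
  rewrite shiftE /affine_map !mul1r.
  by case: hv => -> /=; rewrite mulr0 mulr1 addr0; [apply: le_trans w1 w4|apply: le_trans w2 w4].
have fi : mu2.-integrable setT (EFin \o f) by exact: integrable_dominated fC.
pose h (x : R) p := f (p + x *: v).
have hE x p : h x p = f (affine_map 1 (x * v.1) (x * v.2) p) by rewrite /h shiftE.
have hi x : mu2.-integrable setT (EFin \o h x).
  rewrite (_ : h x = f \o affine_map 1 (x * v.1) (x * v.2)); last first.
    by apply/funext => p; rewrite hE.
  by apply: integrable_affine => //; exact: oner_neq0.
have hc x : \int[mu2]_p h x p = \int[mu2]_p f p.
  rewrite (integral_affine (x * v.1) (x * v.2) (oner_neq0 R) fi) expr1n mul1r.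
  by apply: eq_Rintegral => p _; rewrite hE.
have dh (x : R) p : is_derive x 1 (h ^~ p) (df (p + x *: v)) by apply: derive_line.
have i1 x : `]-1, 1[%classic x -> mu2.-integrable setT (EFin \o h x) by move=> _.
have i2 (x : R) p : `]-1, 1[%classic x -> setT p -> derivable (h ^~ p) x 1.
  by move=> _ _; case: (dh x p).
have i3 : mu2.-integrable setT (EFin \o (fun p => C' * 4 * weight p)).
  by have := integrableZl measurableT (C' * 4) integrable_weight.
have pE (x : R) p : partial1of2 h x p = df (p + x *: v).
  by rewrite /partial1of2 derive1E; case: (dh x p).
have i4 (x : R) p : `]-1, 1[%classic x -> setT p -> `|partial1of2 h x p| <= C' * 4 * weight p.
  rewrite /= in_itv /= => x1 _; rewrite pE; apply: le_trans (dfC _) _.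
  by rewrite -mulrA ler_wpM2l// wl.
have g0 p : 0 <= C' * 4 * weight p by apply: mulr_ge0 (ltW (weight_gt0 p)); exact: mulr_ge0.
have I0 : `]-1, 1[%classic (0 : R) by rewrite /= in_itv /= ltrN10 ltr01.
have := @differentiation_under_integral R _ _ mu2 h setT measurableT 0 (-1) 1 I0 i1 i2 _ g0 i3 i4.
rewrite (_ : (fun x : R => \int[mu2]_p h x p) = fun=> \int[mu2]_p f p); last exact/funext.
rewrite derive1_cst => e; rewrite e; apply: eq_Rintegral => p _.
by rewrite pE scale0r addr0.
Qed.

Definition decaying f := continuous f /\ forall N, exists C, forall p, japanese p ^+ N * `|f p| <= C.

Lemma decaying_weight f : decaying f -> forall N, exists2 C, 0 <= C &
  forall p, japanese p ^+ N * `|f p| <= C * weight p.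
Proof.
move=> [_ df] N; have [C hC] := df (N + 2)%N.
have C0 : 0 <= C by apply: le_trans (hC 0); rewrite mulr_ge0 ?exprn_ge0// ltW// japanese_gt0.
exists C => // p; apply: le_trans (_ : C * japanese p ^- 2 <= _); last first.
  by rewrite ler_wpM2l// weight_ge_japanese.
rewrite ler_pdivlMr ?exprn_gt0 ?japanese_gt0//.
by rewrite mulrAC -exprD.
Qed.

Lemma decaying_dominated f : decaying f -> exists2 C, 0 <= C & forall p, `|f p| <= C * weight p.
Proof. by move=> /decaying_weight/(_ 0%N)[C C0 hC]; exists C => // p; rewrite -[leLHS]mul1r -(expr0 (japanese p)). Qed.

Lemma continuous_dotp xi : continuous (fun p : R * R => dotp p xi).
Proof.
move=> p; apply: continuous_plane_add; apply: continuous_plane_mul; try exact: cst_continuous.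
- exact: continuous_fst.
- exact: continuous_snd.
Qed.

Lemma dotpC p xi : dotp p xi = dotp xi p.
Proof. by rewrite /dotp mulrC (mulrC p.2). Qed.

Lemma measurable_dotp : measurable_fun [set: (measurableTypeR R * measurableTypeR R) * (measurableTypeR R * measurableTypeR R)]
  (fun z : (R * R) * (R * R) => dotp z.1 z.2).
Proof.
apply: measurable_funD; apply: measurable_funM.
- by apply: (measurableT_comp measurable_fst); exact: measurable_fst.
- by apply: (measurableT_comp measurable_fst); exact: measurable_snd.
- by apply: (measurableT_comp measurable_snd); exact: measurable_fst.
- by apply: (measurableT_comp measurable_snd); exact: measurable_snd.
Qed.

Lemma cos_lip (x y : R) : `|cos x - cos y| <= `|x - y|.
Proof.
wlog xy : x y / x < y.
  move=> H; have [xy|yx|->] := ltgtP x y; first exact: H.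
    by rewrite distrC (distrC x); exact: H.
  by rewrite subrr normr0.
have [c _ e] := mean_value xy (fun z _ => is_derive_cos z).
rewrite distrC e normrM normrN (distrC x) ler_piMl// ler_norml.
by rewrite sin_geN1 sin_le1.
Qed.

Lemma sin_lip (x y : R) : `|sin x - sin y| <= `|x - y|.
Proof.
wlog xy : x y / x < y.
  move=> H; have [xy|yx|->] := ltgtP x y; first exact: H.
    by rewrite distrC (distrC x); exact: H.
  by rewrite subrr normr0.
have [c _ e] := mean_value xy (fun z _ => is_derive_sin z).
rewrite distrC e normrM (distrC x) ler_piMl// ler_norml.
by rewrite cos_geN1 cos_le1.
Qed.

(* Stands for cos or sin: the real and the imaginary part of the transform are
   treated at once. *)
Definition kernel (k : R -> R) := [/\ continuous k, forall x, `|k x| <= 1 & forall x y, `|k x - k y| <= `|x - y|].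

Lemma kernel_cos : kernel (@cos R).
Proof.
by split; [exact: continuous_cos|move=> x; rewrite ler_norml cos_geN1 cos_le1|exact: cos_lip].
Qed.

Lemma kernel_sin : kernel (@sin R).
Proof.
by split; [exact: continuous_sin|move=> x; rewrite ler_norml sin_geN1 sin_le1|exact: sin_lip].
Qed.

Lemma kernel_cos_sin k : k = @cos R \/ k = @sin R -> kernel k.
Proof. by case=> ->; [exact: kernel_cos|exact: kernel_sin]. Qed.

Section kernel.
Variables (k : R -> R) (kk : kernel k).

Definition transform f xi : R := \int[mu2]_p (f p * k (dotp p xi)).

Let measurable_k : measurable_fun [set: measurableTypeR R] (k : measurableTypeR R -> measurableTypeR R).
Proof. by case: kk => ck _ _; exact: continuous_measurable_fun. Qed.

Lemma measurable_transform_integrand f xi : plane_measurable R f ->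
  plane_measurable R (fun p => f p * k (dotp p xi)).
Proof.
move=> mf; apply: measurable_funM => //; apply: (measurableT_comp measurable_k).
apply: continuous_measurable_plane; exact: continuous_dotp.
Qed.

Lemma transform_integrand_le f xi p : `|f p * k (dotp p xi)| <= `|f p|.
Proof. by case: kk => _ k1 _; rewrite normrM ler_piMr. Qed.

Lemma transform_le f C xi : plane_measurable R f ->
  (forall p, `|f p| <= C * weight p) -> `|transform f xi| <= C * pi ^+ 2.
Proof.
move=> mf fC; apply: integral_plane_le; first exact: measurable_transform_integrand.
by move=> p; apply: le_trans (transform_integrand_le _ _ _) (fC p).
Qed.

Lemma integrable_transform f xi : decaying f -> mu2.-integrable setT (EFin \o (fun p => f p * k (dotp p xi))).
Proof.
move=> df; have [C C0 hC] := decaying_dominated df.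
apply: (@integrable_dominated _ _ C).
  by apply: measurable_transform_integrand; apply: continuous_measurable_plane; case: df.
by move=> p; apply: le_trans (transform_integrand_le _ _ _) (hC p).
Qed.

(** [k] is 1-Lipschitz, so an increment of the frequency costs a factor |p|, absorbed by one power
    of [japanese]. *)
Lemma transform_lip f : decaying f -> exists2 C, 0 <= C &
  forall xi eta, `|transform f xi - transform f eta| <= C * (`|xi.1 - eta.1| + `|xi.2 - eta.2|).
Proof.
move=> df; have [C C0 hC] := decaying_weight df 1.
have mf : plane_measurable R f.
  by apply: continuous_measurable_plane; case: df.
have [_ _ kl] := kk.
exists (C * pi ^+ 2) => [|xi eta]; first by rewrite mulr_ge0// sqr_ge0.
rewrite /transform -RintegralB//; [|exact: integrable_transform|exact: integrable_transform].
rewrite mulrAC; apply: integral_plane_le.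
  by apply: measurable_funB; exact: measurable_transform_integrand.
move=> p; rewrite -mulrBr normrM.
set D := `|xi.1 - eta.1| + _; have D0 : 0 <= D by rewrite addr_ge0.
have dd : `|k (dotp p xi) - k (dotp p eta)| <= japanese p * D.
  apply: le_trans (kl _ _) _; rewrite /dotp.
  have -> : p.1 * xi.1 + p.2 * xi.2 - (p.1 * eta.1 + p.2 * eta.2) =
    p.1 * (xi.1 - eta.1) + p.2 * (xi.2 - eta.2) by ring.
  apply: le_trans (ler_normD _ _) _; rewrite !normrM mulrDr.
  have j1 : `|p.1| <= japanese p.
    rewrite /japanese -(real_normK (num_real p.1)); have := sqr_ge0 (`|p.1| - 1).
    by have := sqr_ge0 p.2; move: `|p.1| (p.2 ^+ 2) => x y; nra.
  have j2 : `|p.2| <= japanese p.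
    rewrite /japanese -(real_normK (num_real p.2)); have := sqr_ge0 (`|p.2| - 1).
    by have := sqr_ge0 p.1; move: `|p.2| (p.1 ^+ 2) => x y; nra.
  by rewrite lerD// ler_wpM2r.
apply: le_trans (ler_wpM2l (normr_ge0 (f p)) dd) _.
have -> : `|f p| * (japanese p * D) = D * (japanese p * `|f p|) by ring.
have -> : C * D * weight p = D * (C * weight p) by ring.
rewrite ler_wpM2l//.
by have := hC p; rewrite expr1.
Qed.

Lemma continuous_transform f : decaying f -> continuous (transform f).
Proof.
move=> df; have [C C0 hC] := transform_lip df.
move=> xi; apply/cvgrPdist_lt => e e0.
have d0 : 0 < e / (2 * (C + 1)) by rewrite divr_gt0// mulr_gt0// ltr_wpDl.
near=> eta; apply: le_lt_trans (hC _ _) _.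
have n1 : `|xi.1 - eta.1| < e / (2 * (C + 1)).
  by near: eta; apply: (@cvgr_dist_lt _ _ _ _ _ _ xi.1 (@continuous_fst R xi) _ d0).
have n2 : `|xi.2 - eta.2| < e / (2 * (C + 1)).
  by near: eta; apply: (@cvgr_dist_lt _ _ _ _ _ _ xi.2 (@continuous_snd R xi) _ d0).
have h : (C + 1) * (`|xi.1 - eta.1| + `|xi.2 - eta.2|) < e.
  rewrite -ltr_pdivlMl; last by rewrite ltr_wpDl.
  have -> : (C + 1)^-1 * e = e / (2 * (C + 1)) + e / (2 * (C + 1)).
    by field; rewrite gt_eqF// ltr_wpDl.
  exact: ltrD.
apply: le_lt_trans h; rewrite ler_wpM2r ?addr_ge0//; lra.
Unshelve. all: by end_near. Qed.

(** The multiplication formula, from Fubini and the symmetry of the phase. It is the identity by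
    which [is_fourierL2] defines the transform. *)
Lemma transform_fubini f g : decaying f -> decaying g ->
  \int[mu2]_xi (transform f xi * g xi) = \int[mu2]_p (f p * transform g p).
Proof.
move=> df dg; have [C C0 hC] := decaying_dominated df; have [D D0 hD] := decaying_dominated dg.
have mf : plane_measurable R f.
  by apply: continuous_measurable_plane; case: df.
have mg : plane_measurable R g.
  by apply: continuous_measurable_plane; case: dg.
pose h (z : (R * R) * (R * R)) := f z.1 * k (dotp z.1 z.2) * g z.2.
have e1 : \int[mu2]_xi (transform f xi * g xi) = \int[mu2]_xi (\int[mu2]_p h (p, xi)).
  by apply: eq_Rintegral => xi _; rewrite /transform -RintegralZr//; exact: integrable_transform.
have e2 : \int[mu2]_p (f p * transform g p) = \int[mu2]_p (\int[mu2]_xi h (p, xi)).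
  apply: eq_Rintegral => p _; rewrite /transform -RintegralZl//; last exact: integrable_transform.
  by apply: eq_Rintegral => xi _; rewrite /h /= dotpC; ring.
rewrite e1 e2; apply/esym; apply: (@fubini_plane _ h (C * D)).
  apply: measurable_funM; last by apply: (measurableT_comp mg); exact: measurable_snd.
  apply: measurable_funM; first by apply: (measurableT_comp mf); exact: measurable_fst.
  by apply: (measurableT_comp measurable_k); exact: measurable_dotp.
move=> p q; rewrite /h /= normrM.
have -> : C * D * (weight p * weight q) = (C * weight p) * (D * weight q) by ring.
by rewrite ler_pM// (le_trans (transform_integrand_le _ _ _)).
Qed.

End kernel.
Lemma fourier_reE f xi : fourier_re f xi = (2 * pi)^-1 * transform (@cos R) f xi.
Proof. by []. Qed.

Lemma fourier_imE f xi : fourier_im f xi = - ((2 * pi)^-1 * transform (@sin R) f xi).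
Proof. by []. Qed.

Lemma scale_affine l p : affine_map l 0 0 p = l *: p.
Proof. by rewrite /affine_map !addr0. Qed.

Lemma Lnorm2_sqr f : plane_measurable R f ->
  ('N[mu2]_2%:E [EFin \o f] `^ 2 = \int[mu2]_x (f x ^+ 2)%:E)%E.
Proof.
move=> mf; rewrite poweR_Lnorm//; apply: eq_integral => x _.
by rewrite [X in poweR X]/= poweR_EFin powR_mulrn// real_normK// num_real.
Qed.

(** The dilation produces l^2, which the square of l^-1 cancels, and weight^2 <= weight has integral
    at most pi^2. The parameter [l] gives bounds uniform in [l] for functions living at frequency
    [l]. *)
Lemma Lnorm2_le f l D : 0 < l -> 0 <= D ->
  plane_measurable R f ->
  (forall xi, `|f (l *: xi)| <= l^-1 * D * weight xi) ->
  ('N[mu2]_2%:E [EFin \o f] <= (D * pi)%:E)%E.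
Proof.
move=> l0 D0 mf fD.
have mf2 : plane_measurable R (fun x => (f x ^+ 2)%:E).
  by apply/measurable_EFinP; exact: measurable_funX.
have Dpi : 0 <= D * pi by rewrite mulr_ge0// pi_ge0.
have e2 : (\int[mu2]_x (f x ^+ 2)%:E <= ((D * pi) ^+ 2)%:E)%E.
  rewrite (@ge0_integral_affine _ l 0 0 (lt0r_neq0 l0))//; last by move=> p; rewrite lee_fin sqr_ge0.
  have -> : ((D * pi) ^+ 2)%:E = ((l ^+ 2)%:E * \int[mu2]_p ((l^-1 * D) ^+ 2 * weight p)%:E)%E.
    under eq_integral do rewrite EFinM.
    rewrite ge0_integralZl//; last 3 first.
    - by apply/measurable_EFinP; exact: measurable_weight.
    - by move=> p _; rewrite lee_fin ltW// weight_gt0.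
    - by rewrite lee_fin sqr_ge0.
    rewrite integral_weight -!EFinM; congr EFin; field; exact: lt0r_neq0.
  rewrite lee_wpmul2l ?lee_fin ?sqr_ge0//; apply: ge0_le_integral => //.
  - by move=> p _; rewrite lee_fin sqr_ge0.
  - by apply: (measurableT_comp mf2); exact: measurable_affine_map.
  - apply/measurable_EFinP; apply: measurable_funM => //; exact: measurable_weight.
  - move=> p _; rewrite lee_fin scale_affine -(real_normK (num_real (f _))).
    apply: (@le_trans _ _ ((l^-1 * D * weight p) ^+ 2)).
      by rewrite lerXn2r ?nnegrE//; apply: le_trans (fD p).
    by rewrite exprMn ler_wpM2l ?sqr_ge0// expr2 ler_piMr ?weight_le1// ltW// weight_gt0.
have N0 := @Lnorm_ge0 _ _ _ mu2 2%:E (EFin \o f).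
rewrite leNgt; apply/negP => h.
have : (((D * pi)%:E) `^ 2 < 'N[mu2]_2%:E [EFin \o f] `^ 2)%E.
  move: N0 h; case: ('N[mu2]_2%:E [EFin \o f])%E => [r| |]//.
    rewrite lee_fin lte_fin !poweR_EFin lte_fin => r0 h.
    by rewrite !powR_mulrn// ltr_pXn2r ?nnegrE.
  by move=> _ _; rewrite poweR_EFin poweRyr ?ltry ?pnatr_eq0.
by rewrite Lnorm2_sqr// poweR_EFin powR_mulrn// ltNge e2.
Qed.

Lemma schwartz_decaying phi : schwartz phi -> decaying phi.
Proof.
move=> [sm dec]; split.
  move=> p; apply: differentiable_continuous; exact: (sm 1%N [::] isT p).
move=> N; have [C hC] := dec [::] (N * 2)%N; exists (2 ^+ N * C) => p.
apply: (@le_trans _ _ (2 ^+ N * ((1 + `|p|) ^+ (N * 2) * `|phi p|))); last first.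
  by rewrite ler_wpM2l// exprn_ge0.
rewrite mulrA ler_wpM2r// mulnC exprM -exprMn lerXn2r ?nnegrE ?(ltW (japanese_gt0 _)) ?mulr_ge0 ?sqr_ge0//.
have h1 : `|p.1| <= `|p| by rewrite [leRHS]/Num.norm/= le_max lexx.
have h2 : `|p.2| <= `|p| by rewrite [leRHS]/Num.norm/= le_max lexx orbT.
rewrite /japanese -(real_normK (num_real p.1)) -(real_normK (num_real p.2)).
move: (normr_ge0 p.1) (normr_ge0 p.2) h1 h2.
move: (`|p|) (`|p.1|) (`|p.2|) => z x y x0 y0 xz yz.
nra.
Qed.

Lemma decaying_measurable f : decaying f ->
  plane_measurable R f.
Proof. by move=> [cf _]; exact: continuous_measurable_plane. Qed.

Lemma Lfun2_dominated f C : plane_measurable R f -> 0 <= C ->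
  (forall p, `|f p| <= C * weight p) -> f \in Lfun mu2 2%:E.
Proof.
move=> mf C0 fC; rewrite inE; apply/andP; split; rewrite inE//=.
rewrite /finite_norm; apply: le_lt_trans (ltry (C * pi)).
by apply: (@Lnorm2_le _ 1) => // xi; rewrite scale1r invr1 mul1r.
Qed.

Lemma decaying_Lfun2 f : decaying f -> f \in Lfun mu2 2%:E.
Proof.
move=> df; have [C C0 hC] := decaying_dominated df.
by apply: (Lfun2_dominated _ C0 hC); exact: decaying_measurable.
Qed.

Lemma decaying_transform_dominated k f C : kernel k -> decaying f ->
  (forall xi, japanese xi ^+ 2 * `|transform k f xi| <= C) ->
  forall xi, `|transform k f xi| <= C * weight xi.
Proof.
move=> kk df h xi.
have J := japanese_gt0 xi.
have C0 : 0 <= C by apply: le_trans (h xi); rewrite mulr_ge0// sqr_ge0.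
have h2 : `|transform k f xi| <= C * japanese xi ^- 2.
  by rewrite ler_pdivlMr ?exprn_gt0// mulrC.
by apply: le_trans h2 _; rewrite ler_wpM2l// weight_ge_japanese.
Qed.

Lemma scaled_transform_fubini k c f phi : kernel k -> decaying f -> decaying phi ->
\int[mu2]_xi (c * transform k f xi * phi xi) =
  \int[mu2]_p (f p * (c * transform k phi p)).
Proof.
move=> kk df dphi.
have [A A0 hA] := decaying_dominated df; have [B B0 hB] := decaying_dominated dphi.
have e1 : \int[mu2]_xi (c * transform k f xi * phi xi) = c * \int[mu2]_xi (transform k f xi * phi xi).
  rewrite -RintegralZl//; last first.
    apply: (@integrable_dominated _ _ (A * pi ^+ 2 * B)).
      apply: measurable_funM; last exact: decaying_measurable.
      by apply: continuous_measurable_plane; exact: continuous_transform.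
    move=> p; rewrite normrM -[leRHS]mulrA; apply: ler_pM => //.
    by apply: transform_le => //; exact: decaying_measurable.
  by apply: eq_Rintegral => p _; rewrite mulrA.
rewrite e1 (transform_fubini kk)// -RintegralZl//; last first.
  apply: (@integrable_dominated _ _ (B * pi ^+ 2 * A)).
    apply: measurable_funM; first exact: decaying_measurable.
    by apply: continuous_measurable_plane; exact: continuous_transform.
  move=> p; rewrite mulrC normrM -[leRHS]mulrA; apply: ler_pM => //.
  by apply: transform_le => //; exact: decaying_measurable.
by apply: eq_Rintegral => p _; rewrite mulrCA.
Qed.

Lemma measurable_transform k f : kernel k -> decaying f ->
  plane_measurable R (transform k f).
Proof. by move=> kk df; apply: continuous_measurable_plane; exact: continuous_transform. Qed.

Lemma is_fourierL2_decaying f C : decaying f ->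
  (forall xi, japanese xi ^+ 2 * `|transform (@cos R) f xi| <= C) ->
  (forall xi, japanese xi ^+ 2 * `|transform (@sin R) f xi| <= C) ->
  is_fourierL2 f (fourier_re f) (fourier_im f).
Proof.
move=> df hc hs.
have hc' := decaying_transform_dominated kernel_cos df hc.
have hs' := decaying_transform_dominated kernel_sin df hs.
have C0 : 0 <= C by apply: le_trans (hc 0); rewrite mulr_ge0// sqr_ge0.
have mc : plane_measurable R (transform (@cos R) f).
  exact: measurable_transform kernel_cos df.
have ms : plane_measurable R (transform (@sin R) f).
  exact: measurable_transform kernel_sin df.
have pp : 0 <= (2 * pi : R)^-1 by rewrite invr_ge0 mulr_ge0// pi_ge0.
split.
- exact: decaying_Lfun2.
- apply: (@Lfun2_dominated _ ((2 * pi)^-1 * C)); first exact: measurable_funM.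
    exact: mulr_ge0.
  by move=> p; rewrite fourier_reE normrM ger0_norm// -mulrA ler_wpM2l.
- apply: (@Lfun2_dominated _ ((2 * pi)^-1 * C)).
  + apply: measurableT_comp => //; exact: measurable_funM.
  + exact: mulr_ge0.
  by move=> p; rewrite fourier_imE normrN normrM ger0_norm// -mulrA ler_wpM2l.
move=> phi /schwartz_decaying dphi.
split; first exact: scaled_transform_fubini kernel_cos df dphi.
under eq_Rintegral do rewrite fourier_imE -mulNr.
under [RHS]eq_Rintegral do rewrite fourier_imE -mulNr.
exact: scaled_transform_fubini kernel_sin df dphi.
Qed.

Lemma sobolev_weightE p : 1 + (p.1 ^+ 2 + p.2 ^+ 2) = japanese p.
Proof. by rewrite /japanese addrA. Qed.

Lemma measurable_japanese_powR s : plane_measurable R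
  (fun p => japanese p `^ s).
Proof.
apply: (measurableT_comp (measurable_powR s)); apply: continuous_measurable_plane => p.
apply: continuous_plane_add; last by apply: continuous_plane_mul; exact: continuous_snd.
apply: continuous_plane_add; first exact: cst_continuous.
by apply: continuous_plane_mul; exact: continuous_fst.
Qed.

Lemma measurable_modulus f g : plane_measurable R f ->
  plane_measurable R g ->
  plane_measurable R (fun p => Num.sqrt (f p ^+ 2 + g p ^+ 2)).
Proof.
move=> mf mg; apply: (@measurableT_comp _ _ _ _ _ _ (@Num.sqrt R)).
  apply: continuous_measurable_fun; exact: sqrt_continuous.
by apply: measurable_funD; exact: measurable_funX.
Qed.

Lemma sobolev_norm_le f s l C D : decaying f -> 0 < l -> 0 <= D ->
  (forall xi, japanese xi ^+ 2 * `|transform (@cos R) f xi| <= C) ->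
  (forall xi, japanese xi ^+ 2 * `|transform (@sin R) f xi| <= C) ->
  (forall xi, japanese (l *: xi) `^ (s / 2) *
     Num.sqrt (fourier_re f (l *: xi) ^+ 2 + fourier_im f (l *: xi) ^+ 2) <= l^-1 * D * weight xi) ->
  (sobolev_norm s f <= (D * pi)%:E)%E.
Proof.
move=> df l0 D0 hc hs hD.
have mc : plane_measurable R (fourier_re f).
  by apply: measurable_funM; [exact: measurable_cst|exact: measurable_transform kernel_cos df].
have ms : plane_measurable R (fourier_im f).
  apply: (@measurableT_comp _ _ _ _ _ _ (@GRing.opp R)); first exact: oppr_measurable.
  by apply: measurable_funM; [exact: measurable_cst|exact: measurable_transform kernel_sin df].
apply: le_trans.
  by apply: ereal_inf_lbound; exists (fourier_re f), (fourier_im f); split => //; exact: (is_fourierL2_decaying df hc hs).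
apply: (Lnorm2_le l0 D0).
  under eq_fun do rewrite sobolev_weightE.
  by apply: measurable_funM; [exact: measurable_japanese_powR|exact: measurable_modulus].
by move=> xi; rewrite sobolev_weightE ger0_norm// mulr_ge0// ?powR_ge0 ?sqrtr_ge0.
Qed.

(** Duality: some candidate (g, h) has weighted norm below [e], the definition identifies the
    pairing with the integral of g phi, and the Cauchy-Schwarz inequality is applied after splitting
    off the weight. *)
Lemma sobolev_norm_pairing f phi s l Y e : schwartz phi -> 0 < l -> 0 <= Y ->
  (sobolev_norm s f < e%:E)%E ->
  (forall xi, `|phi (l *: xi)| * japanese (l *: xi) `^ (- (s / 2)) <= Y * weight xi) ->
  `|\int[mu2]_p (f p * fourier_re phi p)| <= e * (l * Y * pi).
Proof.
move=> sphi l0 Y0 /ereal_inf_lt[_ [g [h [gh ->]]] lte] hY.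
have dphi := schwartz_decaying sphi.
have [_ Lg Lh /(_ _ sphi)[Eg _]] := gh.
rewrite -Eg.
have mg : plane_measurable R g.
  by move: Lg; rewrite inE => /andP[]; rewrite inE.
have mh : plane_measurable R h.
  by move: Lh; rewrite inE => /andP[]; rewrite inE.
have mphi := decaying_measurable dphi.
set G := (X in ('N[_]__[EFin \o X] < _)%E) in lte.
pose P xi := phi xi * japanese xi `^ (- (s / 2)).
have mG : plane_measurable R G.
  rewrite /G; under eq_fun do rewrite sobolev_weightE.
  by apply: measurable_funM; [exact: measurable_japanese_powR|exact: measurable_modulus].
have mP : plane_measurable R P.
  by apply: measurable_funM => //; exact: measurable_japanese_powR.
have NP : ('N[mu2]_2%:E [EFin \o P] <= (l * Y * pi)%:E)%E.
  apply: (Lnorm2_le l0) => //; first by rewrite mulr_ge0// ltW.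
  move=> xi; rewrite (mulrA l^-1) mulVf ?gt_eqF// mul1r normrM [X in _ * X]ger0_norm ?powR_ge0//.
have half2 : (2 : R)^-1 + 2^-1 = 1 by lra.
have H := @hoelder _ _ _ mu2 G P 2 2 mG mP (ltr0n _ 2) (ltr0n _ 2) half2.
have N0 := @Lnorm_ge0 _ _ _ mu2 2%:E (EFin \o G).
have H2 : ('N[mu2]_1 [EFin \o (G \* P)%R] <= (e * (l * Y * pi))%:E)%E.
  apply: le_trans H _; rewrite EFinM; apply: lee_pmul => //; [exact: Lnorm_ge0|exact: ltW].
have H3 : (`|\int[mu2]_xi (g xi * phi xi)%:E| <= (e * (l * Y * pi))%:E)%E.
  apply: le_trans (le_abse_integral _ _ _) _ => //; first by apply/measurable_EFinP; exact: measurable_funM.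
  apply: le_trans H2; rewrite Lnorm1; apply: ge0_le_integral => //.
  - by apply: measurableT_comp => //; apply/measurable_EFinP; exact: measurable_funM.
  - by apply: measurableT_comp => //; apply/measurable_EFinP; exact: measurable_funM.
  move=> xi _; rewrite /= lee_fin /G /P sobolev_weightE powRN.
  have J : 0 < japanese xi `^ (s / 2) by rewrite powR_gt0// japanese_gt0.
  set sq := Num.sqrt _; rewrite [X in _ <= `|X|](_ : _ = sq * phi xi); last first.
    by field; rewrite gt_eqF.
  (* |g| is at most the modulus of g + i h. *)
  rewrite !normrM ler_wpM2r// [leRHS]ger0_norm ?sqrtr_ge0// -sqrtr_sqr ler_wsqrtr// lerDl.
  exact: sqr_ge0.
rewrite /Rintegral; move: H3; case: (\int[mu2]_xi (g xi * phi xi)%:E)%E => [r| |]//=.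
Qed.

Lemma transformB k f g xi : kernel k -> decaying f -> decaying g ->
  transform k (f \- g) xi = transform k f xi - transform k g xi.
Proof.
move=> kk df dg; rewrite /transform -RintegralB//; last 2 first.
- exact: integrable_transform.
- exact: integrable_transform.
by apply: eq_Rintegral => p _; rewrite mulrBl.
Qed.

Lemma transformZ k c f xi : kernel k -> decaying f ->
  transform k (fun p => c * f p) xi = c * transform k f xi.
Proof.
move=> kk df; rewrite /transform -RintegralZl//; last exact: integrable_transform.
by apply: eq_Rintegral => p _; rewrite mulrA.
Qed.

Lemma sqrt_sqr_le_norm (x y : R) : Num.sqrt (x ^+ 2 + y ^+ 2) <= `|x| + `|y|.
Proof.
rewrite -(real_normK (num_real x)) -(real_normK (num_real y)).
have /ger0_norm <- : 0 <= `|x| + `|y| by rewrite addr_ge0.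
rewrite -[leRHS]sqrtr_sqr ler_wsqrtr// sqrrD -addrA (addrC (_ *+ 2)) addrA lerDl.
by rewrite mulrn_wge0// mulr_ge0.
Qed.

Lemma japanese_scale_le l p : 1 <= l -> japanese (l *: p) <= l ^+ 2 * japanese p.
Proof.
move=> l1; rewrite /japanese /= !exprMn !mulrDr mulr1 !lerD2r.
exact: exprn_ege1.
Qed.

(** At l xi the Sobolev weight is at most l^s japanese^N, and the scaling of the L^2 norm accounts
    for the other power of [l]. The two surplus powers of [japanese] are traded for the integrable
    [weight]. *)
Lemma sobolev_norm_le_scaled f s l (N : nat) C D : decaying f -> 1 <= l -> 0 <= s <= (N * 2)%:R -> 0 <= D ->
  (forall xi, japanese xi ^+ 2 * `|transform (@cos R) f xi| <= C) ->
  (forall xi, japanese xi ^+ 2 * `|transform (@sin R) f xi| <= C) ->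
  (forall xi, japanese xi ^+ (N + 2) * `|transform (@cos R) f (l *: xi)| <= l `^ (- (1 + s)) * D) ->
  (forall xi, japanese xi ^+ (N + 2) * `|transform (@sin R) f (l *: xi)| <= l `^ (- (1 + s)) * D) ->
  (sobolev_norm s f <= D%:E)%E.
Proof.
move=> df l1 /andP[s0 sN] D0 hc hs hC hS.
have l0 : 0 < l by exact: lt_le_trans l1.
have p0 : 0 < pi :> R := pi_gt0 R.
have -> : D = D * pi^-1 * pi by rewrite mulfVK ?gt_eqF.
have D0' : 0 <= D * pi^-1 by rewrite mulr_ge0// invr_ge0 ltW.
apply: (sobolev_norm_le df l0 D0' hc hs) => xi.
have J := japanese_gt0 xi.
apply: (@le_trans _ _ ((l ^+ 2 * japanese xi) `^ (s / 2) * (`|fourier_re f (l *: xi)| + `|fourier_im f (l *: xi)|))).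
  apply: ler_pM; rewrite ?powR_ge0 ?sqrtr_ge0 ?sqrt_sqr_le_norm//.
  apply: ge0_ler_powR; rewrite ?nnegrE ?divr_ge0//; first exact: ltW (japanese_gt0 _).
    by rewrite mulr_ge0 ?sqr_ge0// ltW.
  exact: japanese_scale_le.
rewrite powRM ?sqr_ge0 ?(ltW J)// -powR_mulrn ?(ltW l0)// -powRrM.
have -> : 2 * (s / 2) = s by field.
have JN : japanese xi `^ (s / 2) <= japanese xi ^+ N.
  rewrite -powR_mulrn ?(ltW J)//; apply: ler_powR; first exact: japanese_ge1.
  by rewrite ler_pdivrMr// -natrM.
have lV : l `^ (- (1 + s)) = l^-1 * (l `^ s)^-1.
  by rewrite powRN powRD ?(gt_eqF l0) ?implybT// powRr1 ?(ltW l0)// invfM.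
have bd k : japanese xi ^+ (N + 2) * `|transform k f (l *: xi)| <= l `^ (- (1 + s)) * D ->
    l `^ s * japanese xi `^ (s / 2) * ((2 * pi)^-1 * `|transform k f (l *: xi)|) <=
    2^-1 * (l^-1 * (D / pi) * weight xi).
  rewrite exprD lV => h.
  have L : 0 < l `^ s by rewrite powR_gt0.
  have h1 : japanese xi ^+ N * `|transform k f (l *: xi)| <= l^-1 * (l `^ s)^-1 * D * weight xi.
    apply: (@le_trans _ _ (l^-1 * (l `^ s)^-1 * D * japanese xi ^- 2)).
      by rewrite ler_pdivlMr ?exprn_gt0// mulrAC.
    by apply: ler_wpM2l (weight_ge_japanese xi); rewrite !mulr_ge0 ?invr_ge0// ltW.
  have h2 : japanese xi `^ (s / 2) * `|transform k f (l *: xi)| <= l^-1 * (l `^ s)^-1 * D * weight xi.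
    by apply: le_trans h1; rewrite ler_wpM2r.
  have -> : l `^ s * japanese xi `^ (s / 2) * ((2 * pi)^-1 * `|transform k f (l *: xi)|) =
    (2 * pi)^-1 * (l `^ s * (japanese xi `^ (s / 2) * `|transform k f (l *: xi)|)) by ring.
  have -> : 2^-1 * (l^-1 * (D / pi) * weight xi) = (2 * pi)^-1 * (l `^ s * (l^-1 * (l `^ s)^-1 * D * weight xi)).
    have gen (a b c d w : R) : a != 0 -> b != 0 -> c != 0 ->
        2^-1 * (b^-1 * (d / c) * w) = (2 * c)^-1 * (a * (b^-1 / a * d * w)).
      by move=> a0 b0 c0; field; rewrite a0 b0 c0.
    by apply: gen; rewrite gt_eqF.
  by rewrite !ler_pM2l// invr_gt0 mulr_gt0.
rewrite mulrDr fourier_reE fourier_imE normrN !normrM [`|(2 * pi)^-1|]ger0_norm ?invr_ge0 ?mulr_ge0 ?(ltW p0)//.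
apply: le_trans (lerD (bd _ (hC xi)) (bd _ (hS xi))) _.
by rewrite -mulrDl (_ : 2^-1 + 2^-1 = 1 :> R) ?mul1r//; lra.
Qed.

(** * Differential calculus and decay of transforms of Schwartz functions *)

Lemma schwartz_derive f v : schwartz f -> schwartz ('D_v f).
Proof.
have E vs : iter_derive vs ('D_v f) = iter_derive (rcons vs v) f.
  by rewrite /iter_derive foldr_rcons.
move=> [sm dec]; split.
  by move=> n vs n_vs p; rewrite E; apply: (sm n.+1); rewrite size_rcons.
by move=> vs n; rewrite E; exact: dec.
Qed.

Lemma schwartz_is_derive f v p : schwartz f -> is_derive p v f ('D_v f p).
Proof. by move=> [sm _]; apply: DeriveDef => //; apply: diff_derivable; exact: (sm 1%N [::]). Qed.

Lemma is_derive_plane_eq f p v (a b : R) : is_derive p v f a -> a = b -> is_derive p v f b.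
Proof. by move=> h <-. Qed.

(** Bundles differentiability with all directional derivatives, so that one set of rules yields
    both. *)
Definition gradient f p (a b : R) :=
  differentiable f p /\ forall v, is_derive p v f (a * v.1 + b * v.2).

Lemma gradient_eq f p a b a' b' : gradient f p a b -> a = a' -> b = b' -> gradient f p a' b'.
Proof. by move=> h <- <-. Qed.

Lemma gradient_fst p : gradient (fun q => q.1) p 1 0.
Proof.
have df : differentiable (fun q : R * R => q.1) p.
  exact: (@linear_differentiable R (R * R)%type R (@fst R R) p (fun q => @cvg_fst _ _ _ _ _)).
split=> // v; apply: DeriveDef; first exact: diff_derivable.
rewrite deriveE// (@diff_lin R (R * R)%type R (@fst R R))/=; first by rewrite mul1r mul0r addr0.
by move=> ?; exact: cvg_fst.
Qed.

Lemma gradient_snd p : gradient (fun q => q.2) p 0 1.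
Proof.
have df : differentiable (fun q : R * R => q.2) p.
  exact: (@linear_differentiable R (R * R)%type R (@snd R R) p (fun q => @cvg_snd _ _ _ _ _)).
split=> // v; apply: DeriveDef; first exact: diff_derivable.
rewrite deriveE// (@diff_lin R (R * R)%type R (@snd R R))/=; first by rewrite mul1r mul0r add0r.
by move=> ?; exact: cvg_snd.
Qed.

Lemma gradient_cst p (c : R) : gradient (fun=> c) p 0 0.
Proof.
split; first exact: differentiable_cst.
by move=> v; rewrite !mul0r addr0; exact: is_derive_cst.
Qed.

Lemma gradient_add f g p a b a' b' : gradient f p a b -> gradient g p a' b' ->
  gradient (fun q => f q + g q) p (a + a') (b + b').
Proof.
move=> [df hf] [dg hg]; split; first exact: differentiableD.
move=> v; apply: (is_derive_plane_eq (is_deriveD (hf v) (hg v))); ring.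
Qed.

Lemma is_derive_plane_mul f g p v (df dg : R) : is_derive p v f df -> is_derive p v g dg ->
  is_derive p v (fun q => f q * g q) (df * g p + f p * dg).
Proof.
move=> hf hg; apply: (is_derive_plane_eq (is_deriveM hf hg)).
by rewrite /GRing.scale/= addrC; congr (_ + _); exact: mulrC.
Qed.

Lemma gradient_mul f g p a b a' b' : gradient f p a b -> gradient g p a' b' ->
  gradient (fun q => f q * g q) p (a * g p + f p * a') (b * g p + f p * b').
Proof.
move=> [df hf] [dg hg]; split; first exact: differentiableM.
by move=> v; apply: (is_derive_plane_eq (is_derive_plane_mul (hf v) (hg v))); ring.
Qed.

Lemma gradient_comp (h : R -> R) f p (d a b : R) : is_derive (f p) 1 h d -> gradient f p a b ->
  gradient (fun q => h (f q)) p (d * a) (d * b).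
Proof.
move=> [hd hv] [df hf]; have dh : differentiable h (f p) by exact/derivable1_diffP.
have dhf : differentiable (h \o f) p by exact: differentiable_comp.
split; first exact: dhf.
move=> v; have [fd fv] := hf v.
have vh := @diff_derivable _ _ _ _ _ v dhf.
apply: (DeriveDef vh).
have -> : d * a * v.1 + d * b * v.2 = (a * v.1 + b * v.2) * d by ring.
rewrite (deriveE _ dhf) diff_comp//= -(deriveE _ df) fv.
move: (_ + _) => e; rewrite -(mulr1 e) (_ : e * 1 = e *: (1 : R))// linearZ /= -deriveE// hv.
by rewrite /GRing.scale/= mulr1.
Qed.

Lemma gradient_dotp xi p : gradient (fun q => dotp q xi) p xi.1 xi.2.
Proof.
apply: (gradient_eq (gradient_add (gradient_mul (gradient_fst p) (gradient_cst p xi.1))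
  (gradient_mul (gradient_snd p) (gradient_cst p xi.2)))); ring.
Qed.

(** Integration by parts: the derivative along [v] of f(q) k(q . xi) has integral zero. *)
Lemma transform_derive f v xi : v = (1, 0) \/ v = (0, 1) -> schwartz f ->
  transform (@cos R) ('D_v f) xi = dotp v xi * transform (@sin R) f xi /\
  transform (@sin R) ('D_v f) xi = - (dotp v xi * transform (@cos R) f xi).
Proof.
move=> hv sf; have df := schwartz_decaying sf.
have dDf := schwartz_decaying (schwartz_derive v sf).
have [C C0 hC] := decaying_dominated df; have [D D0 hD] := decaying_dominated dDf.
have cont k : kernel k -> continuous (fun q : R * R => k (dotp q xi)).
  move=> [ck _ _] q; apply: (@continuous_comp _ _ _ (fun q : R * R => dotp q xi) k); last exact: ck.
  exact: continuous_dotp.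
(* [k] and [k'] are cos and sin in either order, with c = -1 or 1, so one computation covers both
   cases. *)
have key k k' c : kernel k -> kernel k' -> (forall x : R, is_derive x 1 k (c * k' x)) -> `|c| <= 1 ->
    transform k ('D_v f) xi = - c * (dotp v xi * transform k' f xi).
  move=> kk kk' hk c1.
  have der p : is_derive p v (fun q => f q * k (dotp q xi))
      ('D_v f p * k (dotp p xi) + c * dotp v xi * (f p * k' (dotp p xi))).
    have [_ /(_ v) hg] := gradient_comp (hk _) (gradient_dotp xi p).
    by apply: (is_derive_plane_eq (is_derive_plane_mul (schwartz_is_derive v p sf) hg)); rewrite /dotp; ring.
  have [_ k1 _] := kk; have [_ k1' _] := kk'.
  have mf : plane_measurable R (fun q => f q * k (dotp q xi)).
    apply: continuous_measurable_plane => q; apply: continuous_plane_mul; [by case: df => /(_ q)|exact: (cont k kk q)].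
  have := @integral_derive_eq0 _ _ v C (D + `|c * dotp v xi| * C) hv der mf.
  rewrite RintegralD//; last 2 first.
  - exact: integrable_transform.
  - apply: (integrableZl measurableT (c * dotp v xi) (integrable_transform kk' xi df)).
  rewrite RintegralZl//; last exact: integrable_transform.
  move=> H; have : transform k ('D_v f) xi + c * dotp v xi * transform k' f xi = 0.
    apply: H => p; first exact: (le_trans (transform_integrand_le kk f xi p) (hC p)).
    rewrite mulrDl; apply: le_trans (ler_normD _ _) _; apply: lerD.
      exact: (le_trans (transform_integrand_le kk ('D_v f) xi p) (hD p)).
    rewrite normrM -mulrA ler_wpM2l//.
    exact: (le_trans (transform_integrand_le kk' f xi p) (hC p)).
  by move=> /eqP; rewrite addr_eq0 => /eqP ->; ring.
have hcos (x : R) : is_derive x 1 (@cos R) (-1 * sin x) by apply: derive_eq (is_derive_cos x) _; rewrite mulN1r.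
have hsin (x : R) : is_derive x 1 (@sin R) (1 * cos x) by apply: derive_eq (is_derive_sin x) _; rewrite mul1r.
have n1 : `|-1 : R| <= 1 by rewrite normrN1.
have n2 : `|1 : R| <= 1 by rewrite normr1.
have := key _ _ _ kernel_cos kernel_sin hcos n1; rewrite opprK mul1r => ->.
by have := key _ _ _ kernel_sin kernel_cos hsin n2; rewrite mulN1r => ->.
Qed.

(** 1 - Laplacian becomes multiplication by 1 + |xi|^2, as two derivatives lead back from cos to cos
    and from sin to sin. *)
Lemma transform_laplacian f xi k : k = @cos R \/ k = @sin R -> schwartz f ->
  japanese xi * transform k f xi =
  transform k f xi - transform k (dx (dx f)) xi - transform k (dy (dy f)) xi.
Proof.
move=> hk sf; rewrite /dx /dy.
have h1 : (1, 0) = (1, 0) :> R * R \/ (1, 0) = (0, 1) :> R * R by left.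
have h2 : (0, 1) = (1, 0) :> R * R \/ (0, 1) = (0, 1) :> R * R by right.
have [xc xs] := transform_derive xi h1 (schwartz_derive (1, 0) sf).
have [yc ys] := transform_derive xi h2 (schwartz_derive (0, 1) sf).
have [xc' xs'] := transform_derive xi h1 sf.
have [yc' ys'] := transform_derive xi h2 sf.
have d1 : dotp (1, 0) xi = xi.1 by rewrite /dotp/= mul1r mul0r addr0.
have d2 : dotp (0, 1) xi = xi.2 by rewrite /dotp/= mul1r mul0r add0r.
rewrite d1 in xc xs xc' xs'; rewrite d2 in yc ys yc' ys'.
have gen (x y A B C B' C' : R) : [\/ [/\ B = x * B', C = y * C', B' = - (x * A) & C' = - (y * A)] |
    [/\ B = - (x * B'), C = - (y * C'), B' = x * A & C' = y * A]] -> (1 + x ^+ 2 + y ^+ 2) * A = A - B - C.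
  by move=> [|] [-> -> -> ->]; ring.
rewrite /japanese; case: hk => ->.
  exact: (gen xi.1 xi.2 _ _ _ _ _ (or_introl (And4 xc yc xs' ys'))).
exact: (gen xi.1 xi.2 _ _ _ _ _ (or_intror (And4 xs ys xc' yc'))).
Qed.

(** Each power of [japanese] is exchanged for one application of 1 - Laplacian, which preserves the
    Schwartz class. *)
Lemma transform_schwartz f k N : k = @cos R \/ k = @sin R -> schwartz f ->
  exists2 C, 0 <= C & forall xi, japanese xi ^+ N * `|transform k f xi| <= C.
Proof.
move=> hk; have kk := kernel_cos_sin hk.
elim: N f => [|N IH] f sf.
  have df := schwartz_decaying sf; have [C C0 hC] := decaying_dominated df.
  exists (C * pi ^+ 2); first by rewrite mulr_ge0// sqr_ge0.
  by move=> xi; rewrite mul1r; apply: transform_le => //; exact: decaying_measurable.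
have [C C0 hC] := IH _ sf.
have [D D0 hD] := IH _ (schwartz_derive (1, 0) (schwartz_derive (1, 0) sf)).
have [E E0 hE] := IH _ (schwartz_derive (0, 1) (schwartz_derive (0, 1) sf)).
exists (C + D + E); first by rewrite !addr_ge0.
move=> xi; rewrite exprSr -mulrA -[X in _ * (X * _)](ger0_norm (ltW (japanese_gt0 xi))) -normrM transform_laplacian//.
have JN : 0 <= japanese xi ^+ N by rewrite exprn_ge0// ltW// japanese_gt0.
apply: (@le_trans _ _ (japanese xi ^+ N * (`|transform k f xi| + `|transform k (dx (dx f)) xi| + `|transform k (dy (dy f)) xi|))).
  apply: ler_wpM2l => //; apply: le_trans (ler_normB _ _) _; rewrite lerD2r.
  exact: ler_normB.
by rewrite !mulrDr; exact: (lerD (lerD (hC xi) (hD xi)) (hE xi)).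
Qed.

End Fourier.

(** A zero integral would make [f] vanish almost everywhere, while the square [1, 2]^2 has measure
    1. The square avoids the origin, where an integrand with a factor |xi|^2 vanishes. *)
Lemma integral_plane_gt0 (R : realType) (f : R * R -> R) : (leb2 R).-integrable setT (EFin \o f) ->
  (forall p, 0 <= f p) -> (forall x y, 1 <= x <= 2 -> 1 <= y <= 2 -> 0 < f (x, y)) ->
  0 < \int[leb2 R]_p f p.
Proof.
move=> fi f0 fp; have mf : measurable_fun setT (EFin \o f) by case/integrableP: fi.
have I0 := integral_plane_ge0 f0.
rewrite lt_neqAle I0 andbT eq_sym; apply/negP => /eqP fE.
have : (\int[leb2 R]_(p in setT) `|(EFin \o f) p| = 0)%E.
  under eq_integral do rewrite /= ger0_norm//.
  by move: fE; rewrite /Rintegral => fE; rewrite -[LHS]fineK ?fE//; exact: integrable_fin_num.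
have [+ _] := ae_eq_integral_abs (leb2 R) measurableT mf; move=> H /H[N [mN N0 sN]].
have : ((leb2 R) (`[1%R, 2%R]%classic `*` `[1%R, 2%R]%classic) <= (leb2 R) N)%E.
  apply: le_measure; rewrite ?inE//; first by apply: measurableX; exact: measurable_itv.
  move=> [x y] [/= xI yI]; apply: sN => /= /(_ I) [] fxy.
  by move: xI yI; rewrite !in_itv/= => xI yI; have := fp x y xI yI; rewrite fxy ltxx.
have L1 : lebesgue_measure (`[1%R, 2%R]%classic : set R) = 1%E.
  rewrite lebesgue_measure_itv/= lte_fin ltrDl ltr01 -EFinB; congr EFin; lra.
have -> : (leb2 R) (`[1%R, 2%R]%classic `*` `[1%R, 2%R]%classic) = (1 * 1)%E.
  by rewrite product_measure1E//; congr (_ * _)%E; exact: L1.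
by rewrite mule1 N0 lee_fin ler10.
Qed.

(** * Solitary waves *)

Section SolitaryWave.
Context {R : realType}.
Notation mu2 := (leb2 R).
Variables (w : nat -> R -> R) (u0 : R) (deg : nat).
Hypotheses (u0_lt0 : u0 < 0)
  (w_derive : forall n (s : R), u0 < s -> is_derive s 1 (w n) (w n.+1 s))
  (w_rapid : forall n, rapid (w n))
  (w_pos : forall s, 0 <= s -> 0 < w 0 s)
  (w_ode : forall s, u0 < s -> s * w 2 s + w 1 s = w 0 s - w 0 s ^+ deg.+1).
Implicit Types (f g phi : R * R -> R) (p q v xi : R * R) (s l : R).

(** The factor 1/4 turns the Laplacian of w(radial) into l^2 (s w'' + w'), the left side of
    [w_ode]. *)
Definition radial l (x0 : R) p : R := l ^+ 2 * ((p.1 - x0) ^+ 2 + p.2 ^+ 2) / 4.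

(* The scale l and the centre x0 vary within the class, so that it contains the
   difference of two solitary waves and is stable under dilations. *)
Inductive profile_class : (R * R -> R) -> Prop :=
| profile_base n l x0 : 0 < l -> profile_class (fun p => w n (radial l x0 p))
| profile_add f g : profile_class f -> profile_class g -> profile_class (fun p => f p + g p)
| profile_scale c f : profile_class f -> profile_class (fun p => c * f p)
| profile_fst f : profile_class f -> profile_class (fun p => p.1 * f p)
| profile_snd f : profile_class f -> profile_class (fun p => p.2 * f p).

Lemma radial_ge0 l x0 p : 0 <= radial l x0 p.
Proof. by rewrite /radial mulr_ge0// mulr_ge0 ?sqr_ge0// addr_ge0 ?sqr_ge0. Qed.

Lemma gradient_radial l x0 p :
  gradient (radial l x0) p (l ^+ 2 / 2 * (p.1 - x0)) (l ^+ 2 / 2 * p.2).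
Proof.
have G1 := gradient_add (gradient_fst p) (gradient_cst p (- x0)).
have G := gradient_mul (gradient_mul (gradient_cst p (l ^+ 2)) (gradient_add (gradient_mul G1 G1)
  (gradient_mul (gradient_snd p) (gradient_snd p)))) (gradient_cst p (4^-1)).
by apply: (gradient_eq G); field.
Qed.

Lemma gradient_base n l x0 p :
  gradient (fun q => w n (radial l x0 q)) p (w n.+1 (radial l x0 p) * (l ^+ 2 / 2 * (p.1 - x0)))
    (w n.+1 (radial l x0 p) * (l ^+ 2 / 2 * p.2)).
Proof.
apply: gradient_comp (gradient_radial l x0 p); apply: w_derive.
exact: lt_le_trans (radial_ge0 l x0 p).
Qed.

(** Differentiating a radial profile brings out coordinate factors; this is why the class admits
    multiplication by coordinates. *)
Lemma profile_gradient f : profile_class f -> exists a b, [/\ profile_class a, profile_class b &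
  forall p, gradient f p (a p) (b p)].
Proof.
elim=> {f} [n l x0 l0|f g cf [a [b [ca cb ab]]] cg [a' [b' [ca' cb' ab']]]|c f cf [a [b [ca cb ab]]]
  |f cf [a [b [ca cb ab]]]|f cf [a [b [ca cb ab]]]].
- have W := profile_base n.+1 x0 l0.
  exists (fun p => l ^+ 2 / 2 * (p.1 * w n.+1 (radial l x0 p)) + (- (l ^+ 2 / 2 * x0)) * w n.+1 (radial l x0 p)).
  exists (fun p => l ^+ 2 / 2 * (p.2 * w n.+1 (radial l x0 p))).
  split; [apply: profile_add; apply: profile_scale => //; exact: profile_fst|
    by apply: profile_scale; exact: profile_snd|].
  by move=> p; apply: (gradient_eq (gradient_base n l x0 p)); ring.
- exists (fun p => a p + a' p), (fun p => b p + b' p); split; [exact: profile_add|exact: profile_add|].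
  by move=> p; exact: gradient_add.
- exists (fun p => c * a p), (fun p => c * b p); split; [exact: profile_scale|exact: profile_scale|].
  by move=> p; apply: (gradient_eq (gradient_mul (gradient_cst p c) (ab p))); ring.
- exists (fun p => f p + p.1 * a p), (fun p => p.1 * b p).
  split; [by apply: profile_add => //; exact: profile_fst|exact: profile_fst|].
  by move=> p; apply: (gradient_eq (gradient_mul (gradient_fst p) (ab p))); ring.
- exists (fun p => p.2 * a p), (fun p => f p + p.2 * b p).
  split; [exact: profile_snd|by apply: profile_add => //; exact: profile_snd|].
  by move=> p; apply: (gradient_eq (gradient_mul (gradient_snd p) (ab p))); ring.
Qed.

Lemma profile_differentiable f p : profile_class f -> differentiable f p.
Proof. by move=> /profile_gradient[a [b [_ _ /(_ p)[]]]]. Qed.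

Lemma profile_class_derive f v : profile_class f -> profile_class ('D_v f).
Proof.
move=> /profile_gradient[a [b [ca cb ab]]].
rewrite (_ : 'D_v f = fun p => v.1 * a p + v.2 * b p).
  by apply: profile_add; exact: profile_scale.
by apply/funext => p; have [_ /(_ v)[_ ->]] := ab p; rewrite mulrC (mulrC (b p)).
Qed.

(** A coordinate factor costs one power of [japanese], so the induction carries all [N] together. *)
Lemma profile_decay f : profile_class f -> forall N, exists2 C, 0 <= C & forall p, japanese p ^+ N * `|f p| <= C.
Proof.
have coord (x : R) p (g : R * R -> R) : `|x| <= japanese p -> forall N C, 0 <= C ->
    (forall q, japanese q ^+ N.+1 * `|g q| <= C) -> japanese p ^+ N * `|x * g p| <= C.
  move=> xp N C C0 h; apply: le_trans (h p); rewrite exprSr normrM -mulrA ler_wpM2l//.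
    by rewrite exprn_ge0// ltW// japanese_gt0.
  exact: ler_wpM2r.
have norm_le (x y : R) : `|x| <= 1 + x ^+ 2 + y ^+ 2.
  have := sqr_ge0 y; have := sqr_ge0 (`|x| - 1); rewrite -(real_normK (num_real x)).
  by move: (`|x|) => z; nra.
elim=> {f} [n l x0 l0 N|f g _ Hf _ Hg N|c f _ Hf N|f _ Hf N|f _ Hf N].
- have wr := w_rapid; have [C hC] := wr n N.
  have C0 : 0 <= C by apply: le_trans (hC 0 (lexx 0)); rewrite mulr_ge0// exprn_ge0// addr0.
  (* From |p|^2 <= 2 |p - x0|^2 + 2 x0^2, where 2 |p - x0|^2 is 8 l^-2 times [radial]. *)
  pose K := 1 + 2 * x0 ^+ 2 + 8 / l ^+ 2.
  have l8 : 0 <= 8 / l ^+ 2 by apply: mulr_ge0; rewrite ?invr_ge0 ?sqr_ge0.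
  have K0 : 0 <= K by apply: addr_ge0 l8; apply: addr_ge0 => //; apply: mulr_ge0 => //; exact: sqr_ge0.
  exists (K ^+ N * C); first by rewrite mulr_ge0 ?exprn_ge0.
  move=> p; have s0 := radial_ge0 l x0 p.
  apply: (@le_trans _ _ (K ^+ N * ((1 + radial l x0 p) ^+ N * `|w n (radial l x0 p)|))); last first.
    by rewrite ler_wpM2l ?exprn_ge0// hC.
  rewrite mulrA -exprMn ler_wpM2r// lerXn2r ?nnegrE ?(ltW (japanese_gt0 _)) ?(mulr_ge0 K0 (addr_ge0 ler01 s0))//.
  apply: (@le_trans _ _ (K + 8 / l ^+ 2 * radial l x0 p)).
    have -> : 8 / l ^+ 2 * radial l x0 p = 2 * ((p.1 - x0) ^+ 2 + p.2 ^+ 2).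
      by rewrite /radial; field; rewrite gt_eqF.
    rewrite /K /japanese; move: {s0} (8 / l ^+ 2) l8 (p.1) (p.2) => a a0 x y.
    have := sqr_ge0 (x - 2 * x0); have := sqr_ge0 y; nra.
  rewrite mulrDr mulr1 lerD2l ler_wpM2r// /K lerDr.
  by apply: addr_ge0 => //; apply: mulr_ge0 => //; exact: sqr_ge0.
- have [C C0 hC] := Hf N; have [D D0 hD] := Hg N; exists (C + D); first exact: addr_ge0.
  move=> p; apply: le_trans (lerD (hC p) (hD p)); rewrite -mulrDr ler_wpM2l ?ler_normD//.
  by rewrite exprn_ge0// ltW// japanese_gt0.
- have [C C0 hC] := Hf N; exists (`|c| * C); first exact: mulr_ge0.
  by move=> p; rewrite normrM mulrCA ler_wpM2l.
- have [C C0 hC] := Hf N.+1; exists C => // p; apply: coord => //; exact: norm_le.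
- have [C C0 hC] := Hf N.+1; exists C => // p; apply: coord => //.
  by rewrite /japanese addrAC; exact: norm_le.
Qed.

Lemma profile_schwartz f : profile_class f -> schwartz f.
Proof.
move=> cf.
have ci vs : profile_class (iter_derive vs f) by elim: vs => //= v vs IH; exact: profile_class_derive.
split; first by move=> n vs _ p; exact: profile_differentiable.
move=> vs n; have [C C0 hC] := profile_decay (ci vs) n; exists (2 ^+ n * C) => p.
apply: (@le_trans _ _ (2 ^+ n * (japanese p ^+ n * `|iter_derive vs f p|))); last first.
  by rewrite ler_wpM2l// exprn_ge0.
rewrite mulrA -exprMn ler_wpM2r// lerXn2r ?nnegrE ?mulr_ge0 ?addr_ge0 ?sqr_ge0//.
have -> : `|p| = Num.max `|p.1| `|p.2| by [].
have : Num.max `|p.1| `|p.2| <= 1 + `|p.1| ^+ 2 + `|p.2| ^+ 2.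
  rewrite ge_max; move: (`|p.1|) (`|p.2|) => x y; apply/andP; split.
    by have := sqr_ge0 (x - 1); have := sqr_ge0 y; nra.
  by have := sqr_ge0 (y - 1); have := sqr_ge0 x; nra.
rewrite !real_normK ?num_real// -/(japanese p) => h.
by have := japanese_ge1 p; lra.
Qed.

(** * Transforms of translated and dilated bumps *)

Definition bump l x0 p : R := w 0 (radial l x0 p).
(** The profile is even, so its sine transform vanishes and this real function is its whole
    transform, up to the factor 1 / (2 pi). *)
Definition amplitude xi : R := transform (@cos R) (bump 1 0) xi.

Lemma profile_bump l x0 : 0 < l -> profile_class (bump l x0).
Proof. exact: profile_base. Qed.

Lemma schwartz_profile f : profile_class f -> schwartz f.
Proof. exact: (profile_schwartz). Qed.

Lemma decaying_profile f : profile_class f -> decaying f.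
Proof. by move=> /schwartz_profile/schwartz_decaying. Qed.

Lemma schwartz_bump l x0 : 0 < l -> schwartz (bump l x0).
Proof. by move=> /(@profile_bump _ x0)/schwartz_profile. Qed.

Lemma decaying_bump l x0 : 0 < l -> decaying (bump l x0).
Proof. by move=> /(@schwartz_bump _ x0)/schwartz_decaying. Qed.

Lemma integrable_profile f : profile_class f -> mu2.-integrable setT (EFin \o f).
Proof.
move=> /decaying_profile df; have [C C0 hC] := decaying_dominated df.
by apply: (integrable_dominated _ hC); exact: decaying_measurable.
Qed.

Lemma integrable_mul_profile (h f : R * R -> R) : continuous h -> (exists C, forall p, `|h p| <= C) ->
  profile_class f -> mu2.-integrable setT (EFin \o (fun p => h p * f p)).
Proof.
move=> ch [C hC] /decaying_profile df; have [D D0 hD] := decaying_dominated df.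
apply: (@integrable_dominated _ _ (C * D)).
  by apply: measurable_funM; [exact: continuous_measurable_plane|exact: decaying_measurable].
by move=> p; rewrite normrM -mulrA; apply: ler_pM.
Qed.

Lemma bump_gt0 l x0 p : 0 < bump l x0 p.
Proof. by apply: w_pos; exact: radial_ge0. Qed.

Lemma bump_affine l x0 p : bump 1 0 (affine_map l (- (l * x0)) 0 p) = bump l x0 p.
Proof. by congr (w 0 _); rewrite /radial /affine_map/=; ring. Qed.

Lemma integral_bump (h : R * R -> R) l x0 : 0 < l -> continuous h -> (exists C, forall p, `|h p| <= C) ->
  \int[mu2]_p (bump l x0 p * h (affine_map l (- (l * x0)) 0 p)) =
  l ^- 2 * \int[mu2]_q (bump 1 0 q * h q).
Proof.
move=> l0 ch [C hC]; have l_neq0 := lt0r_neq0 l0.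
rewrite [in RHS](@integral_affine _ l (- (l * x0)) 0 l_neq0).
  rewrite mulrA mulVf ?sqrf_eq0// mul1r; apply: eq_Rintegral => p _.
  by rewrite bump_affine.
rewrite (_ : (fun p => _) = fun p => h p * bump 1 0 p); last by apply/funext => p; rewrite mulrC.
by apply: integrable_mul_profile => //; [exists C|exact: profile_bump].
Qed.

Lemma continuous_affine_map l a b : continuous (affine_map l a b).
Proof.
have -> : affine_map l a b = fun p => l *: p + (a, b) by apply/funext => p; rewrite -scale_affine /affine_map !addr0.
move=> p; apply: (@continuousD _ (R * R)%type); last exact: cst_continuous.
exact: scaler_continuous.
Qed.

Lemma continuous_kernel_dotp (k : R -> R) xi c : kernel k ->
  continuous (fun q : R * R => k (dotp q xi + c)).
Proof.
move=> [ck _ _] q; apply: (@continuous_comp _ _ _ (fun q : R * R => dotp q xi + c) k); last exact: ck.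
apply: continuous_plane_add; [exact: continuous_dotp|exact: cst_continuous].
Qed.

Lemma transform_bump (k : R -> R) l x0 xi : kernel k -> 0 < l ->
  transform k (bump l x0) xi =
  l ^- 2 * \int[mu2]_q (bump 1 0 q * k (dotp q (l^-1 *: xi) + x0 * xi.1)).
Proof.
move=> kk l0; rewrite -(@integral_bump _ _ x0 l0); last 2 first.
- exact: continuous_kernel_dotp.
- by exists 1 => p; case: kk.
apply: eq_Rintegral => p _; congr (_ * k _).
by rewrite -scale_affine /dotp /affine_map/=; field; rewrite gt_eqF.
Qed.

Lemma transform_sin_ground xi : transform (@sin R) (bump 1 0) xi = 0.
Proof.
have n1 : (-1 : R) != 0 by rewrite oppr_eq0 oner_eq0.
have : transform (@sin R) (bump 1 0) xi = - transform (@sin R) (bump 1 0) xi.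
  rewrite {1}/transform (@integral_affine _ (-1) 0 0 n1); last first.
    by apply: integrable_transform; [exact: kernel_sin|exact: decaying_bump].
  rewrite sqrrN expr1n mul1r /transform -[RHS]mulN1r -RintegralZl//; last first.
    by apply: integrable_transform; [exact: kernel_sin|exact: decaying_bump].
  apply: eq_Rintegral => p _.
  have -> : bump 1 0 (affine_map (-1) 0 0 p) = bump 1 0 p.
    by congr (w 0 _); rewrite /radial /affine_map/=; ring.
  have -> : dotp (affine_map (-1) 0 0 p) xi = - dotp p xi by rewrite /dotp /affine_map/=; ring.
  by rewrite sinN mulN1r mulrN.
by move=> h; lra.
Qed.

(** Translation becomes modulation and dilation the inverse dilation; the sine part drops out of the
    addition formula. *)
Lemma transform_cos_bump l x0 xi : 0 < l ->
  transform (@cos R) (bump l x0) xi = l ^- 2 * (cos (x0 * xi.1) * amplitude (l^-1 *: xi)).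
Proof.
move=> l0; rewrite transform_bump//; last exact: kernel_cos.
have ic := integrable_transform kernel_cos (l^-1 *: xi) (decaying_bump 0 (@ltr01 R)).
have is_ := integrable_transform kernel_sin (l^-1 *: xi) (decaying_bump 0 (@ltr01 R)).
congr (_ * _); under eq_Rintegral do rewrite cosD mulrBr !mulrA.
under eq_Rintegral do rewrite (mulrC _ (cos (x0 * _))) (mulrC _ (sin (x0 * _))).
rewrite RintegralB//; last 2 first.
- exact: (integrableZl measurableT (cos (x0 * xi.1)) ic).
- exact: (integrableZl measurableT (sin (x0 * xi.1)) is_).
rewrite !RintegralZl// -/(transform (@sin R) (bump 1 0) _) transform_sin_ground mulr0 subr0.
by [].
Qed.

Lemma transform_sin_bump l x0 xi : 0 < l ->
  transform (@sin R) (bump l x0) xi = l ^- 2 * (sin (x0 * xi.1) * amplitude (l^-1 *: xi)).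
Proof.
move=> l0; rewrite transform_bump//; last exact: kernel_sin.
have ic := integrable_transform kernel_cos (l^-1 *: xi) (decaying_bump 0 (@ltr01 R)).
have is_ := integrable_transform kernel_sin (l^-1 *: xi) (decaying_bump 0 (@ltr01 R)).
congr (_ * _); under eq_Rintegral do rewrite sinD mulrDr !mulrA.
under eq_Rintegral do rewrite (mulrC _ (cos (x0 * _))) (mulrC _ (sin (x0 * _))).
rewrite RintegralD//; last 2 first.
- exact: (integrableZl measurableT (cos (x0 * xi.1)) is_).
- exact: (integrableZl measurableT (sin (x0 * xi.1)) ic).
rewrite !RintegralZl// -/(transform (@sin R) (bump 1 0) _) transform_sin_ground mulr0 add0r.
by [].
Qed.

Lemma amplitude_decay N : exists2 C, 0 <= C & forall xi, japanese xi ^+ N * `|amplitude xi| <= C.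
Proof. by apply: transform_schwartz; [left|exact: schwartz_bump]. Qed.

Lemma amplitude_lip : exists2 C, 0 <= C &
  forall xi eta, `|amplitude xi - amplitude eta| <= C * (`|xi.1 - eta.1| + `|xi.2 - eta.2|).
Proof. by apply: transform_lip; [exact: kernel_cos|exact: decaying_bump]. Qed.

Lemma continuous_amplitude : continuous amplitude.
Proof. by apply: continuous_transform; [exact: kernel_cos|exact: decaying_bump]. Qed.

Lemma amplitude0_gt0 : 0 < amplitude 0.
Proof.
rewrite /amplitude /transform; under eq_Rintegral do rewrite /dotp/= !mulr0 addr0 cos0 mulr1.
apply: integral_plane_gt0; first by apply: integrable_profile; exact: profile_bump.
  by move=> p; rewrite ltW// bump_gt0.
by move=> x y _ _; exact: bump_gt0.
Qed.

(* The factor |xi|^2 compensates for the weight |xi|^-s at low frequencies. *)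
Definition probe (e l : R) xi : R :=
  l ^- 2 * (xi.1 * (xi.1 * bump (e * l)^-1 0 xi) + xi.2 * (xi.2 * bump (e * l)^-1 0 xi)).

Lemma profile_probe e l : 0 < e -> 0 < l -> profile_class (probe e l).
Proof.
move=> e0 l0; have P : profile_class (bump (e * l)^-1 0) by apply: profile_bump; rewrite invr_gt0 mulr_gt0.
apply: profile_scale; apply: profile_add.
  by apply: profile_fst; exact: profile_fst.
by apply: profile_snd; exact: profile_snd.
Qed.

Lemma probe_scale e l xi : 0 < e -> 0 < l -> probe e l (l *: xi) = probe e 1 xi.
Proof.
move=> e0 l0; rewrite /probe.
have -> : bump (e * l)^-1 0 (l *: xi) = bump (e * 1)^-1 0 xi.
  by congr (w 0 _); rewrite -scale_affine /radial/= mulr1 invfM; field; rewrite !gt_eqF.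
by rewrite -scale_affine/=; field; rewrite gt_eqF.
Qed.

Lemma transform_probe e l p : 0 < e -> 0 < l ->
  transform (@cos R) (probe e l) p = l ^+ 2 * transform (@cos R) (probe e 1) (l *: p).
Proof.
move=> e0 l0; rewrite {1}/transform (@integral_affine _ l 0 0 (lt0r_neq0 l0)); last first.
  by apply: integrable_transform; [exact: kernel_cos|apply: decaying_profile; exact: profile_probe].
congr (_ * _); apply: eq_Rintegral => q _; rewrite scale_affine probe_scale//.
by congr (_ * cos _); rewrite -!scale_affine /dotp /affine_map/=; ring.
Qed.

(** Measured in the units of the probe, the centre becomes l1 x0: this is the separation that later
    grows with the scale. *)
Lemma integral_bump_probe e l1 l x0 : 0 < e -> 0 < l1 -> 0 < l ->
  \int[mu2]_p (bump l x0 p * transform (@cos R) (probe e l1) p) =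
  l1 ^+ 2 * l ^- 2 *
  \int[mu2]_q (bump 1 0 q * transform (@cos R) (probe e 1) (affine_map (l1 / l) (l1 * x0) 0 q)).
Proof.
move=> e0 l10 l0.
have dG : decaying (probe e 1) by apply: decaying_profile; exact: profile_probe.
set h := fun q => transform (@cos R) (probe e 1) (affine_map (l1 / l) (l1 * x0) 0 q).
have hb : exists C, forall p, `|h p| <= C.
  have [C C0 hC] := decaying_dominated dG; exists (C * pi ^+ 2) => p.
  by apply: transform_le hC; [exact: kernel_cos|exact: decaying_measurable].
have ch : continuous h.
  move=> q; apply: (@continuous_comp _ _ _ (affine_map (l1 / l) (l1 * x0) 0)); last first.
    by apply: continuous_transform => //; exact: kernel_cos.
  exact: continuous_affine_map.
rewrite -mulrA -(@integral_bump h l x0 l0 ch hb) -RintegralZl//; last first.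
  rewrite (_ : (fun p => _) = fun p => (h \o affine_map l (- (l * x0)) 0) p * bump l x0 p); last first.
    by apply/funext => p; rewrite mulrC.
  apply: integrable_mul_profile; [|by have [C hC] := hb; exists C => p; exact: hC|exact: profile_bump].
  by move=> p; apply: continuous_comp; [exact: continuous_affine_map|exact: ch].
apply: eq_Rintegral => p _; rewrite transform_probe// mulrCA; congr (_ * (_ * transform _ _ _)).
by rewrite /affine_map /=; congr (_, _); rewrite /GRing.scale/=; field; rewrite gt_eqF.
Qed.

(** By the multiplication formula this is the integral of [amplitude] against the probe. For small
    [e] only values of [amplitude] near 0 matter, and there it is positive. *)
Lemma probe_pairing_gt0 : exists2 e, 0 < e &
  0 < \int[mu2]_q (bump 1 0 q * transform (@cos R) (probe e 1) q).
Proof.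
have [L L0 hL] := amplitude_lip; have A0 := amplitude0_gt0.
pose H q : R := q.1 * (q.1 * bump 1 0 q) + q.2 * (q.2 * bump 1 0 q).
have pB : profile_class (bump 1 0) by exact: profile_bump.
have pH : profile_class H by apply: profile_add; [apply: profile_fst; exact: profile_fst|apply: profile_snd; exact: profile_snd].
have H0 q : 0 <= H q.
  by rewrite /H !mulrA -!expr2 -mulrDl mulr_ge0 ?(ltW (bump_gt0 _ _ _))// addr_ge0// sqr_ge0.
have IH : 0 < \int[mu2]_q H q.
  apply: integral_plane_gt0 => //; first exact: integrable_profile.
  move=> x y /andP[x1 _] _; rewrite /H !mulrA -!expr2 -mulrDl mulr_gt0 ?bump_gt0//=.
  by rewrite ltr_pwDl ?sqr_ge0// exprn_gt0// (lt_le_trans _ x1).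
have dH := decaying_profile pH.
have [C C0 hC] := decaying_weight dH 1.
set I := \int[mu2]_q H q in IH.
(* Keeps the Lipschitz error L e C pi^2 below the limiting value of the dilated integral. *)
have [e e0 he] : exists2 e : R, 0 < e & L * e * C * pi ^+ 2 < amplitude 0 * I.
  have := mulr_gt0 A0 IH; move: (amplitude 0 * I) => y y0.
  have : 0 <= L * C * pi ^+ 2 by rewrite mulr_ge0 ?sqr_ge0// mulr_ge0.
  move E : (L * C * pi ^+ 2) => x x0.
  have x1 : 0 < x + 1 by rewrite ltr_wpDl.
  exists (y / (x + 1)); first exact: divr_gt0.
  have -> : L * (y / (x + 1)) * C * pi ^+ 2 = y * (x / (x + 1)).
    by rewrite (mulrCA y) -E; ring.
  by rewrite -[ltRHS]mulr1 ltr_pM2l// ltr_pdivrMr// mul1r ltrDl.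
exists e => //.
have dG : decaying (probe e 1) by apply: decaying_profile; exact: profile_probe.
rewrite -(transform_fubini kernel_cos (decaying_bump 0 (@ltr01 R)) dG) -/amplitude.
have Ab : exists C, forall p, `|amplitude p| <= C.
  by have [K _ hK] := amplitude_decay 0; exists K => p; have := hK p; rewrite mul1r.
rewrite (@integral_affine _ e 0 0 (lt0r_neq0 e0)); last first.
  by apply: integrable_mul_profile; [exact: continuous_amplitude|exact: Ab|exact: profile_probe].
have cA : continuous (fun p => amplitude (e *: p)).
  move=> p; apply: (@continuous_comp _ _ _ (fun p : R * R => e *: p) amplitude); last exact: continuous_amplitude.
  exact: scaler_continuous.
have iAH : mu2.-integrable setT (EFin \o (fun p => amplitude (e *: p) * H p)).
  by apply: integrable_mul_profile => //; have [K hK] := Ab; exists K => p.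
have HG q : probe e 1 (affine_map e 0 0 q) = e ^+ 2 * H q.
  rewrite scale_affine /probe /H.
  have -> : bump (e * 1)^-1 0 (e *: q) = bump 1 0 q.
    by congr (w 0 _); rewrite -scale_affine /radial/= mulr1; field; rewrite gt_eqF.
  by rewrite -scale_affine/=; field.
have -> : \int[mu2]_p (transform (@cos R) (bump 1 0) (affine_map e 0 0 p) * probe e 1 (affine_map e 0 0 p)) =
    e ^+ 2 * \int[mu2]_p (amplitude (e *: p) * H p).
  rewrite -RintegralZl//.
  by apply: eq_Rintegral => p _; rewrite HG scale_affine mulrCA.
rewrite !mulr_gt0 ?exprn_gt0//.
have iAH2 : mu2.-integrable setT (EFin \o (fun p => amplitude 0 * H p)).
  exact: (integrableZl measurableT (amplitude 0) (integrable_profile pH)).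
have : `|\int[mu2]_p (amplitude (e *: p) * H p) - amplitude 0 * I| <= L * e * C * pi ^+ 2.
  rewrite /I -RintegralZl//; last exact: integrable_profile.
  rewrite -RintegralB//.
  apply: integral_plane_le.
    have mH := decaying_measurable dH.
    apply: measurable_funB; apply: measurable_funM => //; exact: continuous_measurable_plane.
  move=> p; rewrite -mulrBl normrM.
  apply: (@le_trans _ _ (L * (`|(e *: p).1 - 0| + `|(e *: p).2 - 0|) * `|H p|)).
    by rewrite ler_wpM2r.
  rewrite !subr0 -scale_affine /= !addr0 !normrM (ger0_norm (ltW e0)) -mulrDr -!mulrA ler_wpM2l// ler_wpM2l ?(ltW e0)//.
  apply: le_trans (hC p); rewrite expr1 ler_wpM2r// /japanese.
  have := sqr_ge0 (`|p.1| - 1); have := sqr_ge0 (`|p.2| - 1).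
  rewrite -(real_normK (num_real p.1)) -(real_normK (num_real p.2)).
  by move: (`|p.1|) (`|p.2|) => x y; nra.
rewrite ler_norml => /andP[h _].
by lra.
Qed.

(** The bump concentrates [q] near 0, so the transform of the probe is read near [b], where it
    decays. The condition l <= 1 makes the bound uniform in [l]. *)
Lemma probe_integral_decay e : 0 < e -> exists2 C, 0 <= C & forall l b : R, 0 < l <= 1 ->
  `|\int[mu2]_q (bump 1 0 q * transform (@cos R) (probe e 1) (affine_map l b 0 q))| <= C / (1 + b ^+ 2).
Proof.
move=> e0; have sG : schwartz (probe e 1) by apply: schwartz_profile; exact: profile_probe.
have cc : @cos R = @cos R \/ @cos R = @sin R by left.
have [C C0 hC] := transform_schwartz 1 cc sG.
have dB := decaying_bump 0 (@ltr01 R).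
have [D D0 hD] := decaying_weight dB 1.
exists (2 * C * D * pi ^+ 2); first by rewrite mulr_ge0 ?sqr_ge0// mulr_ge0// mulr_ge0.
move=> l b /andP[l0 l1]; have b0 : 0 < 1 + b ^+ 2 by rewrite ltr_pwDl// sqr_ge0.
rewrite mulrAC; apply: integral_plane_le.
  apply: measurable_funM; first exact: decaying_measurable.
  apply: measurableT_comp; last exact: measurable_affine_map.
  by apply: measurable_transform; [exact: kernel_cos|exact: schwartz_decaying].
move=> q; set z := affine_map l b 0 q.
(* Peetre's inequality *)
have J : 1 + b ^+ 2 <= 2 * (japanese z * japanese q).
  have l2 : l ^+ 2 * q.1 ^+ 2 <= q.1 ^+ 2.
    by rewrite ler_piMl ?sqr_ge0// expr_le1 ?(ltW l0).
  have E : b = z.1 - l * q.1 by rewrite /z /affine_map/=; ring.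
  rewrite /japanese E; move: l2; move: (z.1) (z.2) (q.1) (q.2) => a c x y l2.
  have h1 : (a - l * x) ^+ 2 <= 2 * a ^+ 2 + 2 * x ^+ 2.
    by have := sqr_ge0 (a + l * x); nra.
  apply: (@le_trans _ _ (2 * ((1 + a ^+ 2) * (1 + x ^+ 2)))).
    by have := sqr_ge0 (a * x); nra.
  rewrite ler_pM2l// ler_pM ?addr_ge0 ?sqr_ge0// lerDl sqr_ge0//.
have Jz := japanese_gt0 z; have Jq := japanese_gt0 q.
rewrite normrM mulrAC ler_pdivlMr//.
have := hC z; have := hD q; rewrite !expr1.
move: (weight_gt0 q) (normr_ge0 (bump 1 0 q)) (normr_ge0 (transform cos (probe e 1) z)) J Jz Jq.
move: (weight q) `|bump 1 0 q| `|transform cos (probe e 1) z| (japanese z) (japanese q) (1 + b ^+ 2).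
move=> W x y jz jq B W0 x0 y0 hB jz0 jq0 hx hy.
apply: (@le_trans _ _ (x * y * (2 * (jz * jq)))); first by rewrite ler_wpM2l// mulr_ge0.
have -> : x * y * (2 * (jz * jq)) = 2 * ((jz * y) * (jq * x)) by ring.
have -> : 2 * C * D * W = 2 * (C * (D * W)) by ring.
by rewrite ler_pM2l// ler_pM// mulr_ge0// ltW.
Qed.

(** Bounding japanese(l xi)^(-s/2) by l^-s |xi|^-s gives the right power of [l] at the price of a
    singularity at 0, which the factor |xi|^2 of the probe removes because s <= 2. *)
Lemma probe_weight e s : 0 < e -> 0 <= s <= 2 -> exists2 Y, 0 <= Y & forall l xi, 0 < l ->
  `|probe e l (l *: xi)| * japanese (l *: xi) `^ (- (s / 2)) <= l `^ (- s) * Y * weight xi.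
Proof.
move=> e0 /andP[s0 s2].
have d0 : 0 < (e * 1)^-1 by rewrite invr_gt0 mulr1.
have [Y Y0 hY] := decaying_weight (decaying_bump 0 d0) 1.
exists Y => // l xi l0; rewrite probe_scale//.
have -> : probe e 1 xi = (xi.1 ^+ 2 + xi.2 ^+ 2) * bump (e * 1)^-1 0 xi.
  by rewrite /probe expr1n invr1; ring.
set r := xi.1 ^+ 2 + xi.2 ^+ 2.
have r0 : 0 <= r by rewrite addr_ge0 ?sqr_ge0.
(* The negative power of [r] used below needs r > 0; at r = 0 the probe vanishes. *)
have [->|rn0] := eqVneq r 0.
  rewrite mul0r normr0 mul0r mulr_ge0 ?(ltW (weight_gt0 _))// mulr_ge0// powR_ge0//.
have rp : 0 < r by rewrite lt_neqAle eq_sym rn0.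
have Jr : japanese xi = 1 + r by rewrite /japanese addrA.
have JE : japanese (l *: xi) = 1 + l ^+ 2 * r.
  by rewrite -scale_affine /japanese /affine_map/= /r; ring.
have h1 : japanese (l *: xi) `^ (- (s / 2)) <= l `^ (- s) * r `^ (- (s / 2)).
  have -> : l `^ (- s) * r `^ (- (s / 2)) = (l ^+ 2 * r) `^ (- (s / 2)).
    rewrite powRM ?sqr_ge0// -powR_mulrn ?(ltW l0)// -powRrM (_ : 2 * - (s / 2) = - s)//; lra.
  have lr : 0 < l ^+ 2 * r by rewrite mulr_gt0 ?exprn_gt0.
  rewrite !powRN lef_pV2 ?posrE; last 2 first.
  - by rewrite powR_gt0// japanese_gt0.
  - by rewrite powR_gt0.
  apply: ge0_ler_powR; rewrite ?nnegrE ?divr_ge0 ?(ltW lr) ?(ltW (japanese_gt0 _))//.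
  by rewrite JE lerDr.
have h2 : r * r `^ (- (s / 2)) <= japanese xi.
  rewrite -{1}(powRr1 r0) -powRD ?rn0 ?implybT//.
  apply: (@le_trans _ _ (japanese xi `^ (1 + - (s / 2)))).
    apply: ge0_ler_powR; rewrite ?nnegrE ?(ltW (japanese_gt0 _))//.
      by rewrite subr_ge0 ler_pdivrMr ?mul1r.
    by rewrite Jr lerDr.
  rewrite -[leRHS]powRr1 ?(ltW (japanese_gt0 _))//; apply: ler_powR; first exact: japanese_ge1.
  by rewrite gerDl oppr_le0 divr_ge0.
have hb := hY xi; rewrite expr1 in hb.
rewrite normrM (ger0_norm r0) -mulrA.
apply: (@le_trans _ _ (r * (`|bump (e * 1)^-1 0 xi| * (l `^ (- s) * r `^ (- (s / 2)))))).
  by rewrite -[leLHS]mulrA !ler_wpM2l.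
have -> : r * (`|bump (e * 1)^-1 0 xi| * (l `^ (- s) * r `^ (- (s / 2)))) =
  l `^ (- s) * ((r * r `^ (- (s / 2))) * `|bump (e * 1)^-1 0 xi|) by ring.
rewrite ler_wpM2l ?powR_ge0//; apply: le_trans hb.
by rewrite ler_wpM2r.
Qed.

(** * Sobolev bounds for solitary waves *)

Lemma sobolev_norm_le_schwartz f s l (N : nat) D : schwartz f -> 1 <= l -> 0 <= s <= (N * 2)%:R -> 0 <= D ->
  (forall k, k = @cos R \/ k = @sin R -> forall xi,
    japanese xi ^+ (N + 2) * `|transform k f (l *: xi)| <= l `^ (- (1 + s)) * D) ->
  (sobolev_norm s f <= D%:E)%E.
Proof.
move=> sf l1 sN D0 hD.
have cc : @cos R = @cos R \/ @cos R = @sin R by left.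
have ss : @sin R = @cos R \/ @sin R = @sin R by right.
have [C C0 hC] := transform_schwartz 2 cc sf; have [C' C'0 hC'] := transform_schwartz 2 ss sf.
apply: (sobolev_norm_le_scaled (C := C + C') (schwartz_decaying sf) l1 sN D0 _ _ (hD _ cc) (hD _ ss)) => xi.
- by apply: le_trans (hC xi) _; rewrite lerDl.
- by apply: le_trans (hC' xi) _; rewrite lerDr.
Qed.

Lemma scaleVK l xi : 0 < l -> l^-1 *: (l *: xi) = xi.
Proof. by move=> l0; rewrite scalerA mulVf ?gt_eqF// scale1r. Qed.

Definition wave c l x0 p : R := c * bump l x0 p.

Lemma profile_wave c l x0 : 0 < l -> profile_class (wave c l x0).
Proof. by move=> l0; apply: profile_scale; exact: profile_bump. Qed.

Lemma profile_sub f g : profile_class f -> profile_class g -> profile_class (f \- g).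
Proof.
move=> pf pg; rewrite (_ : f \- g = fun p => f p + -1 * g p).
  by apply: profile_add => //; exact: profile_scale.
by apply/funext => p; rewrite mulN1r.
Qed.

Lemma transform_wave (k : R -> R) c l x0 l' xi : k = @cos R \/ k = @sin R -> 0 < l ->
  transform k (wave c l x0) (l' *: xi) =
  c * l ^- 2 * (k (x0 * (l' * xi.1)) * amplitude (l^-1 *: (l' *: xi))).
Proof.
move=> hk l0; rewrite /wave transformZ; last 2 first.
- exact: kernel_cos_sin.
- exact: decaying_bump.
by rewrite -mulrA; congr (_ * _); case: hk => ->;
  rewrite (transform_cos_bump, transform_sin_bump) // -scale_affine /affine_map/= addr0.
Qed.

(** The centre enters only through a modulation of size at most 1. For the coefficient of the
    solitary wave and the critical exponent the powers of [l] will cancel. *)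
Lemma sobolev_norm_wave s (N : nat) : 0 <= s <= (N * 2)%:R -> exists2 D, 0 <= D &
  forall c l x0 : R, 1 <= l ->
  (sobolev_norm s (wave c l x0) <= (`|c| * l ^- 2 * l `^ (1 + s) * D)%:E)%E.
Proof.
move=> sN; have [D D0 hD] := amplitude_decay (N + 2)%N.
exists D => // c l x0 l1; have l0 : 0 < l by exact: lt_le_trans l1.
have L0 : 0 < l `^ (1 + s) by rewrite powR_gt0.
have c0 : 0 <= `|c| * l ^- 2 by rewrite mulr_ge0 ?invr_ge0 ?sqr_ge0.
have bd k : k = @cos R \/ k = @sin R -> forall xi,
    japanese xi ^+ (N + 2) * `|transform k (wave c l x0) (l *: xi)| <=
    l `^ (- (1 + s)) * (`|c| * l ^- 2 * l `^ (1 + s) * D).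
  move=> hk xi; have [_ k1 _] := kernel_cos_sin hk; rewrite transform_wave// scaleVK//.
  have -> : l `^ (- (1 + s)) * (`|c| * l ^- 2 * l `^ (1 + s) * D) = `|c| * l ^- 2 * D.
    by rewrite powRN; move: (l `^ (1 + s)) L0 => L L0; field; rewrite !gt_eqF.
  rewrite !normrM (ger0_norm (_ : 0 <= l ^- 2)) ?invr_ge0 ?sqr_ge0// mulrCA ler_wpM2l//.
  apply: le_trans (hD xi); rewrite ler_wpM2l ?exprn_ge0 ?(ltW (japanese_gt0 _))//.
  by rewrite ler_piMl.
apply: (sobolev_norm_le_schwartz _ l1 sN).
- by apply: schwartz_profile; exact: profile_wave.
- by rewrite mulr_ge0// mulr_ge0// ltW.
- exact: bd.
Qed.

(** Moving the centre changes the modulation by at most l |x0 - x1| |xi|, paid for by one more power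
    of [japanese]. This gives continuity in time, in every H^s. *)
Lemma sobolev_norm_wave_translate s (N : nat) : 0 <= s <= (N * 2)%:R -> exists2 D, 0 <= D &
  forall c l x0 x1 : R, 1 <= l ->
  (sobolev_norm s (wave c l x0 \- wave c l x1)%R <=
   (`|c| * l ^- 2 * l `^ (1 + s) * (l * `|x0 - x1| * D))%:E)%E.
Proof.
move=> sN; have [D D0 hD] := amplitude_decay (N + 3)%N.
exists D => // c l x0 x1 l1; have l0 : 0 < l by exact: lt_le_trans l1.
have L0 : 0 < l `^ (1 + s) by rewrite powR_gt0.
have c0 : 0 <= `|c| * l ^- 2 by rewrite mulr_ge0 ?invr_ge0 ?sqr_ge0.
have X0 : 0 <= l * `|x0 - x1| by rewrite mulr_ge0// ltW.
have bd k : k = @cos R \/ k = @sin R -> forall xi,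
    japanese xi ^+ (N + 2) * `|transform k (wave c l x0 \- wave c l x1) (l *: xi)| <=
    l `^ (- (1 + s)) * (`|c| * l ^- 2 * l `^ (1 + s) * (l * `|x0 - x1| * D)).
  move=> hk xi; have kk := kernel_cos_sin hk; have [_ _ klip] := kk.
  rewrite transformB//; last 2 first.
  - by apply: decaying_profile; exact: profile_wave.
  - by apply: decaying_profile; exact: profile_wave.
  rewrite !transform_wave// !scaleVK//.
  have -> : l `^ (- (1 + s)) * (`|c| * l ^- 2 * l `^ (1 + s) * (l * `|x0 - x1| * D)) = `|c| * l ^- 2 * (l * `|x0 - x1| * D).
    by rewrite powRN; move: (l `^ (1 + s)) L0 => L L0; field; rewrite !gt_eqF.
  rewrite -mulrBr -mulrBl !normrM (ger0_norm (_ : 0 <= l ^- 2)) ?invr_ge0 ?sqr_ge0// mulrCA ler_wpM2l//.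
  apply: (@le_trans _ _ (l * `|x0 - x1| * (japanese xi ^+ (N + 3) * `|amplitude xi|))); last first.
    by rewrite ler_wpM2l.
  have -> : l * `|x0 - x1| * (japanese xi ^+ (N + 3) * `|amplitude xi|) =
    japanese xi ^+ (N + 2) * (l * `|x0 - x1| * japanese xi * `|amplitude xi|).
    by rewrite (addnS N 2) exprS; ring.
  rewrite ler_wpM2l ?exprn_ge0 ?(ltW (japanese_gt0 _))// ler_wpM2r//.
  apply: le_trans (klip _ _) _; rewrite -mulrBl !normrM (gtr0_norm l0) mulrCA mulrA ler_wpM2l//.
  have := sqr_ge0 (`|xi.1| - 1); have := sqr_ge0 xi.2; rewrite /japanese -(real_normK (num_real xi.1)).
  by move: (`|xi.1|) => x; nra.
apply: (sobolev_norm_le_schwartz _ l1 sN).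
- by apply/schwartz_profile/profile_sub; exact: profile_wave.
- by apply: mulr_ge0; apply: mulr_ge0 => //; exact: ltW.
- exact: bd.
Qed.

(* Interpolates the Lipschitz bound with the decay of the amplitude. *)
Lemma amplitude_dilation : exists2 D, 0 <= D & forall l tau : R, 2^-1 <= l <= 1 -> l ^+ 2 <= tau <= 1 ->
  forall xi, japanese xi ^+ 3 * `|amplitude xi - tau * amplitude (l *: xi)| <= D * Num.sqrt (1 - l).
Proof.
have [L L0 hL] := amplitude_lip.
have [C C0 hC] := amplitude_decay 0.
(* 7 = 2 * 3 + 1: the product of this bound and the Lipschitz one, linear in [japanese], controls
   the square of the left-hand side. *)
have [D D0 hD] := amplitude_decay 7.
pose a := L + 2 * C; pose b := D + 4 ^+ 7 * D.
have a0 : 0 <= a by rewrite addr_ge0// mulr_ge0.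
have b0 : 0 <= b by rewrite addr_ge0// mulr_ge0// exprn_ge0.
exists (Num.sqrt (a * b)); first exact: sqrtr_ge0.
move=> l tau /andP[l2 l1] /andP[tau1 tau2] xi.
have l0 : 0 < l by apply: lt_le_trans l2; rewrite invr_gt0.
have t0 : 0 <= tau by apply: le_trans tau1; exact: sqr_ge0.
set X := `|_|; have X0 : 0 <= X by exact: normr_ge0.
have J := japanese_gt0 xi.
have l1' : 0 <= 1 - l by rewrite subr_ge0.
have h1 : X <= a * (1 - l) * japanese xi.
  have hA : `|amplitude (l *: xi)| <= C by have := hC (l *: xi); rewrite mul1r.
  have hB := hL xi (l *: xi).
  have XE : X <= `|amplitude xi - amplitude (l *: xi)| + (1 - tau) * `|amplitude (l *: xi)|.
    rewrite -[X in _ + X * _]ger0_norm ?subr_ge0// -normrM; apply: le_trans (ler_normD _ _).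
    rewrite /X; have -> // : amplitude xi - tau * amplitude (l *: xi) = amplitude xi - amplitude (l *: xi) + (1 - tau) * amplitude (l *: xi).
    by ring.
  apply: le_trans XE _.
  have e1 : `|xi.1 - (l *: xi).1| + `|xi.2 - (l *: xi).2| = (1 - l) * (`|xi.1| + `|xi.2|).
    rewrite -scale_affine /affine_map/= !addr0 -[X in `|X - _| + _]mul1r -[X in _ + `|X - _|]mul1r -!mulrBl !normrM.
    by rewrite (ger0_norm l1') mulrDr.
  have e2 : `|xi.1| + `|xi.2| <= japanese xi.
    have := sqr_ge0 (`|xi.1| - 1); have := sqr_ge0 (`|xi.2| - 1); rewrite /japanese.
    rewrite -(real_normK (num_real xi.1)) -(real_normK (num_real xi.2)).
    by move: (`|xi.1|) (`|xi.2|) => x y; nra.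
  (* 1 - tau <= 1 - l^2 <= 2 (1 - l). *)
  have e3 : (1 - tau) * `|amplitude (l *: xi)| <= 2 * (1 - l) * C.
    apply: ler_pM => //; first by rewrite subr_ge0.
    by nra.
  have e4 : 2 * (1 - l) * C <= 2 * C * (1 - l) * japanese xi.
    rewrite (mulrAC 2) -[leLHS]mulr1 ler_wpM2l ?japanese_ge1//.
    by apply: mulr_ge0 => //; exact: mulr_ge0.
  have -> : a * (1 - l) * japanese xi = L * (1 - l) * japanese xi + 2 * C * (1 - l) * japanese xi by rewrite /a; ring.
  apply: lerD; last exact: le_trans e3 e4.
  apply: le_trans hB _; rewrite e1 -mulrA ler_wpM2l// ler_wpM2l//.
have h2 : japanese xi ^+ 7 * X <= b.
  apply: (@le_trans _ _ (japanese xi ^+ 7 * (`|amplitude xi| + `|amplitude (l *: xi)|))).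
    rewrite ler_wpM2l ?exprn_ge0 ?(ltW J)//; apply: le_trans (ler_normB _ _) _.
    by rewrite lerD2l normrM ger0_norm// ler_piMl.
  rewrite mulrDr /b; apply: lerD; first exact: hD.
  apply: (@le_trans _ _ (4 ^+ 7 * (japanese (l *: xi) ^+ 7 * `|amplitude (l *: xi)|))).
    rewrite mulrA ler_wpM2r// -exprMn lerXn2r ?nnegrE ?(ltW J) ?mulr_ge0 ?(ltW (japanese_gt0 _))//.
    (* As l >= 1/2, japanese xi <= 4 japanese (l xi), whence the constant 4^7. *)
    have l4 : 1 <= 4 * l ^+ 2.
      by have := l2; rewrite -[X in X <= _]div1r ler_pdivrMr// => h; nra.
    rewrite -scale_affine /japanese /affine_map/= !addr0.
    have := sqr_ge0 xi.1; have := sqr_ge0 xi.2; move: (xi.1) (xi.2) => x y y2 x2.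
    by nra.
  by rewrite ler_wpM2l ?exprn_ge0.
rewrite -ler_sqr ?nnegrE; last 2 first.
- by rewrite mulr_ge0 ?exprn_ge0// ltW.
- by rewrite mulr_ge0 ?sqrtr_ge0.
rewrite [leRHS]exprMn !sqr_sqrtr ?mulr_ge0//.
have -> : (japanese xi ^+ 3 * X) ^+ 2 = japanese xi ^- 1 * X * (japanese xi ^+ 7 * X).
  by move: (japanese xi) J => j J; field; rewrite gt_eqF.
have -> : a * b * (1 - l) = a * (1 - l) * b by ring.
apply: ler_pM => //; rewrite ?mulr_ge0 ?invr_ge0 ?exprn_ge0 ?(ltW J)//.
by rewrite mulrC expr1 ler_pdivrMr.
Qed.

(** The waves share their centre, so the modulation factors out and there remains [amplitude] minus
    a multiple of its dilate, as in [amplitude_dilation]. *)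
Lemma sobolev_norm_wave_dilate s : 0 <= s <= 2 -> exists2 D, 0 <= D & forall c1 c2 l1 l2 x0 : R,
  1 <= l1 -> l1 <= l2 -> l2 <= 2 * l1 -> 0 < c1 ->
  (l1 / l2) ^+ 2 <= (c2 * l2 ^- 2) / (c1 * l1 ^- 2) <= 1 ->
  (sobolev_norm s (wave c1 l1 x0 \- wave c2 l2 x0)%R <=
   (c1 * l1 ^- 2 * l1 `^ (1 + s) * (D * Num.sqrt (1 - l1 / l2)))%:E)%E.
Proof.
move=> s2; have [D D0 hD] := amplitude_dilation.
exists D => // c1 c2 l1 l2 x0 l11 l12 l22 c10 tau.
have l10 : 0 < l1 by exact: lt_le_trans l11.
have l20 : 0 < l2 by exact: lt_le_trans l12.
have L0 : 0 < l1 `^ (1 + s) by rewrite powR_gt0.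
have d0 : 0 < c1 * l1 ^- 2 by rewrite mulr_gt0// invr_gt0 exprn_gt0.
have lam : 2^-1 <= l1 / l2 <= 1.
  rewrite ler_pdivrMr// mul1r l12 andbT ler_pdivlMr//; lra.
have bd k : k = @cos R \/ k = @sin R -> forall xi,
    japanese xi ^+ (1 + 2) * `|transform k (wave c1 l1 x0 \- wave c2 l2 x0) (l1 *: xi)| <=
    l1 `^ (- (1 + s)) * (c1 * l1 ^- 2 * l1 `^ (1 + s) * (D * Num.sqrt (1 - l1 / l2))).
  move=> hk xi; have kk := kernel_cos_sin hk; have [_ k1 _] := kk.
  rewrite transformB//; last 2 first.
  - by apply: decaying_profile; exact: profile_wave.
  - by apply: decaying_profile; exact: profile_wave.
  rewrite !transform_wave// !scaleVK//.
  have -> : l1 `^ (- (1 + s)) * (c1 * l1 ^- 2 * l1 `^ (1 + s) * (D * Num.sqrt (1 - l1 / l2))) =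
      c1 * l1 ^- 2 * (D * Num.sqrt (1 - l1 / l2)).
    rewrite powRN; move: (l1 `^ (1 + s)) (Num.sqrt _) L0 => L S L0; field; rewrite !gt_eqF//.
  have -> : l2^-1 *: (l1 *: xi) = (l1 / l2) *: xi by rewrite scalerA mulrC.
  have -> : c1 * l1 ^- 2 * (k (x0 * (l1 * xi.1)) * amplitude xi) -
      c2 * l2 ^- 2 * (k (x0 * (l1 * xi.1)) * amplitude ((l1 / l2) *: xi)) =
      c1 * l1 ^- 2 * (k (x0 * (l1 * xi.1)) * (amplitude xi - (c2 * l2 ^- 2) / (c1 * l1 ^- 2) * amplitude ((l1 / l2) *: xi))).
    move: (amplitude xi) (amplitude _) (k _) => A B K; field; rewrite !gt_eqF//.
  rewrite normrM (ger0_norm (ltW d0)) mulrCA ler_wpM2l ?(ltW d0)//.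
  apply: le_trans (hD _ _ lam tau xi); rewrite ler_wpM2l ?exprn_ge0 ?(ltW (japanese_gt0 _))//.
  by rewrite normrM ler_piMl.
apply: (sobolev_norm_le_schwartz (N := 1) _ l11) => //.
- by apply/schwartz_profile/profile_sub; exact: profile_wave.
- by apply: mulr_ge0; apply: mulr_ge0; rewrite ?sqrtr_ge0// ltW.
Qed.

(** * The waves solve the equation and are continuous in time *)

Lemma gradient_derive f p a b : gradient f p a b -> dx f p = a /\ dy f p = b.
Proof.
move=> [_ h]; split; rewrite /dx /dy.
  by have [_ ->] := h (1, 0); rewrite /= mulr1 mulr0 addr0.
by have [_ ->] := h (0, 1); rewrite /= mulr1 mulr0 add0r.
Qed.

Lemma gradient_wave c l x0 p : gradient (wave c l x0) p
  (c * (w 1 (radial l x0 p) * (l ^+ 2 / 2 * (p.1 - x0)))) (c * (w 1 (radial l x0 p) * (l ^+ 2 / 2 * p.2))).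
Proof.
by apply: (gradient_eq (gradient_mul (gradient_cst p c) (gradient_base 0 l x0 p))); ring.
Qed.

Lemma laplacian_wave c l x0 p :
  laplacian (wave c l x0) p = l ^+ 2 * (wave c l x0 p - c * bump l x0 p ^+ deg.+1).
Proof.
have dxE : dx (wave c l x0) = fun q => c * (w 1 (radial l x0 q) * (l ^+ 2 / 2 * (q.1 - x0))).
  by apply/funext => q; have [-> _] := gradient_derive (gradient_wave c l x0 q).
have dyE : dy (wave c l x0) = fun q => c * (w 1 (radial l x0 q) * (l ^+ 2 / 2 * q.2)).
  by apply/funext => q; have [_ ->] := gradient_derive (gradient_wave c l x0 q).
have G1 := gradient_mul (gradient_cst p c) (gradient_mul (gradient_base 1 l x0 p)
  (gradient_mul (gradient_cst p (l ^+ 2 / 2)) (gradient_add (gradient_fst p) (gradient_cst p (- x0))))).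
have G2 := gradient_mul (gradient_cst p c) (gradient_mul (gradient_base 1 l x0 p)
  (gradient_mul (gradient_cst p (l ^+ 2 / 2)) (gradient_snd p))).
rewrite /laplacian dxE dyE; have [-> _] := gradient_derive G1; have [_ ->] := gradient_derive G2.
have s0 : u0 < radial l x0 p by apply: lt_le_trans (radial_ge0 l x0 p).
rewrite /wave /bump -mulrBr -w_ode// /radial; by field.
Qed.

(** The condition on [c] turns the x-derivative of c l^2 bump^(k+1) into u^k u_x for the wave u. *)
Lemma dx_laplacian_wave c l x0 p : c ^+ deg = deg.+1%:R * l ^+ 2 ->
  dx (laplacian (wave c l x0)) p = l ^+ 2 * dx (wave c l x0) p - wave c l x0 p ^+ deg * dx (wave c l x0) p.
Proof.
move=> ck; have -> : laplacian (wave c l x0) = fun q => l ^+ 2 * (c * (bump l x0 q + -1 * bump l x0 q ^+ deg.+1)).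
  by apply/funext => q; rewrite laplacian_wave /wave; ring.
have Gb := gradient_base 0 l x0 p.
have Gp := gradient_comp (derive_exp deg.+1 (derive_id (w 0 (radial l x0 p)))) Gb.
have G := gradient_mul (gradient_cst p (l ^+ 2)) (gradient_mul (gradient_cst p c)
  (gradient_add Gb (gradient_mul (gradient_cst p (-1)) Gp))).
have [-> _] := gradient_derive G; have [-> _] := gradient_derive (gradient_wave c l x0 p).
rewrite /wave exprMn ck /bump -pred_Sn.
ring.
Qed.

(** Travelling at speed l^2 gives u_t = - l^2 u_x, which cancels the linear term left by
    [dx_laplacian_wave]. *)
Lemma wave_solves T c l x0 : c ^+ deg = deg.+1%:R * l ^+ 2 -> 0 < l ->
  solves_gZK deg T (fun t => wave c l (x0 + l ^+ 2 * t)).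
Proof.
move=> ck l0 t p _.
have W : profile_class (wave c l (x0 + l ^+ 2 * t)) by exact: profile_wave.
have [_ _] := schwartz_profile W.
have D : is_derive t 1 (fun s => wave c l (x0 + l ^+ 2 * s) p) (- l ^+ 2 * dx (wave c l (x0 + l ^+ 2 * t)) p).
  have [-> _] := gradient_derive (gradient_wave c l (x0 + l ^+ 2 * t) p).
  have u1 : u0 < radial l (x0 + l ^+ 2 * t) p by apply: lt_le_trans (radial_ge0 _ _ _).
  have h1 := derive_sub (derive_cst p.1 t) (derive_add (derive_cst x0 t) (derive_scale (l ^+ 2) (derive_id t))).
  have h2 := derive_scale (l ^+ 2 / 4) (derive_add (derive_mul h1 h1) (derive_cst (p.2 ^+ 2) t)).
  have E s : radial l (x0 + l ^+ 2 * s) p = l ^+ 2 / 4 * ((p.1 - (x0 + l ^+ 2 * s)) * (p.1 - (x0 + l ^+ 2 * s)) + p.2 ^+ 2).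
    by rewrite /radial expr2 mulrAC.
  have h3 := derive_ext (fun s => esym (E s)) h2.
  have h4 := derive_scale c (derive_comp (f := w 0) (g := fun s => radial l (x0 + l ^+ 2 * s) p) (w_derive 0 u1) h3).
  by apply: (derive_eq h4); field.
split.
- by have [sm _] := schwartz_profile W; exact: sm.
- by case: D.
- by have [_ ->] := D; rewrite dx_laplacian_wave//; ring.
Qed.

Lemma wave_continuous_Hs s T c l x0 : 1 <= l -> 0 <= s ->
  continuous_Hs s T (fun t => wave c l (x0 + l ^+ 2 * t)).
Proof.
move=> l1 s0; have [N sN] : exists N, 0 <= s <= (N * 2)%:R.
  exists (Num.truncn s).+1; rewrite s0/=; apply: le_trans (ltW (truncnS_gt s)) _.
  by rewrite ler_nat leq_pmulr.
split=> [t _|t0 _].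
  have [D D0 hD] := sobolev_norm_wave sN.
  exact: le_lt_trans (hD c l _ l1) (ltry _).
have [D D0 hD] := sobolev_norm_wave_translate sN.
pose K := `|c| * l ^- 2 * l `^ (1 + s) * (l * l ^+ 2 * D).
have l0 : 0 <= l by apply: le_trans l1.
have K0 : 0 <= K.
  by rewrite /K; apply: mulr_ge0; apply: mulr_ge0; rewrite ?mulr_ge0 ?invr_ge0 ?sqr_ge0 ?powR_ge0.
have bd t : (sobolev_norm s (wave c l (x0 + l ^+ 2 * t) \- wave c l (x0 + l ^+ 2 * t0))%R <= (K * `|t - t0|)%:E)%E.
  apply: le_trans (hD c l _ _ l1) _; rewrite lee_fin le_eqVlt; apply/orP; left; apply/eqP.
  rewrite (_ : x0 + l ^+ 2 * t - (x0 + l ^+ 2 * t0) = l ^+ 2 * (t - t0)); last by ring.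
  by rewrite normrM (ger0_norm (sqr_ge0 l)) /K; ring.
have ge0 f : (0 <= sobolev_norm s f)%E.
  by apply/ereal_infP => _ [g [h [_ ->]]]; exact: Lnorm_ge0.
apply: (@squeeze_cvge _ _ _ _ (fun=> 0%E) _ (fun t => (K * `|t - t0|)%:E)).
  by near=> t; rewrite ge0 bd.
  exact: cvg_cst.
apply: cvg_within_filter; apply: cvg_EFin; first exact: nearW.
have : {for t0, continuous (fun t => K * `|t - t0|)}.
  apply: (@continuous_lipschitz _ _ K) => x y.
  rewrite -mulrBr normrM (ger0_norm K0) ler_wpM2l// (le_trans (ler_dist_dist _ _))//.
  by rewrite opprB addrA subrK.
by rewrite /prop_for /continuous_at subrr normr0 mulr0; exact.
Unshelve. all: by end_near.
Qed.

(** The first wave, centred at 0 and at the scale of the probe, contributes a fixed positive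
    integral; the second one carries the displacement. *)
Lemma probe_pairing_wave e l1 c1 l2 c2 x0 : 0 < e -> 0 < l1 -> 0 < l2 ->
  \int[mu2]_p ((wave c1 l1 0 \- wave c2 l2 x0) p * fourier_re (probe e l1) p) =
  (2 * pi)^-1 * (c1 * \int[mu2]_q (bump 1 0 q * transform (@cos R) (probe e 1) q) -
    c2 * (l1 ^+ 2 * l2 ^- 2 *
    \int[mu2]_q (bump 1 0 q * transform (@cos R) (probe e 1) (affine_map (l1 / l2) (l1 * x0) 0 q)))).
Proof.
move=> e0 l10 l20.
have pP : profile_class (probe e l1) by exact: profile_probe.
have dP := decaying_profile pP.
have cP := continuous_transform kernel_cos dP.
have bP : exists C, forall p, `|transform (@cos R) (probe e l1) p| <= C.
  have [C C0 hC] := decaying_dominated dP; exists (C * pi ^+ 2) => p.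
  by apply: transform_le hC; [exact: kernel_cos|exact: decaying_measurable].
have I l x : 0 < l -> mu2.-integrable setT (EFin \o (fun p => bump l x p * transform (@cos R) (probe e l1) p)).
  move=> l0; rewrite (_ : (fun p => _) = fun p => transform (@cos R) (probe e l1) p * bump l x p).
    by apply: (integrable_mul_profile cP bP); exact: profile_bump.
  by apply/funext => p; rewrite mulrC.
rewrite (_ : (fun p => _) = fun p => (2 * pi)^-1 * (c1 * (bump l1 0 p * transform (@cos R) (probe e l1) p) -
    c2 * (bump l2 x0 p * transform (@cos R) (probe e l1) p))); last first.
  by apply/funext => p; rewrite fourier_reE /wave /=; ring.
have Z c l x : 0 < l -> mu2.-integrable setT (EFin \o (fun p => c * (bump l x p * transform (@cos R) (probe e l1) p))).
  by move=> l0; exact: (integrableZl measurableT c (I l x l0)).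
rewrite RintegralZl//; last first.
  have := integrableB measurableT (Z c1 l1 0 l10) (Z c2 l2 x0 l20); exact.
rewrite RintegralB//; [|exact: Z|exact: Z].
rewrite !RintegralZl//; [|exact: I|exact: I].
have E1 := integral_bump_probe 0 e0 l10 l10.
have E2 := integral_bump_probe x0 e0 l10 l20.
have e1 : l1 ^+ 2 / l1 ^+ 2 = 1 by rewrite divff// sqrf_eq0 gt_eqF.
have e2 : l1 / l1 = 1 by rewrite divff// gt_eqF.
have A1 : affine_map 1 0 0 = id :> (R * R -> R * R) by apply/funext => q; rewrite scale_affine scale1r.
by rewrite E1 E2 mulr0 e1 e2 mul1r A1.
Qed.

(** * Critical scaling and failure of uniform continuity *)

Definition coefficient l : R := deg.+1%:R `^ deg%:R^-1 * l `^ (2 / deg%:R).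

(** The second clause makes the wave solve the equation; the third is criticality, 2/k - 2 + 1 + s_c
    = 0. *)
Lemma coefficientP l : (2 <= deg)%N -> 0 < l ->
  [/\ 0 < coefficient l, coefficient l ^+ deg = deg.+1%:R * l ^+ 2 &
      coefficient l * l ^- 2 * l `^ (1 + s_crit R deg) = deg.+1%:R `^ deg%:R^-1].
Proof.
move=> k2 l0; have k0 : (deg%:R : R) != 0 by rewrite pnatr_eq0 -lt0n (leq_trans _ k2).
have P (x a : R) : (x `^ a) ^+ deg = x `^ (a * deg%:R) by rewrite -powR_mulrn ?powR_ge0// powRrM.
split; first by rewrite mulr_gt0// powR_gt0.
  by rewrite /coefficient exprMn !P mulVf// powRr1// mulfVK// powR_mulrn// ltW.
have -> : l ^- 2 = l `^ (- 2%:R) by rewrite powRN powR_mulrn// ltW.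
rewrite /coefficient -!mulrA -!powRD ?(gt_eqF l0) ?implybT//.
rewrite (_ : 2 / deg%:R + (- 2%:R + (1 + s_crit R deg)) = 0) ?powRr0 ?mulr1// /s_crit.
by field.
Qed.

(** The ratio is (l1 / l2)^(2 - 2/k) with 0 <= 2/k <= 1, which lies in the range that
    [amplitude_dilation] accepts. *)
Lemma coefficient_ratio l1 l2 : (2 <= deg)%N -> 0 < l1 -> l1 <= l2 ->
  (l1 / l2) ^+ 2 <= (coefficient l2 * l2 ^- 2) / (coefficient l1 * l1 ^- 2) <= 1.
Proof.
move=> k2 l10 l12; have l20 := lt_le_trans l10 l12.
have k0 : 0 < (deg%:R : R) by rewrite ltr0n (leq_trans _ k2).
have m0 : 0 < deg.+1%:R `^ deg%:R^-1 :> R by rewrite powR_gt0.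
set q : R := 2 / deg%:R; have q0 : 0 <= q by rewrite divr_ge0// ltW.
have q1 : 0 <= 1 - q by rewrite subr_ge0 ler_pdivrMr// mul1r ler_nat.
have P0 : 0 < l1 `^ q by rewrite powR_gt0.
have Q0 : 0 < l2 `^ q by rewrite powR_gt0.
have P12 : l1 `^ q <= l2 `^ q by apply: ge0_ler_powR => //; rewrite nnegrE ltW.
have S l : 0 < l -> l = l `^ q * l `^ (1 - q).
  by move=> l0; rewrite -powRD ?(gt_eqF l0) ?implybT// addrC subrK powRr1// ltW.
have P12' : l2 `^ q * l1 <= l1 `^ q * l2.
  rewrite [X in _ * X <= _](S _ l10) [X in _ <= _ * X](S _ l20) !mulrA (mulrC (l2 `^ q)).
  rewrite ler_wpM2l ?mulr_ge0 ?powR_ge0//.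
  by apply: ge0_ler_powR => //; rewrite nnegrE ltW.
have -> : (coefficient l2 * l2 ^- 2) / (coefficient l1 * l1 ^- 2) = (l1 / l2) ^+ 2 * (l2 `^ q / l1 `^ q).
  rewrite /coefficient -/q; move: (_ `^ _) (l1 `^ _) (l2 `^ _) m0 P0 => m a b m0 a0.
  by field; rewrite (gt_eqF a0) (gt_eqF m0) (gt_eqF l10) (gt_eqF l20).
apply/andP; split.
  by rewrite ler_peMr ?sqr_ge0// ler_pdivlMr// mul1r.
rewrite expr_div_n mulf_div ler_pdivrMr ?mulr_gt0 ?exprn_gt0// mul1r.
apply: (@le_trans _ _ (l1 * l2 * l1 `^ q)).
  rewrite (_ : l1 ^+ 2 * l2 `^ q = l1 * (l2 `^ q * l1)); last by ring.
  by rewrite -mulrA ler_wpM2l ?(ltW l10)// (mulrC l2).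
by rewrite ler_wpM2r ?(ltW P0)// expr2 ler_wpM2r// ltW.
Qed.

Lemma ill_posed T : (3 <= deg)%N -> 0 < T -> ~ uniformly_continuous_Hs (s_crit R deg) T (data_solution deg T).
Proof.
move=> k3 T0; have k2 : (2 <= deg)%N by exact: ltnW.
set s := s_crit R deg.
have k0 : 0 < (deg%:R : R) by rewrite ltr0n (leq_trans _ k2).
have s02 : 0 <= s <= 2.
  rewrite /s /s_crit subr_ge0 ler_pdivrMr// mul1r ler_nat k2/=.
  have : 0 <= 2 / deg%:R :> R by rewrite divr_ge0// ltW.
  lra.
have s12 : 0 <= s <= (1 * 2)%:R by rewrite mul1n.
set m : R := deg.+1%:R `^ deg%:R^-1; have m0 : 0 < m by rewrite powR_gt0.
pose c := coefficient.
have [D D0 hD] := sobolev_norm_wave s12.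
have [E E0 hE] := sobolev_norm_wave_dilate s02.
have [e e0 I0] := probe_pairing_gt0.
set I := \int[mu2]_q _ in I0.
have [J J0 hJ] := probe_integral_decay e0.
have [Y Y0 hY] := probe_weight e0 s02.
have p0 : 0 < pi :> R := pi_gt0 R.
have Z0 : 0 < 2 * (2 * pi * Y * pi + 1) by rewrite mulr_gt0// ltr_wpDl// !mulr_ge0// ltW.
(* Decoupled waves have pairing at least (2 pi)^-1 c(n) I / 2, whereas a distance below [eps] allows
   at most eps n^(1-s) Y pi; this choice makes the two incompatible. The added 1 keeps the
   denominator positive. *)
pose eps := m * I / (2 * (2 * pi * Y * pi + 1)).
have eps0 : 0 < eps by apply: divr_gt0 => //; exact: mulr_gt0.
move=> /(_ (m * D) eps eps0)[d d0 hd].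
(* Two demands on the scale: the bound m E (n + 1)^(-1/2) on the initial distance falls below [d],
   and at time [T] the second wave takes away at most half of the pairing of the first. *)
have [n n1 [hn1 hn2]] : exists2 n : R, 1 <= n & m * (E * Num.sqrt (1 - n / (n + 1))) < d /\
    J / (1 + (n * (n * T)) ^+ 2) <= I / 2.
  have A0 : 0 <= (m * E) ^+ 2 / d ^+ 2 by rewrite divr_ge0 ?sqr_ge0.
  have B0 : 0 <= 2 * J / (I * T ^+ 2) by rewrite divr_ge0 ?mulr_ge0 ?sqr_ge0// ltW.
  exists (1 + (m * E) ^+ 2 / d ^+ 2 + 2 * J / (I * T ^+ 2)).
    by rewrite -addrA lerDl addr_ge0.
  set n := 1 + _ + _; have n1 : 1 <= n by rewrite /n -addrA lerDl addr_ge0.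
  have nA : (m * E) ^+ 2 / d ^+ 2 < n + 1 by rewrite /n; lra.
  have nB : 2 * J / (I * T ^+ 2) <= n by rewrite /n; lra.
  have n0 : 0 < n by exact: lt_le_trans n1.
  have n10 : 0 < n + 1 by exact: addr_gt0.
  split.
    have -> : 1 - n / (n + 1) = (n + 1)^-1 by field; rewrite gt_eqF.
    have mE : 0 <= m * E by rewrite mulr_ge0// ltW.
    rewrite mulrA -ltr_sqr ?nnegrE ?(ltW d0) ?(mulr_ge0 mE) ?sqrtr_ge0//.
    by rewrite exprMn sqr_sqrtr ?invr_ge0 ?(ltW n10)// ltr_pdivrMr// -ltr_pdivrMl ?exprn_gt0// mulrC.
  have IT : 0 < I * T ^+ 2 by rewrite mulr_gt0// exprn_gt0.
  rewrite ler_pdivrMr in nB => //.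
  rewrite ler_pdivrMr ?ltr_pwDl ?sqr_ge0//.
  have n4 : n * T ^+ 2 <= (n * (n * T)) ^+ 2.
    rewrite mulrA exprMn ler_wpM2r ?sqr_ge0//.
    have : n * 1 <= n * n by rewrite ler_wpM2l// ltW.
    by rewrite mulr1; move: (n * n) => z nz; nra.
  have := ler_wpM2l (ltW I0) n4; move: nB; rewrite mulrA (mulrCA n) mulrA.
  move: (_ ^+ 2) (I * n * T ^+ 2) => z y; nra.
have n0 : 0 < n by exact: lt_le_trans n1.
have n10 : 0 < n + 1 by exact: addr_gt0.
have n11 : 1 <= n + 1 by rewrite lerDr ltW.
have [c1 ck1 cs1] := coefficientP k2 n0.
have [c2 ck2 cs2] := coefficientP k2 n10.
rewrite -/m -/c in c1 ck1 cs1 c2 ck2 cs2.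
(* The common initial centre -n^2 T brings the first wave to the origin at time [T], where the
   transform of the probe is centred. *)
pose u t := wave (c n) n (- (n ^+ 2 * T) + n ^+ 2 * t).
pose v t := wave (c (n + 1)) (n + 1) (- (n ^+ 2 * T) + (n + 1) ^+ 2 * t).
have Su : data_solution deg T (u 0, u).
  split=> //=; first exact: wave_solves.
  by move=> r r0; exact: wave_continuous_Hs.
have Sv : data_solution deg T (v 0, v).
  split=> //=; first exact: wave_solves.
  by move=> r r0; exact: wave_continuous_Hs.
have bu : (sobolev_norm s (u 0%R) <= (m * D)%:E)%E.
  by apply: le_trans (hD _ _ _ n1) _; rewrite gtr0_norm// cs1.
have bv : (sobolev_norm s (v 0%R) <= (m * D)%:E)%E.
  by apply: le_trans (hD _ _ _ n11) _; rewrite gtr0_norm// cs2.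
have duv : (sobolev_norm s (u 0 \- v 0)%R < d%:E)%E.
  rewrite /u /v !mulr0 !addr0.
  have n12 : n <= n + 1 by rewrite lerDl.
  have n22 : n + 1 <= 2 * n by lra.
  apply: le_lt_trans (hE _ _ _ _ _ n1 n12 n22 c1 (coefficient_ratio k2 n0 n12)) _.
  by rewrite cs1 lte_fin.
have TT : T \in `[0, T] by rewrite in_itv/= lexx ltW.
have fin : (sobolev_norm s (u T \- v T)%R < eps%:E)%E.
  apply: le_lt_trans (hd _ _ _ _ Su Sv bu bv duv).
  by apply: ereal_sup_ubound; exists T.
have hY' xi : `|probe e n (n *: xi)| * japanese (n *: xi) `^ (- (s / 2)) <= n `^ (- s) * Y * weight xi by exact: hY.
have sP : schwartz (probe e n).
  by apply: (schwartz_profile); exact: profile_probe.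
have Y1 : 0 <= n `^ (- s) * Y by rewrite mulr_ge0// powR_ge0.
have := sobolev_norm_pairing sP n0 Y1 fin hY'.
pose x1 := - (n ^+ 2 * T) + (n + 1) ^+ 2 * T.
rewrite (_ : u T = wave (c n) n 0); last by rewrite /u addNr.
rewrite (_ : v T = wave (c (n + 1)) (n + 1) x1)// probe_pairing_wave// -/I.
set K := \int[mu2]_q (_ * transform _ _ (affine_map _ _ _ _)).
have nn1 : 0 < n / (n + 1) <= 1 by rewrite divr_gt0//= ler_pdivrMr// mul1r lerDl.
have hK : `|K| <= I / 2.
  apply: le_trans (hJ _ (n * x1) nn1) _; apply: le_trans hn2; rewrite ler_wpM2l//.
  have x1n : n * T <= x1.
    have -> : x1 = (2 * n + 1) * T by rewrite /x1; ring.
    by rewrite ler_wpM2r ?(ltW T0)//; lra.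
  have b0 : 0 < 1 + (n * (n * T)) ^+ 2 by rewrite ltr_pwDl// sqr_ge0.
  rewrite lef_pV2 ?posrE// ?ltr_pwDl ?sqr_ge0// lerD2l lerXn2r ?nnegrE ?mulr_ge0 ?(ltW n0) ?(ltW T0)//.
    by apply: le_trans x1n; rewrite mulr_ge0 ?ltW.
  by rewrite ler_wpM2l// ltW.
have := coefficient_ratio k2 n0 (_ : n <= n + 1); rewrite -/c lerDl => /(_ ler01)/andP[_ rat].
have c21 : c (n + 1) * (n ^+ 2 * (n + 1) ^- 2) <= c n.
  move: rat; rewrite ler_pdivrMr ?mul1r; last by rewrite mulr_gt0// invr_gt0 exprn_gt0.
  by rewrite ler_pdivlMr ?exprn_gt0// -mulrA (mulrC (_ ^- 2)).
(* Criticality again: c(n) grows exactly like the factor n^(1-s) of the duality bound, so the lower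
   bound does not degrade with [n]. *)
have ns : n * n `^ (- s) * m = c n.
  rewrite /c /coefficient mulrC; congr (_ * _); rewrite -{1}(powRr1 (ltW n0)) -powRD ?(gt_eqF n0) ?implybT//.
  by congr (_ `^ _); rewrite /s /s_crit; ring.
have low : c n * (I / 2) <= c n * I - c (n + 1) * (n ^+ 2 * (n + 1) ^- 2 * K).
  have : `|c (n + 1) * (n ^+ 2 / (n + 1) ^+ 2) * K| <= c n * (I / 2).
    have q0 : 0 <= c (n + 1) * (n ^+ 2 / (n + 1) ^+ 2).
      by apply: (mulr_ge0 (ltW c2)); rewrite mulr_ge0 ?invr_ge0 ?sqr_ge0.
    by rewrite normrM (ger0_norm q0); exact: ler_pM.
  rewrite [c (n + 1) * (_ * K)]mulrA; move: (_ * K) (c n) => z y; rewrite ler_norml => /andP[_ zl]; lra.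
move=> up.
have : (2 * pi)^-1 * (c n * (I / 2)) <= eps * (n * (n `^ (- s) * Y) * pi).
  apply: le_trans up; apply: le_trans (ler_norm _).
  by rewrite ler_wpM2l// invr_ge0 mulr_ge0// ltW.
apply/negP; rewrite -ltNge -ns.
have N0 : 0 < n * n `^ (- s) by rewrite mulr_gt0// powR_gt0.
have -> : eps * (n * (n `^ (- s) * Y) * pi) = n * n `^ (- s) * (eps * (Y * pi)) by ring.
have -> : (2 * pi)^-1 * (n * n `^ (- s) * m * (I / 2)) = n * n `^ (- s) * (m * I / (4 * pi)).
  have gen (a b r q z : R) : z != 0 -> (2 * z)^-1 * (a * b * r * (q / 2)) = a * b * (r * q / (4 * z)).
    by move=> z0; field.
  by apply: gen; rewrite gt_eqF.
rewrite ltr_pM2l// ltr_pdivlMr ?mulr_gt0//.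
have -> : m * I = eps * (2 * (2 * pi * Y * pi + 1)) by rewrite /eps mulfVK ?gt_eqF.
by rewrite -[X in X < _]mulrA ltr_pM2l//; move: (pi : R) (Y) => x y; lra.
Qed.

End SolitaryWave.

Theorem theorem1p3 (R : realType) (k : nat) (hk : (3 <= k)%N)
    (T : R) (hT : 0 < T) :
  ~ uniformly_continuous_Hs (s_crit R k) T (data_solution k T).
Proof.
(* The exponent of the profile equation is p = k + 1. *)
have [w [u0 [u0_lt0 w_derive w_ode w_pos w_rapid]]] := ground_profile_smooth R (leqW (ltnW hk)).
exact: (ill_posed u0_lt0 w_derive w_rapid w_pos w_ode hk hT).
Qed.
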